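(* For every positive integer $k$, let $\{Z_k(t)\}_{t\ge0}$ be a continuous time centered Gaussian process with non-negative correlation function $A_k(\cdot,\cdot)$ and continuous sample paths. Further, let $\{Z_\infty(t)\}_{t\ge0}$ be a stationary centered Gaussian process with continuous sample paths and non-negative correlation function $A_\infty(\cdot)$. Assume that, for every $\tau\ge0$, $A_k(s,s+\tau)$ converges to $A_\infty(\tau)$ as $k\to\infty$, uniformly in $s\ge0$. Suppose further that the following conditions hold. (a) Setting $g_k(\tau):=\sup_{s\ge0}A_k(s,s+\tau)$, for every positive integer $\ell$ we have $$\lim_{L\to\infty}\limsup_{k\to\infty}\sum_{i=L}^\infty g_k(i/\ell)=0.$$ (b) There exists an $\eta>1$ such that $$\limsup_{\varepsilon\downarrow0}|\log\varepsilon|^\eta\sup_{1\le k\le\infty,\ s\ge0,\ \tau\in[0,\varepsilon]}\big(1-A_k(s,s+\tau)\big)<\infty ,$$ where $A_\infty(s,s+\tau):=A_\infty(\tau)$. (c) The limiting process $\{Z_\infty(t)\}_{t\ge0}$ has a persistence exponent which is sampling continuous, i.e. for every $r\in\mathbb{R}$ $$\limsup_{\ell\to\infty}\limsup_{T\to\infty}\frac1T\Big|\log\mathbb{P}\Big(\sup_{t\in[0,T]}Z_\infty(t)<r\Big)-\log\mathbb{P}\Big(\max_{1\le i\le\lceil T\ell\rceil}Z_\infty(i/\ell)<r\Big)\Big|=0.$$ Then for every $r\in\mathbb{R}$ we have $$\limsup_{k,T\to\infty}\frac1T\Big|\log\mathbb{P}\Big(\sup_{t\in[0,T]}Z_k(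t)<r\Big)-\log\mathbb{P}\Big(\sup_{t\in[0,T]}Z_\infty(t)<r\Big)\Big|=0.$$
   Context: All processes have unit variance, so that correlation functions are covariance functions: $\mathbb{E}[Z_k(s)Z_k(t)]=A_k(s,t)$ with $A_k(s,s)=1$, and $\mathbb{E}[Z_\infty(s)Z_\infty(t)]=A_\infty(|s-t|)$ with $A_\infty(0)=1$. The notation $\limsup_{k,T\to\infty}a(k,T)$ denotes the joint upper limit, i.e. the limit as $M\to\infty$ of $\sup_{k\ge M,\,T\ge M}a(k,T)$. *)

(* Defs.v *)
From mathcomp Require Export all_boot all_order all_algebra.
From mathcomp Require Export all_classical all_reals all_analysis.
Export numFieldNormedType.Exports.
Set Implicit Arguments.
Unset Strict Implicit.
Unset Printing Implicit Defensive.
Import Order.TTheory GRing.Theory Num.Theory.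
Local Open Scope classical_set_scope.
Local Open Scope ring_scope.

(* A continuous-time process is a family [Z : R -> {RV P >-> R}] of which only
   the restriction to nonnegative times is ever used. *)

(* Gaussian law with mean [m] and standard deviation [s], degenerate case
   included: [normal_prob m 0] is not the Dirac mass in the library. *)
Definition gaussian_law (R : realType) (m s : R) (V : set R) : \bar R :=
  if s == 0 then \d_m V else normal_prob m s V.

Definition is_gaussian (d : measure_display) (Omega : measurableType d)
    (R : realType) (P : probability Omega R) (X : Omega -> R) : Prop :=
  exists m s : R, 0 <= s /\
    forall V : set R, measurable V -> pushforward P X V = gaussian_law m s V.

(* The finite-dimensional distributions are multivariate normal (possibly
   degenerate): every linear combination of the coordinates is normal. *)
Definition gaussian_process (d : measure_display) (Omega : measurableType d)
    (R : realType) (P : probability Omega R) (Z : R -> {RV P >-> R}) : Prop :=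
  forall (n : nat) (t c : 'I_n -> R), (forall i, 0 <= t i) ->
    is_gaussian P (fun w => \sum_(i < n) c i * Z (t i) w).

Definition centered_process (d : measure_display) (Omega : measurableType d)
    (R : realType) (P : probability Omega R) (Z : R -> {RV P >-> R}) : Prop :=
  forall t : R, 0 <= t -> 'E_P[Z t]%E = 0%E.

Definition stationary_process (d : measure_display) (Omega : measurableType d)
    (R : realType) (P : probability Omega R) (Z : R -> {RV P >-> R}) : Prop :=
  forall (n : nat) (t : 'I_n -> R) (h : R), (forall i, 0 <= t i) -> 0 <= h ->
    forall V : set (n.-tuple R), measurable V ->
      pushforward P (fun w => [tuple Z (t i + h) w | i < n]) V =
      pushforward P (fun w => [tuple Z (t i) w | i < n]) V.

Definition continuous_paths (d : measure_display) (Omega : measurableType d)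
    (R : realType) (P : probability Omega R) (Z : R -> {RV P >-> R}) : Prop :=
  forall w : Omega, {within `[0, +oo[, continuous (fun t : R => Z t w)}.

Definition has_covariance (d : measure_display) (Omega : measurableType d)
    (R : realType) (P : probability Omega R) (Z : R -> {RV P >-> R})
    (C : R -> R -> R) : Prop :=
  forall s t : R, 0 <= s -> 0 <= t ->
    'E_P[fun w => (Z s w * Z t w)%R]%E = (C s t)%:E.

Definition prob_sup_lt (d : measure_display) (Omega : measurableType d)
    (R : realType) (P : probability Omega R) (Z : R -> {RV P >-> R})
    (T r : R) : \bar R :=
  P [set w | (ereal_sup [set (Z t w)%:E | t in `[0%R, T]] < r%:E)%E].

(* The maximum is taken in [\bar R] (-oo when there is no index). *)
Definition prob_max_lt (d : measure_display) (Omega : measurableType d)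
    (R : realType) (P : probability Omega R) (Z : R -> {RV P >-> R})
    (l : nat) (T r : R) : \bar R :=
  P [set w | (\big[maxe/-oo]_(1 <= i < (`|Num.ceil (T * l%:R)|%N).+1)
                (Z (i%:R / l%:R) w)%:E < r%:E)%E].

Definition sup_corr (R : realType) (A : R -> R -> R) (tau : R) : \bar R :=
  ereal_sup [set (A s (s + tau))%:E | s in `[0, +oo[].

(* Supremum of 1 - A_k(s, s + tau) over 1 <= k <= oo, s >= 0 and
   0 <= tau <= eps; the value for k = oo is 1 - Ainf tau. *)
Definition sup_decorr (R : realType) (A : nat -> R -> R -> R) (Ainf : R -> R)
    (eps : R) : \bar R :=
  ereal_sup
    ([set x | exists k s tau, [/\ (1 <= k)%N, 0 <= s, 0 <= tau <= eps &
                 x = (1 - A k s (s + tau))%:E]] `|`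
     [set (1 - Ainf tau)%:E | tau in `[0, eps]]).

Definition joint_limsup (R : realType) (a : nat -> R -> \bar R) : \bar R :=
  limn (fun M : nat =>
    ereal_sup [set a p.1 p.2 |
      p in [set p : nat * R | (M <= p.1)%N /\ M%:R <= p.2]]).

(* Main.v *)
(* Upper bound: the supremum over [0, T] dominates the maximum over the points
   i / l.  Interpolating between Z_k and Z_oo on this grid costs a factor
   exp (C sum_ij (A_k - A_oo)^+) and a shift h of the level; by (a) and the
   uniform convergence the exponent is o(1) per grid point.  The shift is removed
   by differentiating the probability in the level along the vector of row sums of
   the covariance matrix, a direction whose Cameron-Martin functional is the sum
   of the coordinates, of variance O(T); then (c) applies.  Lower bound: since the
   correlations are nonnegative, Slepian's inequality bounds P(sup_[0,T] Z_k < r)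
   from below by the product over blocks of length M.  On one block the law of Z_k
   is close to that of Z_oo uniformly in the position of the block, by the same
   interpolation on a finite grid and a chaining argument from (b).  Finally M is
   chosen such that log P(sup_[0,M] Z_oo < r) / M nearly attains its supremum.
   Gaussian vectors only enter through their characteristic functions: indicators
   are approximated by trigonometric polynomials of the coordinates. *)

Require Import Defs.
From mathcomp Require Import measurable_realfun ring lra.
Set Implicit Arguments.
Unset Strict Implicit.
Unset Printing Implicit Defensive.
Import Order.TTheory GRing.Theory Num.Theory.
Local Open Scope classical_set_scope.
Local Open Scope ring_scope.

(** * Test functions *)

(** Covariance matrices may be singular, which rules out Gaussian densities and inverse matrices.
    Against a trigonometric polynomial an expectation is a finite sum of values of the
    characteristic function, so derivatives along the interpolation and along the shift are computed
    term by term. The price is periodicity: a test function is monotone only on a window [-B, B],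
    and B grows after the logarithmic slope C is fixed. A test function is moreover only close to an
    indicator, with an error k at every coordinate, while the number N of grid points grows with T.
    A factor (1 + c k)^N is harmless on the exponential scale; an error added to the probability is
    not. Non-negative correlations make the error multiplicative: a discarded coordinate is restored
    at the cost 1 / P(Z < r). Likewise the level shift runs Gronwall at a rate b of order N, so that
    its additive remainder falls below P(Z < r)^N, itself a lower bound of the probability. In the
    lower bound the block length is fixed before k grows, so additive errors and crude estimates
    suffice there. *)

Section bernstein.
Variable R : realType.
Implicit Types (c : nat -> R) (y g : R) (N : nat).

(* de Casteljau's recursion for sum_(k <= N) c_k 'C(N, k) y^k (1-y)^(N-k). *)
Fixpoint bernstein N c y : R :=
  if N is N'.+1
  then (1 - y) * bernstein N' c y + y * bernstein N' (fun k => c k.+1) y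
  else c 0%N.

Lemma ler_bernstein N c c' y : 0 <= y <= 1 -> (forall k, c k <= c' k) ->
  bernstein N c y <= bernstein N c' y.
Proof.
move=> /andP[y0 y1]; elim: N c c' => [|N IH] c c' cc'; first exact: cc'.
rewrite /= lerD// ler_wpM2l ?subr_ge0//; apply: IH => // k.
Qed.

Lemma bernstein_cst N a y : bernstein N (fun=> a) y = a.
Proof. by elim: N => //= N ->; ring. Qed.

Lemma bernsteinZ N a c y :
  bernstein N (fun k => a * c k) y = a * bernstein N c y.
Proof. by elim: N c => //= N IH c; rewrite !IH; ring. Qed.

Lemma bernsteinD N c c' y :
  bernstein N (fun k => c k + c' k) y = bernstein N c y + bernstein N c' y.
Proof. by elim: N c c' => //= N IH c c'; rewrite !IH; ring. Qed.

(** The second moment about [a] of a binomial variable: variance plus squared distance from the mean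
    to [a]. *)
Lemma bernstein_sqr N a y :
  bernstein N (fun k => (k%:R - a) ^+ 2) y =
  N%:R * (y * (1 - y)) + (N%:R * y - a) ^+ 2.
Proof.
elim: N a => [|N IH] a /=; first by ring.
have E k : (k.+1%:R - a) ^+ 2 = (k%:R - (a - 1)) ^+ 2 :> R.
  by rewrite -natr1; ring.
rewrite IH; under [X in bernstein N X]eq_fun do rewrite E.
by rewrite IH -natr1; ring.
Qed.

Lemma is_derive_bernstein N c y : is_derive y 1 (bernstein N c)
  (N%:R * (bernstein N.-1 (fun k => c k.+1) y - bernstein N.-1 c y)).
Proof.
elim: N c => [|N IH] c /=; first by rewrite mul0r; exact: is_derive_cst.
have H1 := IH c; have H2 := IH (fun k => c k.+1).
apply: is_derive_eq; rewrite /GRing.scale/=.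
case: N IH H1 H2 => [|N] _ _ _ /=; first by ring.
by rewrite -(natr1 N.+1); ring.
Qed.

(** Chebyshev's inequality: [c k - a] vanishes near the mean and is at most 1 elsewhere, hence is
    dominated by the quadratic [q], whose binomial expectation is a variance; y (1 - y) <= 1/4 gives
    the constant. *)
Lemma bernstein_tail N c y d a : (0 < N)%N -> 0 <= y <= 1 -> 0 < d ->
  (forall k, `|c k - a| <= 1) ->
  (forall k, (k%:R / N%:R - y) ^+ 2 < d ^+ 2 -> c k = a) ->
  `|bernstein N c y - a| <= (4 * N%:R * d ^+ 2)^-1.
Proof.
move=> N0 y01 d0 c1 ca.
have NR0 : 0 < N%:R :> R by rewrite ltr0n.
have /andP[y0 y1] := y01.
pose q k : R := (N%:R * d) ^- 2 * (k%:R - N%:R * y) ^+ 2.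
have cq k : `|c k - a| <= q k.
  have [lt|ge] := ltP ((k%:R / N%:R - y) ^+ 2) (d ^+ 2).
    by rewrite ca// subrr normr0 /q mulr_ge0 ?invr_ge0 ?sqr_ge0.
  apply: (le_trans (c1 k)).
  rewrite /q mulrC ler_pdivlMr ?exprn_gt0 ?mulr_gt0// mul1r.
  have -> : k%:R - N%:R * y = N%:R * (k%:R / N%:R - y).
    by rewrite mulrBr mulrCA divff ?mulr1 ?gt_eqF.
  by rewrite !exprMn ler_pM2l ?exprn_gt0.
have bq : bernstein N q y <= (4 * N%:R * d ^+ 2)^-1.
  rewrite /q bernsteinZ bernstein_sqr subrr expr0n addr0.
  have -> : (4 * N%:R * d ^+ 2)^-1 = (N%:R * d) ^- 2 * (N%:R * 4^-1).
    by field; rewrite !gt_eqF.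
  rewrite ler_wpM2l ?invr_ge0 ?sqr_ge0// ler_wpM2l ?(ltW NR0)//.
  by have := sqr_ge0 (2 * y - 1); nra.
rewrite ler_norml; apply/andP; split.
  rewrite lerBrDr -[X in _ + X](bernstein_cst N a y).
  apply: (@le_trans _ _ (bernstein N (fun k => -1 * q k + a) y)).
    by rewrite bernsteinD bernsteinZ mulN1r lerD2r lerN2.
  apply: ler_bernstein => // k; rewrite mulN1r.
  by have := cq k; rewrite ler_norml => /andP[+ _]; rewrite lerBrDr.
rewrite lerBlDr -[X in _ + X](bernstein_cst N a y).
apply: (@le_trans _ _ (bernstein N (fun k => q k + a) y)).
  apply: ler_bernstein => // k.
  by have := cq k; rewrite ler_norml => /andP[_]; rewrite lerBlDr.
by rewrite bernsteinD lerD2r.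
Qed.

Lemma bernstein_mono N c y : 0 <= y <= 1 -> (forall k, c k <= c k.+1) ->
  bernstein N c y <= bernstein N (fun k => c k.+1) y.
Proof. by move=> y01 H; exact: ler_bernstein. Qed.

(** One more trial cannot lower the expectation of a nondecreasing sequence. *)
Lemma bernstein_prev N c y : 0 <= y <= 1 -> (forall k, c k <= c k.+1) ->
  bernstein N c y <= bernstein N.+1 c y.
Proof.
move=> /[dup] y01 /andP[y0 y1] H /=.
have := bernstein_mono N y01 H; nra.
Qed.

(** A bound on the ratio of consecutive coefficients becomes a bound on the logarithmic derivative.
    This is the origin of |f'| <= C f for the test functions. *)
Lemma bernstein_deriv_bound N c y g : 0 <= y <= 1 -> 0 <= g ->
  (forall k, c k <= c k.+1) -> (forall k, 0 <= c k) ->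
  (forall k, c k.+1 <= (1 + g) * c k) ->
  0 <= N%:R * (bernstein N.-1 (fun k => c k.+1) y - bernstein N.-1 c y)
    <= N%:R * g * bernstein N c y.
Proof.
move=> y01 g0 cm c0 cg; case: N => [|N] /=; first by rewrite !mul0r lexx.
have m1 := bernstein_mono N y01 cm.
rewrite mulr_ge0 ?subr_ge0//= -mulrA ler_wpM2l//.
have := bernstein_prev N y01 cm => /= m2.
have m3 : bernstein N (fun k => c k.+1) y <= (1 + g) * bernstein N c y.
  by rewrite -bernsteinZ; apply: ler_bernstein.
have m4 := ler_wpM2l g0 m2; lra.
Qed.

End bernstein.

(** * Trigonometric polynomials in several variables *)

Section trig_poly.
Variables (R : realType) (I : finType).
Implicit Types (F G : (I -> R) -> R) (x c : I -> R).

(** Each triple is an amplitude, a frequency vector and a phase. With phases allowed, cosines alone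
    are closed under products and sines need no separate treatment. *)
Definition trig_poly F := exists s : seq (R * (I -> R) * R),
  forall x, F x = \sum_(q <- s) q.1.1 * cos (\sum_i q.1.2 i * x i + q.2).

Lemma trig_poly_wave c th : trig_poly (fun x => cos (\sum_i c i * x i + th)).
Proof. by exists [:: (1, c, th)] => x; rewrite big_seq1 /= mul1r. Qed.

Lemma trig_poly_cst a : trig_poly (fun=> a).
Proof.
exists [:: (a, fun=> 0, 0)] => x; rewrite big_seq1 /= addr0.
by rewrite big1 ?cos0 ?mulr1// => i _; rewrite mul0r.
Qed.

Lemma trig_polyD F G : trig_poly F -> trig_poly G ->
  trig_poly (fun x => F x + G x).
Proof.
move=> [s Fs] [s' Gs']; exists (s ++ s') => x.
by rewrite big_cat/= Fs Gs'.
Qed.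

Lemma trig_polyM F G : trig_poly F -> trig_poly G ->
  trig_poly (fun x => F x * G x).
Proof.
move=> [s Fs] [s' Gs'].
pose m (e : R) (p q : R * (I -> R) * R) :=
  (p.1.1 * q.1.1 / 2, fun i => p.1.2 i + e * q.1.2 i, p.2 + e * q.2).
exists ([seq m 1 p q | p <- s, q <- s'] ++ [seq m (-1) p q | p <- s, q <- s']).
move=> x; rewrite big_cat/= !big_allpairs_dep/= -big_split/= Fs big_distrl/=.
apply: eq_bigr => p _; rewrite -big_split/= Gs' big_distrr/=.
apply: eq_bigr => q _.
have E e : \sum_i (p.1.2 i + e * q.1.2 i) * x i + (p.2 + e * q.2) =
    (\sum_i p.1.2 i * x i + p.2) + e * (\sum_i q.1.2 i * x i + q.2).
  rewrite mulrDr mulr_sumr addrACA -big_split/=; congr (_ + _).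
  by apply: eq_bigr => i _; ring.
rewrite !E; move: (\sum_i p.1.2 i * x i + p.2) (\sum_i q.1.2 i * x i + q.2).
by move=> a b; rewrite mul1r mulN1r cosD cosB; field.
Qed.

Lemma trig_poly_prod (f : I -> (I -> R) -> R) : (forall i, trig_poly (f i)) ->
  trig_poly (fun x => \prod_i f i x).
Proof.
move=> fT; elim: (index_enum I) => [|i s IH].
  by under eq_fun do rewrite big_nil; exact: trig_poly_cst.
by under eq_fun do rewrite big_cons; exact: trig_polyM.
Qed.

End trig_poly.

(** * Smooth substitutes for indicators *)

Section test_function.
Variable R : realType.
Implicit Types r h k C B : R.

(* A smooth decreasing substitute for the indicator of ]-oo, r]: a Bernstein
   polynomial in (1 - sin (x / B)) / 2, hence monotone on [-B, B] only.  The bound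
   |f'| <= C f, with C independent of B, makes Gronwall's lemma applicable. *)
Definition test_function r h k C B (f : R -> R) : Prop :=
  [/\ forall (I : finType) (i : I), trig_poly (fun x : I -> R => f (x i)),
      forall x, 0 < f x <= 1,
      exists f' : R -> R, forall x : R, [/\ is_derive x 1 f (f' x),
        `|f' x| <= C * f x & `|x| <= B -> f' x <= 0],
      forall x, - B <= x -> x <= r -> 1 - k <= f x &
      forall x, r + h <= x -> x <= B -> f x <= 2 * k].

Lemma near0_cos_ge_half : exists2 e : R, 0 < e &
  forall z : R, `|z| <= e -> 2^-1 <= cos z.
Proof.
have /cvgrPdist_lt/(_ 2^-1) : cos z @[z --> (0:R)] --> (1:R).
  by rewrite -cos0; exact: continuous_cos.
have h2 : 0 < 2^-1 :> R by rewrite invr_gt0.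
move=> /(_ h2)/nbhs_ballP[e /= e0 H].
exists (e / 2); first by rewrite divr_gt0.
move=> z ze; have : ball (0:R) e z.
  by rewrite /ball/= sub0r normrN; lra.
by move=> /H /=; rewrite ltr_norml => /andP[_]; lra.
Qed.

Lemma cos_ge0_norm1 (z : R) : `|z| <= 1 -> 0 <= cos z.
Proof.
rewrite ler_norml => /andP[z1 z2]; apply: cos_ge0_pihalf.
have := pihalf_ge1 R => pi1.
by rewrite (le_trans z2)// andbT (le_trans _ z1)// lerN2.
Qed.

Lemma sin_increment (a b m : R) : a <= b ->
  (forall z, a <= z <= b -> m <= cos z) -> m * (b - a) <= sin b - sin a.
Proof.
move=> ab H.
have cs : {within `[a, b], continuous (@sin R)}.
  by apply: continuous_subspaceT => x; exact: continuous_sin.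
have [c] := MVT_segment ab (fun x _ => is_derive_sin x) cs.
by rewrite in_itv/= => cab ->; rewrite ler_wpM2r ?subr_ge0// H.
Qed.

Lemma sin_le_norm1 (a b : R) : -1 <= a -> a <= b -> b <= 1 -> sin a <= sin b.
Proof.
move=> a1 ab b1; rewrite -subr_ge0 -(mul0r (b - a)).
apply: sin_increment => // z /andP[az zb].
by apply: cos_ge0_norm1; rewrite ler_norml; lra.
Qed.

Lemma trig_poly_bernstein (I : finType) (y : (I -> R) -> R) N c :
  trig_poly y -> trig_poly (fun x => bernstein N c (y x)).
Proof.
move=> yT; elim: N c => [|N IH] c /=; first exact: trig_poly_cst.
apply: trig_polyD; apply: trig_polyM => //.
have -> : (fun x => 1 - y x) = (fun x => 1 + (-1) * y x).
  by apply/funext => x; rewrite mulN1r.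
apply: trig_polyD; first exact: trig_poly_cst.
by apply: trig_polyM => //; exact: trig_poly_cst.
Qed.

Definition clip01 (u : R) : R := Num.min 1 (Num.max 0 u).

Lemma clip01_bounds u : 0 <= clip01 u <= 1.
Proof.
rewrite /clip01 ge_min lexx/= le_min ler01/= le_max lexx//.
Qed.

Lemma clip01_le0 u : u <= 0 -> clip01 u = 0.
Proof. by move=> u0; rewrite /clip01 (max_idPl u0) min_r. Qed.

Lemma clip01_ge1 u : 1 <= u -> clip01 u = 1.
Proof. by move=> u1; rewrite /clip01 min_l// le_max u1 orbT. Qed.

Lemma clip01_lip u e : 0 <= e -> clip01 u <= clip01 (u + e) <= clip01 u + e.
Proof.
move=> e0; rewrite /clip01 /Num.min /Num.max.
by case: (ltP 0 u) => ?; case: (ltP 0 (u + e)) => ?; do 10?[case: ltP => ?]; lra.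
Qed.

(** The slope constant is the product of the degree N, the relative step g = 1 / (N v k) of the
    coefficients and the slope w / 2 of [y]. As v = w h / 12, both N and w cancel, which leaves 6 /
    (h k), whatever the window. *)
Lemma test_function_exists r h k : 0 < h -> 0 < k < 1 ->
  exists2 C, 0 <= C & exists B0, forall B, B0 <= B ->
    exists f, test_function r h k C B f.
Proof.
move=> h0 /andP[k0 k1].
exists (6 / (h * k)); first by rewrite divr_ge0// mulr_ge0// ltW.
have [e e0 He] := near0_cos_ge_half.
(* Beyond this threshold [r] and [r + h], rescaled by 1 / B, fall where cos >= 1/2, so that [y]
   decreases between them at a known rate; both also lie in the window. *)
exists (Num.max 1 ((`|r| + h) / Num.min e 1)) => B.
rewrite ge_max => /andP[B1 Be].
have B0 : 0 < B by lra.
have /andP[ra rb] : - `|r| <= r <= `|r| by rewrite -ler_norml.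
pose w := B^-1.
have w0 : 0 < w by rewrite invr_gt0.
have me0 : 0 < Num.min e 1 by rewrite lt_min e0 ltr01.
have wB : w * B = 1 by rewrite mulVf// gt_eqF.
have wr : w * (`|r| + h) <= Num.min e 1.
  move: Be; rewrite ler_pdivrMr// => Be.
  by rewrite mulrC ler_pdivrMr// mulrC.
pose y (x : R) := (1 - sin (w * x)) / 2.
have y01 x : 0 <= y x <= 1.
  by have := sin_le1 (w * x); have := sin_geN1 (w * x); rewrite /y; lra.
have me1 : Num.min e 1 <= 1 by rewrite ge_min lexx orbT.
have y_anti u z : - B <= u -> u <= z -> z <= B -> y z <= y u.
  move=> uB uz zB; have : sin (w * u) <= sin (w * z).
    by apply: sin_le_norm1; rewrite ?ler_pM2l// -?wB -?mulrN ler_pM2l.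
  by rewrite /y; lra.
have rhB : `|r| + h <= B by rewrite -(ler_pM2l w0) wB (le_trans wr).
(* The drop of [y] from [r] to [r + h] is at least w h / 4 = 3 v: one [v] for the ramp of the
   coefficients and one on each side for Chebyshev's inequality. *)
pose v := w * h / 12.
have v0 : 0 < v by rewrite !mulr_gt0// invr_gt0.
have Dy : y r - y (r + h) >= 3 * v.
  have : 2^-1 * (w * (r + h) - w * r) <= sin (w * (r + h)) - sin (w * r).
    apply: sin_increment; first by rewrite ler_pM2l//; lra.
    move=> z /andP[z1 z2]; apply: He.
    apply: (@le_trans _ _ (w * (`|r| + h))); last first.
      by rewrite (le_trans wr)// ge_min lexx.
    have /(ler_wpM2l (ltW w0)) := ra; have /(ler_wpM2l (ltW w0)) := rb.
    have := mulr_gt0 w0 h0.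
    by move=> *; rewrite ler_norml; nra.
  by rewrite /y /v; lra.
pose y1 := y (r + h) + v.
have vN : v != 0 by rewrite gt_eqF.
have [N N0 HN] : exists2 N, (0 < N)%N & (4 * N%:R * v ^+ 2)^-1 <= k.
  pose z := Num.ceil ((4 * v ^+ 2 * k)^-1); exists `|z|%N.+1 => //.
  set N := `|z|%N.+1.
  have : (4 * v ^+ 2 * k)^-1 <= N%:R.
    apply: (le_trans (ceil_ge _)); rewrite -/z {}/N; move: z => z.
    by rewrite -natr1 natr_absz (@le_trans _ _ `|z|%:~R) ?ler_int ?ler_norm// lerDl.
  have p0 : 0 < 4 * v ^+ 2 by rewrite mulr_gt0 ?exprn_gt0.
  rewrite -[leLHS]div1r ler_pdivrMr ?mulr_gt0// => H.
  rewrite -[leLHS]div1r ler_pdivrMr ?mulr_gt0 ?exprn_gt0 ?ltr0n//.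
  lra.
have NR0 : 0 < N%:R :> R by rewrite ltr0n.
(* The coefficients stay above [k], so that an additive step g k is also a relative step [g]. *)
pose c (i : nat) := k + (1 - k) * clip01 ((i%:R / N%:R - y1) / v).
pose g := (N%:R * v * k)^-1.
have g0 : 0 <= g by rewrite invr_ge0 !mulr_ge0// ltW.
have cb i : k <= c i <= 1.
  by have := clip01_bounds ((i%:R / N%:R - y1) / v); rewrite /c; nra.
have cS i : c i <= c i.+1 <= c i + g * k.
  have -> : g * k = (N%:R * v)^-1.
    by rewrite /g invfM divfK// gt_eqF.
  have p0 : 0 <= (N%:R * v)^-1 by rewrite invr_ge0 mulr_ge0// ltW.
  have := clip01_lip ((i%:R / N%:R - y1) / v) p0.
  have -> : (i%:R / N%:R - y1) / v + (N%:R * v)^-1 = (i.+1%:R / N%:R - y1) / v.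
    by rewrite -natr1; field; rewrite vN gt_eqF.
  by rewrite /c; nra.
have cm i : c i <= c i.+1 by have /andP[] := cS i.
have c0 i : 0 <= c i by have /andP[? _] := cb i; lra.
have cg i : c i.+1 <= (1 + g) * c i.
  have /andP[_ H1] := cS i; have /andP[H2 _] := cb i.
  by have := ler_wpM2l g0 H2; lra.
pose p : R -> R := bernstein N c.
pose p' (z : R) := N%:R * (bernstein N.-1 (fun i => c i.+1) z - bernstein N.-1 c z).
have p'b z : 0 <= z <= 1 -> 0 <= p' z <= N%:R * g * p z.
  by move=> z01; exact: bernstein_deriv_bound.
have pb z : 0 <= z <= 1 -> k <= p z <= 1.
  move=> z01; rewrite -{1}(bernstein_cst N k z) -(bernstein_cst N 1 z).
  by rewrite !ler_bernstein// => i; have /andP[] := cb i.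
exists (p \o y); split.
- move=> I i; apply: trig_poly_bernstein.
  have -> : (fun x : I -> R => y (x i)) = (fun x : I -> R => 2^-1 + (- 2^-1) *
      cos (\sum_j (if j == i then w else 0) * x j + (- (pi / 2)))).
    apply/funext => x; rewrite cosBpihalf (bigD1 i)//= eqxx big1 ?addr0.
      by rewrite /y; lra.
    by move=> j /negbTE ->; rewrite mul0r.
  apply: trig_polyD; first exact: trig_poly_cst.
  by apply: trig_polyM; [exact: trig_poly_cst|exact: trig_poly_wave].
- by move=> x; have := pb _ (y01 x) => /=; lra.
- exists (fun x => p' (y x) * (- (w * cos (w * x)) / 2)) => x.
  have /andP[q0 q1] := p'b _ (y01 x); have /andP[pk _] := pb _ (y01 x).
  split.
  + apply: is_derive1_comp; first exact: is_derive_bernstein.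
    have dw : is_derive x 1 (fun x => w * x) w.
      by apply: is_derive_eq; rewrite /GRing.scale/= mulr1.
    have ds : is_derive x 1 (@sin R \o (fun x => w * x)) (cos (w * x) * w).
      exact: is_derive1_comp.
    rewrite /y; apply: is_derive_eq; rewrite /GRing.scale/=; lra.
  + rewrite normrM (ger0_norm q0) mulNr normrN !normrM (gtr0_norm w0).
    have -> : `|2^-1 : R| = 2^-1 by rewrite ger0_norm.
    have c1 := cos_max (w * x).
    have -> : 6 / (h * k) = N%:R * g * (w / 2).
      by rewrite /g /v; field; rewrite !gt_eqF.
    have -> : N%:R * g * (w / 2) * (p \o y) x = N%:R * g * p (y x) * (w / 2).
      by rewrite /=; ring.
    apply: ler_pM => //.
      by rewrite !mulr_ge0 ?(ltW w0).
    by rewrite ler_pM2r ?invr_gt0// ler_piMr// ltW.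
  + move=> xB; rewrite mulNr mulrN oppr_le0 mulr_ge0// mulr_ge0 ?invr_ge0//.
    rewrite mulr_ge0 ?(ltW w0)// cos_ge0_norm1// normrM (gtr0_norm w0).
    by rewrite -wB ler_pM2l.
- move=> x xB xr /=.
  have yx : y r <= y x.
    by apply: y_anti; lra.
  have : `|p (y x) - 1| <= (4 * N%:R * v ^+ 2)^-1.
    apply: bernstein_tail => //.
      by move=> i; have := cb i => /andP[? ?]; rewrite ler_norml; lra.
    move=> i H.
    rewrite /c clip01_ge1 ?mulr1; first by lra.
    rewrite ler_pdivlMr// mul1r /y1.
    have : - v < i%:R / N%:R - y x.
      rewrite ltNge; apply/negP => H'; move: H; rewrite ltNge => /negP[].
      by nra.
    by lra.
  by rewrite ler_norml => /andP[]; lra.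
- move=> x xr xB /=.
  have yx : y x <= y (r + h).
    by apply: y_anti; lra.
  have : `|p (y x) - k| <= (4 * N%:R * v ^+ 2)^-1.
    apply: bernstein_tail => //.
      by move=> i; have := cb i => /andP[? ?]; rewrite ler_norml; lra.
    move=> i H.
    rewrite /c clip01_le0 ?mulr0 ?addr0//.
    rewrite pmulr_lle0 ?invr_gt0// /y1.
    have : i%:R / N%:R - y x < v.
      by rewrite ltNge; apply/negP => H'; move: H; rewrite ltNge => /negP[]; nra.
    by lra.
  by rewrite ler_norml => /andP[]; lra.
Qed.

End test_function.

(** * Comparison of Gaussian vectors *)

Section bounded_expectation.
Context d (T : measurableType d) (R : realType) (P : probability T R).
Implicit Types f g : T -> R.

Definition bmf f := measurable_fun setT f /\ exists M, forall w, `|f w| <= M.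

Lemma bmf_integrable f : bmf f -> P.-integrable setT (EFin \o f).
Proof.
move=> [mf [M fM]]; apply: (@le_integrable _ _ _ P _ measurableT _ (cst M%:E)).
- exact/measurable_EFinP.
- by move=> w _ /=; rewrite lee_fin (le_trans (fM w))// ler_norm.
- apply/integrableP; split; first exact: measurable_cst.
  by rewrite integral_cst//= probability_setT mule1 ltry.
Qed.

Lemma bmf_cst (a : R) : bmf (fun=> a).
Proof. by split; [exact: measurable_cst|exists `|a|]. Qed.

Lemma bmfD f g : bmf f -> bmf g -> bmf (fun w => f w + g w).
Proof.
move=> [mf [M fM]] [mg [N gN]]; split; first exact: measurable_funD.
by exists (M + N) => w; rewrite (le_trans (ler_normD _ _))// lerD.
Qed.

Lemma bmfM f g : bmf f -> bmf g -> bmf (fun w => f w * g w).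
Proof.
move=> [mf [M fM]] [mg [N gN]]; split; first exact: measurable_funM.
by exists (M * N) => w; rewrite normrM ler_pM.
Qed.

Lemma bmfZ (a : R) f : bmf f -> bmf (fun w => a * f w).
Proof. exact/bmfM/bmf_cst. Qed.

Lemma bmf_sum (I : Type) (s : seq I) (F : I -> T -> R) :
  (forall i, bmf (F i)) -> bmf (fun w => \sum_(i <- s) F i w).
Proof.
move=> FB; elim: s => [|i s IH].
  by under eq_fun do rewrite big_nil; exact: bmf_cst.
by under eq_fun do rewrite big_cons; exact: bmfD.
Qed.

Lemma bmf_prod (I : Type) (s : seq I) (A : pred I) (F : I -> T -> R) :
  (forall i, bmf (F i)) -> bmf (fun w => \prod_(i <- s | A i) F i w).
Proof.
move=> FB; elim: s => [|i s IH].
  by under eq_fun do rewrite big_nil; exact: bmf_cst.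
under eq_fun do rewrite big_cons.
by case: (A i) => //; exact: bmfM.
Qed.

Lemma bmf_indic (A : set T) : measurable A -> bmf (\1_A : T -> R).
Proof.
move=> mA; split; first exact: measurable_indic.
exists 1 => w; rewrite indicE; case: (w \in A) => /=; first by rewrite normr1.
by rewrite normr0 ler01.
Qed.

Lemma bmf_cos f : measurable_fun setT f -> bmf (fun w => cos (f w)).
Proof.
move=> mf; split; last by exists 1 => w; exact: cos_max.
apply: (measurableT_comp _ mf).
by apply: continuous_measurable_fun; exact: continuous_cos.
Qed.

Lemma bmf_comp (h : R -> R) f (M : R) : continuous h ->
  (forall x, `|h x| <= M) -> measurable_fun setT f -> bmf (fun w => h (f w)).
Proof.
move=> ch hM mf; split; last by exists M => w; exact: hM.
apply: (measurableT_comp _ mf).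
exact: continuous_measurable_fun.
Qed.

Lemma Ex_le f g : bmf f -> bmf g -> (forall w, f w <= g w) ->
  \int[P]_w f w <= \int[P]_w g w.
Proof.
move=> /bmf_integrable fi /bmf_integrable gi fg.
by apply: le_Rintegral => // w _; exact: fg.
Qed.

Lemma ExD f g : bmf f -> bmf g ->
  \int[P]_w (f w + g w) = \int[P]_w f w + \int[P]_w g w.
Proof. by move=> /bmf_integrable fi /bmf_integrable gi; rewrite RintegralD. Qed.

Lemma ExZ a f : bmf f -> \int[P]_w (a * f w) = a * \int[P]_w f w.
Proof. by move=> /bmf_integrable fi; rewrite RintegralZl. Qed.

Lemma Ex_cst a : \int[P]_w a = a.
Proof.
rewrite Rintegral_cst// [fine _](_ : _ = 1) ?mulr1//.
exact: (congr1 fine (probability_setT P)).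
Qed.

Lemma Ex_sum (I : Type) (s : seq I) (F : I -> T -> R) :
  (forall i, bmf (F i)) ->
  \int[P]_w (\sum_(i <- s) F i w) = \sum_(i <- s) \int[P]_w F i w.
Proof.
move=> FB; elim: s => [|i s IH].
  by rewrite big_nil; under eq_Rintegral do rewrite big_nil; exact: Ex_cst.
rewrite big_cons -IH -ExD//; last exact: bmf_sum.
by apply: eq_Rintegral => w _; rewrite big_cons.
Qed.

Definition pr (A : set T) : R := fine (P A).

Lemma prE A : measurable A -> (pr A)%:E = P A.
Proof. by move=> mA; rewrite /pr fineK// fin_num_measure. Qed.

Lemma pr_ge0 A : 0 <= pr A.
Proof. exact/fine_ge0/measure_ge0. Qed.

Lemma pr_le A B : measurable A -> measurable B -> A `<=` B -> pr A <= pr B.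
Proof. by move=> mA mB AB; rewrite -lee_fin !prE// le_measure// ?inE. Qed.

Lemma pr_le1 A : measurable A -> pr A <= 1.
Proof. by move=> mA; rewrite -lee_fin prE// probability_le1. Qed.

Lemma Ex_indic A : measurable A -> \int[P]_w (\1_A w) = pr A.
Proof. by move=> mA; rewrite /Rintegral integral_indic// setIT. Qed.

Lemma prU_le A B : measurable A -> measurable B ->
  pr (A `|` B) <= pr A + pr B.
Proof.
move=> mA mB; rewrite -lee_fin EFinD !prE//; last exact: measurableU.
exact: measureU2.
Qed.

End bounded_expectation.

Section product_expectation.
Context d1 (T1 : measurableType d1) d2 (T2 : measurableType d2) (R : realType).
Variables (P : probability T1 R) (Q : probability T2 R).

Lemma bmf_fst (f : T1 -> R) : bmf f -> bmf (fun z : T1 * T2 => f z.1).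
Proof.
move=> [mf [M fM]]; split; last by exists M.
exact: (measurableT_comp mf measurable_fst).
Qed.

Lemma bmf_snd (f : T2 -> R) : bmf f -> bmf (fun z : T1 * T2 => f z.2).
Proof.
move=> [mf [M fM]]; split; last by exists M.
exact: (measurableT_comp mf measurable_snd).
Qed.

Lemma Ex_indep (f : T1 -> R) (g : T2 -> R) : bmf f -> bmf g ->
  \int[(P \x Q)%E]_z (f z.1 * g z.2) = \int[P]_x f x * \int[Q]_y g y.
Proof.
move=> bf bg; rewrite -[LHS]/(fine _).
have bfg : bmf (fun z : T1 * T2 => f z.1 * g z.2).
  by apply: bmfM; [exact: bmf_fst|exact: bmf_snd].
have := integral12_prod_meas1 (bmf_integrable (P \x Q)%E bfg) => /= <-.
transitivity (fine (\int[P]_x ((f x)%:E * (\int[Q]_y g y)%:E)))%E.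
  congr fine; apply: eq_integral => x _; rewrite /fubini_F/=.
  under eq_integral do rewrite EFinM.
  rewrite integralZl//; last exact: bmf_integrable.
  congr (_ * _)%E; rewrite fineK//.
  exact/integrable_fin_num/bmf_integrable.
rewrite integralZr//; last exact: bmf_integrable.
by rewrite fineM//; exact/integrable_fin_num/bmf_integrable.
Qed.

End product_expectation.

(** * Gaussian vectors and independent mixtures *)

Section gaussian_vector.
Variables (R : realType).

Definition cov_form (I : finType) (S : I -> I -> R) (c : I -> R) : R :=
  \sum_i \sum_j c i * c j * S i j.

(* The centered Gaussian vectors with covariance matrix [S], through their
   characteristic function. *)
Definition gvec d (T : measurableType d) (P : probability T R) (I : finType)
    (X : I -> T -> R) (S : I -> I -> R) : Prop :=
  (forall i, measurable_fun setT (X i)) /\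
  forall (c : I -> R) (th : R),
    \int[P]_w cos (\sum_i c i * X i w + th) = cos th * expR (- cov_form S c / 2).

Lemma measurable_lin d (T : measurableType d) (I : finType) (X : I -> T -> R)
    (c : I -> R) (th : R) : (forall i, measurable_fun setT (X i)) ->
  measurable_fun setT (fun w => \sum_i c i * X i w + th).
Proof.
move=> mX; apply: measurable_funD => //.
by apply: measurable_sum => i; apply: measurable_funM.
Qed.

(** The weights depend on the coordinate so that one lemma serves twice: constant weights sqrt t and
    sqrt (1 - t) give the interpolation, weights 0 and 1 assign each coordinate to one of two
    independent copies. *)
Lemma gvec_mix d1 (T1 : measurableType d1) (P : probability T1 R)
    d2 (T2 : measurableType d2) (Q : probability T2 R) (I : finType)
    (X : I -> T1 -> R) (Y : I -> T2 -> R) (S S' : I -> I -> R) (a b : I -> R) :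
  gvec P X S -> gvec Q Y S' ->
  gvec (P \x Q)%E (fun i z => a i * X i z.1 + b i * Y i z.2)
    (fun i j => a i * a j * S i j + b i * b j * S' i j).
Proof.
move=> [mX gX] [mY gY]; split.
  move=> i; apply: measurable_funD; apply: measurable_funM => //.
    exact: measurableT_comp (mX i) measurable_fst.
  exact: measurableT_comp (mY i) measurable_snd.
move=> c th.
pose u x := \sum_i (c i * a i) * X i x + th.
pose v y := \sum_i (c i * b i) * Y i y + 0.
have mu : measurable_fun setT u by exact: measurable_lin.
have mv : measurable_fun setT v by exact: measurable_lin.
(* Sines are written as cosines shifted by - pi / 2. The phase of [v] is 0, so the expectation of
   its sine vanishes and only the product of the cosines survives. *)
pose u' x := \sum_i (c i * a i) * X i x + (th - pi / 2).
pose v' y := \sum_i (c i * b i) * Y i y + (0 - pi / 2).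
have mu' : measurable_fun setT u' by exact: measurable_lin.
have mv' : measurable_fun setT v' by exact: measurable_lin.
transitivity (\int[(P \x Q)%E]_z
    (cos (u z.1) * cos (v z.2) + (-1) * (cos (u' z.1) * cos (v' z.2)))).
  apply: eq_Rintegral => z _.
  have -> : u' z.1 = u z.1 - pi / 2 by rewrite /u' /u addrA.
  have -> : v' z.2 = v z.2 - pi / 2 by rewrite /v' /v addrA.
  rewrite !cosBpihalf mulN1r -cosD; congr cos.
  rewrite /u /v addr0 addrAC -big_split/=; congr (_ + _).
  by apply: eq_bigr => i _; ring.
have b1 := bmfM (bmf_fst _ (bmf_cos mu)) (bmf_snd _ (bmf_cos mv)).
have b2 := bmfM (bmf_fst _ (bmf_cos mu')) (bmf_snd _ (bmf_cos mv')).
rewrite ExD//; last exact: bmfZ.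
rewrite ExZ// (Ex_indep P Q (bmf_cos mu) (bmf_cos mv)).
rewrite (Ex_indep P Q (bmf_cos mu') (bmf_cos mv')).
rewrite gX !gY sub0r cosN cos_pihalf mul0r mulr0 mulr0 addr0 cos0 mul1r.
rewrite -mulrA -expRD; congr (_ * expR _).
rewrite -mulrDl -opprD; congr (- _ / _).
rewrite /cov_form -big_split/=; apply: eq_bigr => i _.
by rewrite -big_split/=; apply: eq_bigr => j _; ring.
Qed.

End gaussian_vector.

(** * Derivatives along lines and Gronwall's inequality *)

Section derive_extra.
Variable R : realType.

Lemma is_derive_bigsum (Q : Type) (s : seq Q) (f : Q -> R -> R) (df : Q -> R)
    (x : R) : (forall q, is_derive x 1 (f q) (df q)) ->
  is_derive x 1 (fun u => \sum_(q <- s) f q u) (\sum_(q <- s) df q).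
Proof.
move=> fd; elim: s => [|q s IH].
  under eq_fun do rewrite big_nil.
  by rewrite big_nil; exact: is_derive_cst.
under eq_fun do rewrite big_cons.
by rewrite big_cons; have := is_deriveD (fd q) IH.
Qed.

Lemma is_derive_affine (a b x : R) : is_derive x 1 (fun u => a + b * u) b.
Proof. by apply: is_derive_eq; rewrite /GRing.scale/=; ring. Qed.

Lemma is_derive_unique (f : R -> R) (x a b : R) :
  is_derive x 1 f a -> is_derive x 1 f b -> a = b.
Proof. by move=> [_ <-] [_ <-]. Qed.

(** The function exp (- K x) f x - e x is nonincreasing on [0, t]. *)
Lemma gronwall (f df : R -> R) (K e t : R) : 0 <= K -> 0 <= e -> 0 <= t ->
  (forall x : R, is_derive x 1 f (df x)) ->
  (forall x, 0 <= x <= t -> df x <= K * f x + e) ->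
  f t <= expR (K * t) * (f 0 + e * t).
Proof.
move=> K0 e0 t0 fd fb.
pose g x := expR (- (K * x)) * f x - e * x.
pose dg x := expR (- (K * x)) * (df x - K * f x) - e.
have gd (x : R) : is_derive x 1 g (dg x).
  have h1 : is_derive x 1 (fun y => - (K * y)) (- K).
    by apply: is_derive_eq; rewrite /GRing.scale/=; ring.
  have h2 : is_derive x 1 (expR \o (fun y => - (K * y))) (expR (- (K * x)) * - K).
    exact: is_derive1_comp.
  have h3 := fd x.
  have h4 : is_derive x 1 (fun y : R => e * y) e.
    by apply: is_derive_eq; rewrite /GRing.scale/=; ring.
  have := is_deriveB (is_deriveM h2 h3) h4.
  rewrite /GRing.scale/=.
  suff -> : expR (- (K * x)) * df x + f x * (expR (- (K * x)) * - K) - e = dg x.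
    by [].
  by rewrite /dg; ring.
have gc : {within `[0, t], continuous g}.
  apply: derivable_within_continuous => x _.
  by have [] := gd x.
have [c ct] := MVT_segment t0 (fun x _ => gd x) gc.
rewrite in_itv/= in ct.
rewrite subr0 => E.
have : g t <= g 0.
  rewrite -subr_le0 E mulr_le0_ge0// /dg.
  have ec : expR (- (K * c)) <= 1.
    by rewrite -expR0 ler_expR oppr_le0 mulr_ge0//; case/andP: ct.
  have := fb c ct; have := expR_ge0 (- (K * c)) => e1 e2.
  apply: (@le_trans _ _ (expR (- (K * c)) * e - e)).
    by rewrite lerD2r ler_wpM2l//; lra.
  by rewrite subr_le0 ler_piMl.
rewrite /g mulr0 oppr0 expR0 mul1r mulr0 subr0 => H.
have -> : f t = expR (K * t) * (expR (- (K * t)) * f t).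
  by rewrite mulrA -expRD subrr expR0 mul1r.
by rewrite ler_pM2l ?expR_gt0//; lra.
Qed.

End derive_extra.

Section trig_derivative.
Variables (R : realType) (I : finType).
Implicit Type s : seq (R * (I -> R) * R).

Definition trig_phase (q : R * (I -> R) * R) (x : I -> R) : R :=
  \sum_i q.1.2 i * x i + q.2.

Definition trig_sum s (x : I -> R) : R :=
  \sum_(q <- s) q.1.1 * cos (trig_phase q x).

(** The mixed second partial derivative of [trig_sum s], taken term by term. *)
Definition trig_dd s (i j : I) (x : I -> R) : R :=
  \sum_(q <- s) - (q.1.1 * (q.1.2 i * q.1.2 j) * cos (trig_phase q x)).

Lemma trig_phase_shift q x i j (u v : R) :
  trig_phase q (fun m => x m + (if m == i then u else 0) +
                               (if m == j then v else 0)) =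
  trig_phase q x + q.1.2 i * u + q.1.2 j * v.
Proof.
rewrite /trig_phase.
have E k (a : R) : \sum_m q.1.2 m * (if m == k then a else 0) = q.1.2 k * a.
  rewrite (bigD1 k)//= eqxx big1 ?addr0// => m /negbTE ->; exact: mulr0.
under eq_bigr do rewrite !mulrDr.
rewrite !big_split/= !E; ring.
Qed.

(** The product and its expansion are one function, hence have the same derivatives: along the line
    of [x i] first, then along that of [x j]. Only derivatives in one real variable enter. *)
Lemma trig_dd_prod s (f f' : R -> R) (x : I -> R) i j : i != j ->
  (forall x : R, is_derive x 1 f (f' x)) ->
  (forall x, \prod_i f (x i) = trig_sum s x) ->
  trig_dd s i j x = f' (x i) * f' (x j) * \prod_(m | (m != i) && (m != j)) f (x m).
Proof.
move=> ij fd Fs.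
pose K := \prod_(m | (m != i) && (m != j)) f (x m).
pose z (u v : R) m := x m + (if m == i then u else 0) + (if m == j then v else 0).
have prodE u v : trig_sum s (z u v) = f (x i + u) * (f (x j + v) * K).
  rewrite -Fs (bigD1 i)//= (bigD1 j)/=; last by rewrite eq_sym.
  rewrite /z !eqxx (negbTE ij) eq_sym (negbTE ij) !addr0; congr (_ * (_ * _)).
  by apply: eq_bigr => m /andP[/negbTE -> /negbTE ->]; rewrite !addr0.
have fshift a (u : R) : is_derive u 1 (fun u => f (a + u)) (f' (a + u)).
  have h : is_derive u 1 (fun u => a + u) (1 : R).
    by have := is_derive_affine a 1 u; under eq_fun do rewrite mul1r.
  by have := is_derive1_comp (fd (a + u)) h; rewrite mulr1.
pose G (v : R) := \sum_(q <- s) q.1.1 *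
  (- sin (trig_phase q x + q.1.2 j * v) * q.1.2 i).
have GE v : G v = f' (x i) * (f (x j + v) * K).
  have D1 : is_derive (0:R) 1 (fun u => trig_sum s (z u v)) (G v).
    rewrite /trig_sum /G; apply: is_derive_bigsum => q.
    have -> : (fun u => q.1.1 * cos (trig_phase q (z u v))) =
      q.1.1 \*: (cos \o (fun u => (trig_phase q x + q.1.2 j * v) + q.1.2 i * u)).
      by apply/funext => u; rewrite trig_phase_shift /=/GRing.scale/= addrAC.
    have := is_deriveZ q.1.1 (is_derive1_comp (is_derive_cos _)
      (is_derive_affine (trig_phase q x + q.1.2 j * v) (q.1.2 i) 0)).
    by rewrite mulr0 addr0.
  have D2 : is_derive (0:R) 1 (fun u => trig_sum s (z u v))
      (f' (x i) * (f (x j + v) * K)).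
    under eq_fun do rewrite prodE mulrC.
    have := is_deriveZ (f (x j + v) * K) (fshift (x i) 0).
    by rewrite addr0 /GRing.scale/= [X in is_derive _ _ _ X -> _]mulrC.
  exact: is_derive_unique D1 D2.
have D1 : is_derive (0:R) 1 G (trig_dd s i j x).
  rewrite /trig_dd /G; apply: is_derive_bigsum => q.
  have -> : - (q.1.1 * (q.1.2 i * q.1.2 j) * cos (trig_phase q x)) =
     (- (q.1.1 * q.1.2 i)) * (cos (trig_phase q x) * q.1.2 j) by ring.
  have -> : (fun v => q.1.1 * (- sin (trig_phase q x + q.1.2 j * v) * q.1.2 i)) =
      (- (q.1.1 * q.1.2 i)) \*: (sin \o (fun v => trig_phase q x + q.1.2 j * v)).
    by apply/funext => v /=; rewrite /GRing.scale/=; ring.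
  have := is_deriveZ (- (q.1.1 * q.1.2 i)) (is_derive1_comp (is_derive_sin _)
    (is_derive_affine (trig_phase q x) (q.1.2 j) 0)).
  by rewrite mulr0 addr0.
have D2 : is_derive (0:R) 1 G (f' (x i) * (f' (x j) * K)).
  rewrite (_ : G = fun v => f' (x i) * (f (x j + v) * K)); last exact/funext.
  have -> : (fun v => f' (x i) * (f (x j + v) * K)) =
    (f' (x i) * K) \*: (fun v => f (x j + v)).
    by apply/funext => v /=; rewrite /GRing.scale/=; ring.
  have := is_deriveZ (f' (x i) * K) (fshift (x j) 0).
  rewrite addr0 /GRing.scale/=.
  by have -> : f' (x i) * K * f' (x j) = f' (x i) * (f' (x j) * K) by ring.
by rewrite (is_derive_unique D1 D2) mulrA.
Qed.

End trig_derivative.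

(** * Tails and truncation to the window *)

Section tails.
Context d (T : measurableType d) (R : realType) (P : probability T R).

Lemma measurable_gt_set (g : T -> R) (B : R) : measurable_fun setT g ->
  measurable [set w | B < g w].
Proof.
move=> mg; rewrite [X in measurable X](_ : _ = g @^-1` `]B, +oo[).
  by rewrite -[X in measurable X]setTI; exact: mg.
by apply/seteqP; split => w /=; rewrite in_itv/= andbT.
Qed.

Lemma measurable_lt_set (g : T -> R) (B : R) : measurable_fun setT g ->
  measurable [set w | g w < B].
Proof.
move=> mg; rewrite [X in measurable X](_ : _ = g @^-1` `]-oo, B[).
  by rewrite -[X in measurable X]setTI; exact: mg.
by apply/seteqP; split => w /=; rewrite in_itv/=.
Qed.

Lemma measurable_ge_set (g : T -> R) (B : R) : measurable_fun setT g ->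
  measurable [set w | B <= g w].
Proof.
move=> mg; rewrite [X in measurable X](_ : _ = g @^-1` `[B, +oo[).
  by rewrite -[X in measurable X]setTI; exact: mg.
by apply/seteqP; split => w /=; rewrite in_itv/= andbT.
Qed.

Lemma measurable_all_lt (I : finType) (X : I -> T -> R) (r : R) :
  (forall i, measurable_fun setT (X i)) ->
  measurable [set w | forall i, X i w < r].
Proof.
move=> mX; rewrite [X in measurable X](_ : _ =
    \bigcap_(i in [set: I]) [set w | X i w < r]).
  apply: fin_bigcap_measurable => [|i _]; first exact: finite_finset.
  exact: measurable_lt_set.
by apply/seteqP; split => w /= H i => [_|]; exact: H.
Qed.

Lemma pr_tail (g : T -> R) (e : R) : measurable_fun setT g -> 0 < e ->
  exists B0, forall B, B0 <= B -> pr P [set w | B < g w] <= e.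
Proof.
move=> mg e0.
pose F (n : nat) := [set w | n%:R < g w].
have mF n : measurable (F n) by exact: measurable_gt_set.
have F0 : \bigcap_n F n = set0.
  apply/seteqP; split => // w H.
  have /= := H (`|Num.ceil (g w)|%N) I.
  apply/negP; rewrite -leNgt (le_trans (ceil_ge _))// natr_absz.
  by rewrite ler_int ler_norm.
have cF : (P \o F) @ \oo --> P (\bigcap_n F n).
  apply: nonincreasing_cvg_mu => //.
  - by rewrite -ge0_fin_numE// fin_num_measure.
  - by rewrite F0.
  - move=> n m nm; apply/subsetPset => w /=.
    by apply: le_lt_trans; rewrite ler_nat.
rewrite F0 measure0 in cF.
have /fine_cvgP[_ /cvgrPdist_le/(_ e e0)[N _ HN]] := cF.
exists N%:R => B NB.
apply: (@le_trans _ _ (pr P (F N))).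
  apply: pr_le => //; first exact: measurable_gt_set.
  by move=> w /=; exact: le_lt_trans.
by have := HN N (leqnn _); rewrite /= sub0r normrN ger0_norm// pr_ge0.
Qed.

Lemma pr_tail_sum (I : Type) (s : seq I) (g : I -> T -> R) (e : R) :
  (forall i, measurable_fun setT (g i)) -> 0 < e ->
  exists B0, forall B, B0 <= B -> \sum_(i <- s) pr P [set w | B < g i w] <= e.
Proof.
move=> mg; elim: s e => [|i s IH] e e0.
  by exists 0 => B _; rewrite big_nil ltW.
have e2 : 0 < e / 2 by rewrite divr_gt0.
have [B1 H1] := IH _ e2; have [B2 H2] := pr_tail (mg i) e2.
exists (Num.max B1 B2) => B; rewrite ge_max => /andP[B1B B2B].
by rewrite big_cons; have := H1 _ B1B; have := H2 _ B2B; lra.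
Qed.

End tails.

Lemma test_function_continuous (R : realType) (r h k C B : R) (f : R -> R) :
  test_function r h k C B f -> continuous f.
Proof.
move=> [_ _ [f' f'P] _ _] x; apply/differentiable_continuous/derivable1_diffP.
by have [[]] := f'P x.
Qed.

Lemma bmf_test_prod (R : realType) (r h k C B : R) (f : R -> R) d (T : measurableType d)
    (I : finType) (X : I -> T -> R) :
  test_function r h k C B f -> (forall i, measurable_fun setT (X i)) ->
  bmf (fun w => \prod_i f (X i w)).
Proof.
move=> tf mX; apply: bmf_prod => i; apply: (@bmf_comp _ _ _ f (X i) 1) => //.
  exact: test_function_continuous tf.
by have [_ f01 _ _ _] := tf => x; have /andP[f0 f1] := f01 x; rewrite gtr0_norm.
Qed.

Section outliers.
Context d (T : measurableType d) (R : realType) (P : probability T R) (I : finType).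
Variables (X : I -> T -> R) (B : R).
Hypothesis mX : forall i, measurable_fun setT (X i).

(** A count instead of the indicator of the union: it is at least 1 as soon as some coordinate
    leaves the window, and its expectation is exactly a sum of tails. *)
Definition outliers (w : T) : R := \sum_i \1_[set w | B < `|X i w|] w.

Let mA i : measurable [set w | B < `|X i w|].
Proof. by apply: measurable_gt_set; exact: measurableT_comp. Qed.

Lemma bmf_outliers : bmf outliers.
Proof. by apply: bmf_sum => i; exact: bmf_indic. Qed.

Lemma Ex_outliers : \int[P]_w outliers w = \sum_i pr P [set w | B < `|X i w|].
Proof.
rewrite Ex_sum => [|i]; last exact: bmf_indic.
by apply: eq_bigr => i _; rewrite Ex_indic.
Qed.

Lemma outliersP w : 0 <= outliers w /\
  ((forall i, `|X i w| <= B) \/ 1 <= outliers w).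
Proof.
have o0 : 0 <= outliers w by apply: sumr_ge0 => m _; rewrite indicE.
split => //; have [H|/existsNP[i /negP]] := pselect (forall i, `|X i w| <= B).
  by left.
rewrite -ltNge => Bi; right.
rewrite /outliers (bigD1 i)//= indicE mem_set//= lerDl.
by apply: sumr_ge0 => m _; rewrite indicE.
Qed.

End outliers.

(** * Interpolation between two Gaussian vectors *)

Section gaussian_comparison.
Variable R : realType.

Lemma gvec_trig d (T : measurableType d) (P : probability T R) (I : finType)
    (X : I -> T -> R) (S : I -> I -> R) s : gvec P X S ->
  \int[P]_w trig_sum s (X ^~ w) =
  \sum_(q <- s) q.1.1 * (cos q.2 * expR (- cov_form S q.1.2 / 2)).
Proof.
move=> [mX gX].
have b (q : R * (I -> R) * R) : bmf (fun w => cos (trig_phase q (X ^~ w))).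
  by apply: bmf_cos; exact: measurable_lin.
rewrite /trig_sum Ex_sum; last by move=> q; exact: bmfZ.
by apply: eq_bigr => q _; rewrite ExZ// gX.
Qed.

Lemma bmf_trig_dd d (T : measurableType d) (I : finType) (X : I -> T -> R) s i j :
  (forall i, measurable_fun setT (X i)) ->
  bmf (fun w => trig_dd s i j (X ^~ w)).
Proof.
move=> mX; apply: bmf_sum => q; under eq_fun do rewrite -mulNr.
by apply/bmfZ/bmf_cos; exact: measurable_lin.
Qed.

Lemma gvec_trig_dd d (T : measurableType d) (P : probability T R) (I : finType)
    (X : I -> T -> R) (S D : I -> I -> R) s : gvec P X S ->
  \sum_i \sum_j D i j * \int[P]_w trig_dd s i j (X ^~ w) =
  \sum_(q <- s) q.1.1 * (cos q.2 * expR (- cov_form S q.1.2 / 2) *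
                         - cov_form D q.1.2).
Proof.
move=> [mX gX].
have b (q : R * (I -> R) * R) : bmf (fun w => cos (trig_phase q (X ^~ w))).
  by apply: bmf_cos; exact: measurable_lin.
have E i j : \int[P]_w trig_dd s i j (X ^~ w) =
    \sum_(q <- s) - (q.1.1 * (q.1.2 i * q.1.2 j)) *
      (cos q.2 * expR (- cov_form S q.1.2 / 2)).
  rewrite /trig_dd; under eq_Rintegral do under eq_bigr do rewrite -mulNr.
  rewrite Ex_sum; last by move=> q; exact: bmfZ.
  by apply: eq_bigr => q _; rewrite ExZ// gX.
under eq_bigr do under eq_bigr do rewrite E mulr_sumr.
under eq_bigr do rewrite exchange_big/=.
rewrite exchange_big/=; apply: eq_bigr => q _.
set e := cos q.2 * _; rewrite /cov_form -sumrN !mulr_sumr; apply: eq_bigr => i _.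
rewrite -sumrN !mulr_sumr; apply: eq_bigr => j _; ring.
Qed.

Variables (d1 : measure_display) (T1 : measurableType d1).
Variables (d2 : measure_display) (T2 : measurableType d2).
Variables (P : probability T1 R) (Q : probability T2 R) (I : finType).
Variables (X : I -> T1 -> R) (Y : I -> T2 -> R) (S S' : I -> I -> R).
Hypotheses (gX : gvec P X S) (gY : gvec Q Y S').
Hypothesis diag : forall i, S i i = S' i i.

Let PQ : probability (T1 * T2)%type R := (P \x Q)%E.

Definition excess : R := \sum_i \sum_j Num.max 0 (S i j - S' i j).

Let U (t : R) (i : I) (z : T1 * T2) : R :=
  Num.sqrt t * X i z.1 + Num.sqrt (1 - t) * Y i z.2.

(** The sum of the two absolute values dominates the interpolant at every time, so a single tail
    serves the whole path. *)
Let tailU (B : R) : R :=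
  \sum_i pr PQ [set z | B < `| `|X i z.1| + `|Y i z.2| | ].

Let mX i : measurable_fun setT (X i). Proof. by case: gX. Qed.
Let mY i : measurable_fun setT (Y i). Proof. by case: gY. Qed.

Let mnorm i : measurable_fun setT (fun z : T1 * T2 => `|X i z.1| + `|Y i z.2|).
Proof.
apply: measurable_funD; apply: measurableT_comp => //.
  exact: (measurableT_comp (mX i) measurable_fst).
exact: (measurableT_comp (mY i) measurable_snd).
Qed.

Let gU t : 0 <= t <= 1 -> gvec PQ (U t) (fun i j => t * S i j + (1 - t) * S' i j).
Proof.
move=> /andP[t0 t1].
have := gvec_mix (fun=> Num.sqrt t) (fun=> Num.sqrt (1 - t)) gX gY.
rewrite -!expr2 !sqr_sqrtr ?subr_ge0//.
Qed.

(* With phi t = E prod_i f (sqrt t X_i + sqrt (1 - t) Y_i), phi' is half the sum of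
   (S - S')_ij E [f' f' prod f].  Where |x| <= B both factors f' are nonpositive,
   so that negative (S - S')_ij can be dropped up to tails, and |f'| <= C f bounds
   the other terms by C^2 phi. *)
Lemma comparison_test r h k C B f : 0 <= C -> test_function r h k C B f ->
  \int[P]_w (\prod_i f (X i w)) <=
  expR (C ^+ 2 / 2 * excess) * (\int[Q]_w (\prod_i f (Y i w)) +
    C ^+ 2 / 2 * (\sum_i \sum_j `|S i j - S' i j|) * tailU B).
Proof.
move=> C0 /[dup] tf [fT f01 [f' f'P] _ _].
have [s sE] := trig_poly_prod (fun i => fT I i).
have {}sE (x : I -> R) : \prod_i f (x i) = trig_sum s x by exact: sE.
have fd (x : R) : is_derive x 1 f (f' x) by have [] := f'P x.
pose D i j := S i j - S' i j.
pose mixS t i j := t * S i j + (1 - t) * S' i j.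
(* The closed formula makes sense and is differentiable for every real [t], as Gronwall's lemma
   asks; its reading as an expectation is needed only for t in [0, 1]. *)
pose phi t := \sum_(q <- s) q.1.1 *
  (cos q.2 * expR (- cov_form (mixS t) q.1.2 / 2)).
pose dphi t := \sum_(q <- s) q.1.1 *
  (cos q.2 * expR (- cov_form (mixS t) q.1.2 / 2) * - cov_form D q.1.2) / 2.
have mixE t c : cov_form (mixS t) c = cov_form S' c + t * cov_form D c.
  rewrite /cov_form mulr_sumr -big_split/=; apply: eq_bigr => i _.
  rewrite mulr_sumr -big_split/=; apply: eq_bigr => j _.
  by rewrite /mixS /D; ring.
have dphiP (t : R) : is_derive t 1 phi (dphi t).
  apply: is_derive_bigsum => q; rewrite mixE.
  have -> : (fun u => q.1.1 * (cos q.2 * expR (- cov_form (mixS u) q.1.2 / 2))) =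
    (q.1.1 * cos q.2) \*: (expR \o
      (fun u => - (cov_form S' q.1.2) / 2 + (- cov_form D q.1.2 / 2) * u)).
    apply/funext => u; rewrite mixE /= /GRing.scale/= mulrA.
    by congr (_ * expR _); ring.
  apply: (is_derive_eq (is_deriveZ (q.1.1 * cos q.2) (is_derive1_comp
    (is_derive_expR _)
    (is_derive_affine (- (cov_form S' q.1.2) / 2) (- cov_form D q.1.2 / 2) t)))).
  rewrite /GRing.scale/=.
  set e1 := expR _; set e2 := expR _; have -> : e1 = e2; last by ring.
  by rewrite /e1 /e2; congr expR; ring.
have phi1 : phi 1 = \int[P]_w (\prod_i f (X i w)).
  under eq_Rintegral do rewrite sE.
  rewrite (gvec_trig _ gX); apply: eq_bigr => q _.
  suff -> : cov_form (mixS 1) q.1.2 = cov_form S q.1.2 by [].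
  rewrite mixE /cov_form mul1r -big_split/=; apply: eq_bigr => i _.
  by rewrite -big_split/=; apply: eq_bigr => j _; rewrite /D; ring.
have phi0 : phi 0 = \int[Q]_w (\prod_i f (Y i w)).
  under eq_Rintegral do rewrite sE.
  rewrite (gvec_trig _ gY); apply: eq_bigr => q _.
  by rewrite mixE mul0r addr0.
rewrite -phi1 -phi0.
have ex0 : 0 <= excess.
  by apply: sumr_ge0 => i _; apply: sumr_ge0 => j _; rewrite le_max lexx.
have tl0 : 0 <= tailU B by apply: sumr_ge0 => i _; exact: pr_ge0.
have ab0 : 0 <= \sum_i \sum_j `|S i j - S' i j|.
  by apply: sumr_ge0 => i _; apply: sumr_ge0.
have C2 : 0 <= C ^+ 2 / 2 by rewrite divr_ge0// sqr_ge0.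
have := @gronwall R phi dphi (C ^+ 2 / 2 * excess)
  (C ^+ 2 / 2 * (\sum_i \sum_j `|S i j - S' i j|) * tailU B) 1.
rewrite !mulr1; apply => //.
  by rewrite mulr_ge0.
  by rewrite !mulr_ge0.
move=> t t01.
have gUt := gU t01; have mU := gUt.1.
have dE : dphi t = 2^-1 *
    \sum_i \sum_j D i j * \int[PQ]_z trig_dd s i j (U t ^~ z).
  rewrite (gvec_trig_dd _ _ gUt) mulr_sumr; apply: eq_bigr => q _.
  by rewrite -/(mixS t); ring.
have pE : phi t = \int[PQ]_z (\prod_i f (U t i z)).
  by under eq_Rintegral do rewrite sE; rewrite (gvec_trig _ gUt).
have fb x : 0 <= f x by have /andP[/ltW] := f01 x.
have fle x : f x <= 1 by have /andP[] := f01 x.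
have bF := bmf_test_prod tf mU.
pose N := outliers (fun i (z : T1 * T2) => `|X i z.1| + `|Y i z.2|) B.
have bN : bmf N := bmf_outliers B mnorm.
have EN : \int[PQ]_z N z = tailU B := Ex_outliers PQ B mnorm.
have dd_up i j : i != j ->
    \int[PQ]_z trig_dd s i j (U t ^~ z) <= C ^+ 2 * phi t.
  move=> ij; rewrite pE -ExZ//; apply: Ex_le => [||z].
  - exact: bmf_trig_dd.
  - exact: bmfZ.
  rewrite (trig_dd_prod _ ij fd sE).
  have -> : \prod_m f (U t m z) = f (U t i z) * (f (U t j z) *
      \prod_(m | (m != i) && (m != j)) f (U t m z)).
    by rewrite (bigD1 i)//= (bigD1 j)//= eq_sym.
  have [_ h1 _] := f'P (U t i z); have [_ h2 _] := f'P (U t j z).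
  rewrite !mulrA; apply: ler_wpM2r; first exact: prodr_ge0.
  rewrite (le_trans (ler_norm _))// normrM.
  have -> : C ^+ 2 * f (U t i z) * f (U t j z) =
    (C * f (U t i z)) * (C * f (U t j z)) by ring.
  by apply: ler_pM.
have dd_lo i j : i != j ->
    - (C ^+ 2 * tailU B) <= \int[PQ]_z trig_dd s i j (U t ^~ z).
  move=> ij; rewrite -EN -mulNr -ExZ//; apply: Ex_le => [||z].
  - exact: bmfZ.
  - exact: bmf_trig_dd.
  rewrite (trig_dd_prod _ ij fd sE).
  set V := \prod_(m | _) _.
  have V0 : 0 <= V by exact: prodr_ge0.
  have V1 : V <= 1 by apply: prodr_ile1 => m _; rewrite fb fle.
  have [_ h1 h1'] := f'P (U t i z); have [_ h2 h2'] := f'P (U t j z).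
  have [N0 o1] : 0 <= N z /\ _ := outliersP _ B z.
  have Ule m : `|U t m z| <= `|X m z.1| + `|Y m z.2|.
    have /andP[t0 t1] := t01.
    rewrite (le_trans (ler_normD _ _))// !normrM lerD// ler_piMl//;
      rewrite ger0_norm ?sqrtr_ge0// -[leRHS]sqrtr1 ler_wsqrtr//; lra.
  have f2V : `|f' (U t i z) * f' (U t j z) * V| <= C ^+ 2.
    have a1 : `|f' (U t i z)| <= C by rewrite (le_trans h1)// ler_piMr.
    have a2 : `|f' (U t j z)| <= C by rewrite (le_trans h2)// ler_piMr.
    rewrite !normrM (ger0_norm V0) expr2.
    have := ler_pM (normr_ge0 _) (normr_ge0 _) a1 a2.
    by apply: le_trans; rewrite ler_piMr// mulr_ge0.
  case: o1 => o1; last first.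
    move: f2V; rewrite ler_norml => /andP[+ _]; apply: le_trans.
    by rewrite mulNr lerN2 ler_peMr// sqr_ge0.
  have {}Ule m : `|U t m z| <= B.
    by rewrite (le_trans (Ule m))// (le_trans _ (o1 m))// ler_norm.
  rewrite (@le_trans _ _ 0)//; first by rewrite mulNr oppr_le0 mulr_ge0// sqr_ge0.
  by rewrite mulr_ge0// mulr_le0// ?h1' ?h2'.
have Dij i j : D i j * \int[PQ]_z trig_dd s i j (U t ^~ z) <=
    Num.max 0 (D i j) * (C ^+ 2 * phi t) + `|D i j| * (C ^+ 2 * tailU B).
  (* A diagonal term would involve f'', on which there is no control; equal variances make its
     coefficient 0. *)
  have [->|ij] := eqVneq i j.
    by rewrite /D diag subrr mul0r maxxx normr0 !mul0r addr0.
  have h1 := dd_up _ _ ij; have h2 := dd_lo _ _ ij.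
  have t2 : 0 <= C ^+ 2 * tailU B by rewrite mulr_ge0// sqr_ge0.
  have [D0|D0] := leP 0 (D i j).
    by rewrite (ger0_norm D0) ler_wpDr ?mulr_ge0// ler_wpM2l.
  by rewrite mul0r add0r (ltr0_norm D0) mulNr -mulrN ler_wnM2l// ltW.
rewrite dE.
have -> : C ^+ 2 / 2 * excess * phi t +
    C ^+ 2 / 2 * (\sum_i \sum_j `|S i j - S' i j|) * tailU B =
    2^-1 * \sum_i \sum_j (Num.max 0 (D i j) * (C ^+ 2 * phi t) +
                          `|D i j| * (C ^+ 2 * tailU B)).
  under [in RHS]eq_bigr do rewrite big_split/= -!mulr_suml.
  by rewrite big_split/= -!mulr_suml /excess /D; ring.
rewrite ler_pM2l ?invr_gt0//.
by apply: ler_sum => i _; apply: ler_sum => j _.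
Qed.

End gaussian_comparison.

Section gaussian_comparison_principle.
Variable R : realType.

Lemma bmf_soft_prod d (T : measurableType d) (I : finType) (Y : I -> T -> R)
    (a b : R) : (forall i, measurable_fun setT (Y i)) ->
  bmf (fun w => \prod_i (\1_[set w | Y i w < a] w + b)).
Proof.
move=> mY; apply: bmf_prod => i; apply: bmfD; last exact: bmf_cst.
by apply: bmf_indic; exact: measurable_lt_set.
Qed.

Lemma test_prod_lower r h k C B (f : R -> R) d (T : measurableType d)
    (P : probability T R) (I : finType) (X : I -> T -> R) : 0 < k < 1 ->
  test_function r h k C B f -> (forall i, measurable_fun setT (X i)) ->
  (1 - k) ^+ #|I| * pr P [set w | forall i, X i w < r] -
    \sum_i pr P [set w | B < `|X i w|] <= \int[P]_w (\prod_i f (X i w)).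
Proof.
move=> /andP[k0 k1] tf mX.
have k1' : 0 <= 1 - k by rewrite subr_ge0 ltW.
have k1'' : 1 - k <= 1 by rewrite gerBl ltW.
have [_ f01 _ flo _] := tf.
have f0 x : 0 <= f x by have /andP[/ltW] := f01 x.
have kn0 : 0 <= (1 - k) ^+ #|I| by exact: exprn_ge0.
have kn1 : (1 - k) ^+ #|I| <= 1 by exact: exprn_ile1.
have bfX := bmf_test_prod tf mX.
have mA := measurable_all_lt r mX.
have bA := bmf_indic R mA; have bO := bmf_outliers B mX.
apply: (@le_trans _ _ (\int[P]_w ((1 - k) ^+ #|I| *
   (\1_[set w | forall i, X i w < r] w + (-1) * outliers X B w)))).
  rewrite ExZ; last by apply: bmfD => //; exact: bmfZ.
  rewrite ExD//; last exact: bmfZ.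
  rewrite ExZ// Ex_indic// Ex_outliers// mulrDr lerD2l mulN1r mulrN lerN2.
  by rewrite ler_piMl// sumr_ge0// => i _; exact: pr_ge0.
apply: Ex_le => //; first by apply: bmfZ; apply: bmfD => //; exact: bmfZ.
move=> w.
have p0 : 0 <= \prod_i f (X i w) by exact: prodr_ge0.
have [N0 o1] := outliersP X B w.
have [Hw|Hw] := pselect (forall i, X i w < r); last first.
  rewrite indicE memNset// add0r mulN1r (le_trans _ p0)//.
  by rewrite mulrN oppr_le0 mulr_ge0.
rewrite indicE mem_set//= mulN1r.
case: o1 => o1; last by rewrite (le_trans _ p0)// mulr_ge0_le0// subr_le0.
apply: (@le_trans _ _ ((1 - k) ^+ #|I|)); first by rewrite ler_piMr// gerBl.
rewrite -prodr_const; apply: ler_prod => i _; rewrite k1'/=; apply: flo.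
  by have := o1 i; rewrite ler_norml => /andP[].
exact: ltW.
Qed.

Lemma test_prod_upper r h k C B (f : R -> R) d (T : measurableType d)
    (P : probability T R) (I : finType) (X : I -> T -> R) : 0 < k ->
  test_function r h k C B f -> (forall i, measurable_fun setT (X i)) ->
  \int[P]_w (\prod_i f (X i w)) <=
  \int[P]_w (\prod_i (\1_[set w | X i w < r + h] w + 2 * k)) +
  \sum_i pr P [set w | B < `|X i w|].
Proof.
move=> k0 tf mX.
have [_ f01 _ _ fup] := tf.
have f0 x : 0 <= f x by have /andP[/ltW] := f01 x.
have f1 x : f x <= 1 by have /andP[] := f01 x.
have k20 : 0 <= 2 * k by rewrite mulr_ge0// ltW.
have bfX := bmf_test_prod tf mX.
have bO := bmf_outliers B mX.
have bJ := bmf_soft_prod (r + h) (2 * k) mX.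
rewrite -Ex_outliers// -ExD//; apply: Ex_le => //; first exact: bmfD.
move=> w; have [N0 o1] := outliersP X B w.
have p1 : \prod_i f (X i w) <= 1 by apply: prodr_ile1 => i _; rewrite f0 f1.
have q0 : 0 <= \prod_i (\1_[set w | X i w < r + h] w + 2 * k).
  by apply: prodr_ge0 => i _; rewrite indicE addr_ge0.
case: o1 => o1; last by rewrite (le_trans p1)// (le_trans o1)// lerDr.
apply: (@le_trans _ _ (\prod_i (\1_[set w | X i w < r + h] w + 2 * k))).
  apply: ler_prod => i _; rewrite f0 /= indicE.
  have [Hi|Hi] := ltP (X i w) (r + h).
    by rewrite mem_set//= (le_trans (f1 _))// lerDl.
  rewrite memNset/=; last by apply/negP; rewrite -leNgt.
  rewrite add0r; apply: fup => //.
  by have := o1 i; rewrite ler_norml => /andP[].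
by rewrite lerDl.
Qed.

(** The constant depends on [r], [h] and [k] alone; it is fixed before the spaces, the number of
    coordinates and the covariances, and so applies to grids of growing size. The window is chosen
    last, so large that all tails are negligible. *)
Lemma gaussian_comparison (r h k : R) : 0 < h -> 0 < k < 1 ->
  exists2 C : R, 0 <= C &
  forall d1 (T1 : measurableType d1) d2 (T2 : measurableType d2)
    (P : probability T1 R) (Q : probability T2 R) (I : finType)
    (X : I -> T1 -> R) (Y : I -> T2 -> R) (S S' : I -> I -> R),
  gvec P X S -> gvec Q Y S' -> (forall i, S i i = S' i i) ->
  (1 - k) ^+ #|I| * pr P [set w | forall i, X i w < r] <=
  expR (C * excess S S') *
  \int[Q]_w (\prod_i (\1_[set w | Y i w < r + h] w + 2 * k)).
Proof.
move=> h0 k01; have /andP[k0 k1] := k01.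
have [C C0 [B1 HC]] := test_function_exists r h0 k01.
exists (C ^+ 2 / 2); first by rewrite divr_ge0// sqr_ge0.
move=> d1 T1 d2 T2 P Q I X Y S S' gX gY diag.
have mX := gX.1; have mY := gY.1.
set L := (1 - k) ^+ #|I| * _; set E := expR _; set J := \int[Q]_w _.
have E0 : 0 <= E by exact: expR_ge0.
set ab := C ^+ 2 / 2 * (\sum_i \sum_j `|S i j - S' i j|).
have ab0 : 0 <= ab.
  rewrite mulr_ge0 ?divr_ge0 ?sqr_ge0//.
  by apply: sumr_ge0 => i _; apply: sumr_ge0.
apply/ler_addgt0Pr => e e0.
(* The total weight of the tails: 1 from the lower estimate, [E] from the upper one, [E * ab] from
   the derivative bound. *)
pose M := 1 + E + E * ab.
have M0 : 0 < M by rewrite /M; have := mulr_ge0 E0 ab0; lra.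
have d0 : 0 < e / M by rewrite divr_gt0.
have nX i : measurable_fun setT (fun w => `|X i w|) by exact: measurableT_comp.
have nY i : measurable_fun setT (fun w => `|Y i w|) by exact: measurableT_comp.
have nXY i : measurable_fun setT (fun z : T1 * T2 => `|X i z.1| + `|Y i z.2|).
  apply: measurable_funD; apply: measurableT_comp => //.
    exact: (measurableT_comp (mX i) measurable_fst).
  exact: (measurableT_comp (mY i) measurable_snd).
have [BX HX] := pr_tail_sum P (index_enum I) nX d0.
have [BY HY] := pr_tail_sum Q (index_enum I) nY d0.
have [BXY HXY] := pr_tail_sum (P \x Q)%E (index_enum I)
  (fun i => measurableT_comp (@normr_measurable R setT) (nXY i)) d0.
pose B := Num.max B1 (Num.max BX (Num.max BY BXY)).
have B1B : B1 <= B by rewrite /B le_max lexx.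
have {}HX : \sum_i pr P [set w | B < `|X i w|] <= e / M.
  by apply: HX; rewrite /B !le_max lexx !orbT.
have {}HY : \sum_i pr Q [set w | B < `|Y i w|] <= e / M.
  by apply: HY; rewrite /B !le_max lexx !orbT.
have {}HXY : \sum_i pr (P \x Q)%E
    [set z | B < `| `|X i z.1| + `|Y i z.2| | ] <= e / M.
  by apply: HXY; rewrite /B !le_max lexx !orbT.
have [f tf] := HC B B1B.
have := comparison_test gX gY diag C0 tf.
rewrite -/E -/ab => Hcmp.
have Hlo : L - e / M <= \int[P]_w (\prod_i f (X i w)).
  by apply: le_trans (test_prod_lower P k01 tf mX); rewrite lerD2l lerN2.
have Hup : \int[Q]_w (\prod_i f (Y i w)) <= J + e / M.
  by apply: (le_trans (test_prod_upper Q k0 tf mY)); rewrite lerD2l.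
have : L - e / M <= E * (J + e / M + ab * (e / M)).
  apply: (le_trans Hlo); apply: (le_trans Hcmp); rewrite ler_wpM2l// lerD//.
  by rewrite ler_wpM2l.
have -> : E * (J + e / M + ab * (e / M)) = E * J + (M - 1) * (e / M).
  by rewrite /M; ring.
rewrite lerBlDr => /le_trans; apply.
by rewrite mulrBl mul1r addrA subrK mulrCA divff ?mulr1// gt_eqF.
Qed.

(** Either every indicator is 1, or some factor is only [b]. The additive [b] makes this bound fit
    for a fixed number of points; growing grids call for [soft_below_le]. *)
Lemma soft_prod_le d (T : measurableType d) (Q : probability T R) (I : finType)
    (Y : I -> T -> R) (a b : R) : 0 <= b ->
  (forall i, measurable_fun setT (Y i)) ->
  \int[Q]_w (\prod_i (\1_[set w | Y i w < a] w + b)) <=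
  (1 + b) ^+ #|I| * (pr Q [set w | forall i, Y i w < a] + b).
Proof.
move=> b0 mY.
have mA := measurable_all_lt a mY; have bA := bmf_indic R mA.
have b1 : 1 <= 1 + b by rewrite lerDl.
have bn : 1 <= (1 + b) ^+ #|I| by exact: exprn_ege1.
have -> : (1 + b) ^+ #|I| * (pr Q [set w | forall i, Y i w < a] + b) =
  \int[Q]_w ((1 + b) ^+ #|I| * (\1_[set w | forall i, Y i w < a] w + b)).
  rewrite ExZ; last by apply: bmfD => //; exact: bmf_cst.
  by rewrite ExD ?Ex_cst ?Ex_indic//; exact: bmf_cst.
apply: Ex_le; first exact: bmf_soft_prod.
  by apply: bmfZ; apply: bmfD => //; exact: bmf_cst.
move=> w; have [Hw|/existsNP[i /negP]] := pselect (forall i, Y i w < a).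
  rewrite [X in _ <= _ * (X + _)]indicE mem_set//=.
  apply: (@le_trans _ _ ((1 + b) ^+ #|I|)); last by rewrite ler_peMr//; lra.
  rewrite -prodr_const; apply: ler_prod => i _.
  by rewrite indicE mem_set//= lexx andbT; lra.
rewrite -leNgt => Yi; rewrite [X in _ <= _ * (X + _)]indicE memNset/= ?add0r;
  last by move=> /(_ i); rewrite ltNge Yi.
rewrite (bigD1 i)//= indicE memNset/= ?add0r; last by apply/negP; rewrite -leNgt.
rewrite mulrC ler_wpM2r//.
apply: (@le_trans _ _ (\prod_(j | j != i) (1 + b))).
  apply: ler_prod => j _; rewrite indicE; case: (_ \in _) => /=; lra.
rewrite prodr_const ler_weXn2l//; exact: max_card.
Qed.

Lemma soft_parameter n (e : R) : 0 < e -> exists k : R,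
  [/\ 0 < k < 1, 2 * k <= e, (1 + 2 * k) ^+ n <= 1 + e & 1 - e <= (1 - k) ^+ n].
Proof.
move=> e0.
have near1 (a : R) : exists2 b : R, 0 < b &
    forall c, 0 <= c < b -> `|1 - (1 + a * c) ^+ n| < e.
  have : (fun c : R => (1 + a * c) ^+ n) @ (0 : R) --> ((1 + a * 0 : R) ^+ n).
    apply: (cvg_comp (fun c : R => 1 + a * c) (fun x : R => x ^+ n)).
      by apply: cvgD; [|apply: cvgM; [|exact: cvg_id]]; exact: cvg_cst.
    exact: exprn_continuous.
  rewrite mulr0 addr0 expr1n => /cvgrPdist_lt/(_ e e0)/nbhs_ballP[b /= b0 H].
  exists b => // c /andP[c0 cb]; apply: H.
  by rewrite /ball/= sub0r normrN ger0_norm.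
have [b1 b10 H1] := near1 2; have [b2 b20 H2] := near1 (-1).
pose k := Num.min (e / 2) (Num.min 2^-1 (Num.min (b1 / 2) (b2 / 2))).
have k0 : 0 < k by rewrite /k !lt_min invr_gt0 ltr0n/= !divr_gt0.
have [ke k1] : k <= e / 2 /\ k <= 2^-1 by rewrite /k !ge_min !lexx !orbT.
have [kb1 kb2] : k <= b1 / 2 /\ k <= b2 / 2 by rewrite /k !ge_min !lexx !orbT.
have {}H1 : `|1 - (1 + 2 * k) ^+ n| < e by apply: H1; lra.
have {}H2 : `|1 - (1 + -1 * k) ^+ n| < e by apply: H2; lra.
move: H1 H2; rewrite mulN1r !ltr_norml => /andP[h1 _] /andP[_ h2].
by exists k; split; lra.
Qed.

End gaussian_comparison_principle.

Section continuity_of_probability.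
Context d (T : measurableType d) (R : realType) (P : probability T R).
Variable F : nat -> set T.
Hypothesis mF : forall n, measurable (F n).

Lemma pr_bigcup_le (c : R) : (forall n m, (n <= m)%N -> F n `<=` F m) ->
  (forall n, pr P (F n) <= c) -> pr P (\bigcup_n F n) <= c.
Proof.
move=> Fm Fc.
have cF : (P \o F) @ \oo --> P (\bigcup_n F n).
  apply: nondecreasing_cvg_mu => //; first exact: bigcup_measurable.
  by move=> n m nm; apply/subsetPset; exact: Fm.
rewrite -lee_fin prE; last exact: bigcup_measurable.
rewrite -(cvg_lim _ cF)//; apply: lime_le; first by apply/cvg_ex; eexists; exact: cF.
by apply: nearW => n /=; rewrite -prE ?lee_fin.
Qed.

Lemma pr_bigcap_ge (c : R) : (forall n m, (n <= m)%N -> F m `<=` F n) ->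
  (forall n, c <= pr P (F n)) -> c <= pr P (\bigcap_n F n).
Proof.
move=> Fm Fc.
have cF : (P \o F) @ \oo --> P (\bigcap_n F n).
  apply: nonincreasing_cvg_mu => //.
  - by rewrite -ge0_fin_numE// fin_num_measure.
  - exact: bigcap_measurable.
  - by move=> n m nm; apply/subsetPset; exact: Fm.
rewrite -lee_fin prE; last exact: bigcap_measurable.
rewrite -(cvg_lim _ cF)//; apply: lime_ge; first by apply/cvg_ex; eexists; exact: cF.
by apply: nearW => n /=; rewrite -prE ?lee_fin.
Qed.

End continuity_of_probability.

(** * Slepian's inequality and association *)

Section slepian.
Variable R : realType.

Lemma ltr_exists_invn (x r : R) : x < r -> exists n : nat, x < r - n.+1%:R^-1.
Proof.
by move=> /ltr_add_invr[n]; rewrite -ltrBrDr => xn; exists n.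
Qed.

(** Continuity from below in the level. It leaves a gap r - r' > 0, which the comparison lemmas
    consume. *)
Lemma pr_all_lt_le d (T : measurableType d) (P : probability T R) (I : finType)
    (X : I -> T -> R) (r c : R) : (forall i, measurable_fun setT (X i)) ->
  (forall r', r' < r -> pr P [set w | forall i, X i w < r'] <= c) ->
  pr P [set w | forall i, X i w < r] <= c.
Proof.
move=> mX H.
pose F (n : nat) := [set w | forall i, X i w < r - n.+1%:R^-1].
have -> : [set w | forall i, X i w < r] = \bigcup_n F n.
  apply/seteqP; split => w /=; last first.
    by move=> [n _ Fn] i; rewrite (lt_trans (Fn i))// gtrBl invr_gt0.
  move=> Xw.
  have /choice[n Hn] : forall i, exists n : nat, X i w < r - n.+1%:R^-1.
    by move=> i; exact: ltr_exists_invn.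
  exists (\max_i n i)%N => // i; rewrite (lt_le_trans (Hn i))// lerB//.
  by rewrite lef_pV2 ?posrE// ler_nat ltnS leq_bigmax.
apply: pr_bigcup_le => [n|n m nm w /= Fn i|n]; first exact: measurable_all_lt.
  by rewrite (lt_le_trans (Fn i))// lerB// lef_pV2 ?posrE// ler_nat ltnS.
by apply: H; rewrite gtrBl invr_gt0.
Qed.

(** The limit e -> 0 made explicit: as p, q <= 1, all errors together are at most (2 + 4 E) e. *)
Lemma le_of_perturbation (p q E c : R) : 0 <= p <= 1 -> 0 <= q <= 1 -> 0 <= E ->
  (forall e, 0 < e < 1 ->
     (1 - e) * p - e <= E * ((1 + e) * (q + e) + e + c)) ->
  p <= E * (q + c).
Proof.
move=> /andP[p0 p1] /andP[q0 q1] E0 H; apply/ler_addgt0Pr => e0 e00.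
pose M := 2 + 5 * E.
have M0 : 0 < M by rewrite /M; lra.
pose e := Num.min 2^-1 (e0 / M).
have e1 : 0 < e by rewrite /e lt_min divr_gt0// invr_gt0 ltr0n.
have e2 : e <= 2^-1 by rewrite /e ge_min lexx.
have e3 : M * e <= e0.
  rewrite mulrC -ler_pdivlMr//; by rewrite /e ge_min lexx orbT.
have := H e; rewrite e1/=.
have -> : e < 1 by lra.
move=> /(_ isT) h.
have h1 : e * p <= e by rewrite ler_piMr// ltW.
have h2 : (1 + e) * (q + e) + e + c <= q + c + 4 * e.
  have : e * q <= e by rewrite ler_piMr// ltW.
  have : e * e <= e by rewrite ler_piMr ?(ltW e1)//; lra.
  by lra.
have h3 := ler_wpM2l E0 h2.
have h4 : 0 <= E * e by rewrite mulr_ge0// ltW.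
by move: e3 h3; rewrite /M; lra.
Qed.

(** With S <= S' the excess is 0 and the comparison costs no exponential factor; the gap between the
    levels and the softness vanish in the limit. *)
Lemma slepian d1 (T1 : measurableType d1) d2 (T2 : measurableType d2)
    (P : probability T1 R) (Q : probability T2 R) (I : finType)
    (X : I -> T1 -> R) (Y : I -> T2 -> R) (S S' : I -> I -> R) (r : R) :
  gvec P X S -> gvec Q Y S' -> (forall i, S i i = S' i i) ->
  (forall i j, S i j <= S' i j) ->
  pr P [set w | forall i, X i w < r] <= pr Q [set w | forall i, Y i w < r].
Proof.
move=> gX gY diag SS'; have mX := gX.1; have mY := gY.1.
apply: pr_all_lt_le => // r' r'r.
have h0 : 0 < r - r' by rewrite subr_gt0.
have mA := measurable_all_lt r' mX; have mB := measurable_all_lt r mY.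
rewrite -[leRHS]mul1r -[X in 1 * X]addr0.
apply: le_of_perturbation => //; rewrite ?pr_ge0 ?pr_le1//.
move=> e /andP[e0 e1].
have [k [k01 ke Hk2 Hk]] := soft_parameter #|I| e0.
have [C C0 HC] := gaussian_comparison r' h0 k01.
have := HC _ _ _ _ P Q I X Y S S' gX gY diag.
have -> : excess S S' = 0.
  rewrite /excess big1// => i _; rewrite big1// => j _.
  by apply/max_idPl; rewrite subr_le0.
have -> : r' + (r - r') = r by rewrite addrC subrK.
rewrite mulr0 expR0 mul1r => H.
have k20 : 0 <= 2 * k by move: k01; lra.
have := soft_prod_le Q r k20 mY.
have p0 := pr_ge0 P [set w | forall i, X i w < r'].
have q0 := pr_ge0 Q [set w | forall i, Y i w < r].
move: H Hk Hk2 p0 q0 => {HC}.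
set p := pr P _; set q := pr Q _; set a := (1 - k) ^+ _; set a' := (1 + _) ^+ _.
set J := Rintegral _ _ _ => H Hk Hk2 p0 q0 HJ.
have := ler_wpM2r p0 Hk.
have q20 : 0 <= q + 2 * k by rewrite addr_ge0.
have := ler_wpM2r q20 Hk2.
have e10 : 0 <= 1 + e by lra.
have : (1 + e) * (q + 2 * k) <= (1 + e) * (q + e) by rewrite ler_wpM2l// lerD2l.
by lra.
Qed.

(* Slepian's inequality, against the vector whose coordinates in J and outside J
   are taken from two independent copies of X. *)
Lemma gvec_assoc d (T : measurableType d) (P : probability T R) (I : finType)
    (X : I -> T -> R) (S : I -> I -> R) (J : pred I) (r : R) :
  gvec P X S -> (forall i j, 0 <= S i j) ->
  pr P [set w | forall i, J i -> X i w < r] *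
  pr P [set w | forall i, ~~ J i -> X i w < r] <=
  pr P [set w | forall i, X i w < r].
Proof.
move=> gX S0; have mX := gX.1.
pose a i : R := if J i then 1 else 0; pose b i : R := if J i then 0 else 1.
have gZ := gvec_mix a b gX gX.
have mA (K : pred I) : measurable [set w | forall i, K i -> X i w < r].
  rewrite [X in measurable X](_ : _ =
      \bigcap_(i in [set i | K i]) [set w | X i w < r]).
    apply: fin_bigcap_measurable => [|i _]; first exact: finite_finset.
    exact: measurable_lt_set.
  by apply/seteqP; split => w /= H i; exact: H.
apply: le_trans (slepian r gZ gX _ _).
- rewrite -lee_fin EFinM !prE//; last exact: measurable_all_lt gZ.1.
  rewrite -product_measure1E//.
  rewrite [X in (P \x P)%E X](_ : _ =
    [set z | forall i, a i * X i z.1 + b i * X i z.2 < r])//.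
  apply/seteqP; split => [[w w'] /= [H1 H2] i|[w w'] /= H].
    rewrite /a /b; case: ifPn => Ji; rewrite mul1r mul0r ?addr0 ?add0r.
      exact: H1.
    exact: H2.
  split=> i Ji; have := H i; rewrite /a /b.
    by rewrite Ji mul1r mul0r addr0.
  by rewrite (negbTE Ji) mul0r mul1r add0r.
- by move=> i; rewrite /a /b; case: (J i); rewrite !mul1r !mul0r ?addr0 ?add0r.
- move=> i j; rewrite /a /b; case: (J i); case: (J j);
  by rewrite ?mul1r ?mulr0 ?mul0r ?addr0 ?add0r ?mul1r ?mul0r.
Qed.

End slepian.

Section gaussian_field.
Variables (R : realType) (U : eqType).

(** The map [phi] may repeat points: the vectors are then degenerate, and lists of times with
    repetitions need no special care. *)
Definition gfield d (T : measurableType d) (P : probability T R)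
    (X : U -> T -> R) (K : U -> U -> R) : Prop :=
  (forall u, measurable_fun setT (X u)) /\
  forall (I : finType) (phi : I -> U),
    gvec P (fun i => X (phi i)) (fun i j => K (phi i) (phi j)).

Definition below (T : Type) (X : U -> T -> R) (s : seq U) (r : R) : set T :=
  [set w | forall t, t \in s -> X t w < r].

Lemma below_tnth (T : Type) (X : U -> T -> R) (s : seq U) (r : R) :
  below X s r = [set w | forall i : 'I_(size s), X (tnth (in_tuple s) i) w < r].
Proof.
apply/seteqP; split => w /= H.
  by move=> i; apply: H; exact: mem_tnth.
by move=> t /(tnthP (in_tuple s))[i ->]; exact: H.
Qed.

Section one_field.
Context d (T : measurableType d) (P : probability T R).
Variables (X : U -> T -> R) (K : U -> U -> R).
Hypothesis gX : gfield P X K.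

Lemma measurable_below s r : measurable (below X s r).
Proof. by rewrite below_tnth; apply: measurable_all_lt => i; exact: gX.1. Qed.

Lemma pr_below_perm s s' r : s =i s' -> pr P (below X s r) = pr P (below X s' r).
Proof.
by move=> ss'; congr pr; apply/seteqP; split => w /= H t ts; apply: H;
  rewrite ?ss'// -ss'.
Qed.

Hypothesis K0 : forall u v, 0 <= K u v.

Lemma below_assoc s s' r :
  pr P (below X s r) * pr P (below X s' r) <= pr P (below X (s ++ s') r).
Proof.
pose phi (i : 'I_(size s) + 'I_(size s')) : U :=
  match i with inl i => tnth (in_tuple s) i | inr i => tnth (in_tuple s') i end.
have := gvec_assoc (fun i => if i is inl _ then true else false) r (gX.2 _ phi)
  (fun i j => K0 _ _).
rewrite [X in pr P X * _](_ : _ = below X s r); last first.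
  rewrite below_tnth; apply/seteqP; split => w /= H.
    by move=> i; exact: (H (inl i)).
  by move=> [i|]// _; exact: H.
rewrite [X in _ * pr P X](_ : _ = below X s' r); last first.
  rewrite below_tnth; apply/seteqP; split => w /= H.
    by move=> i; exact: (H (inr i)).
  by move=> [|i]// _; exact: H.
move=> /le_trans; apply; apply: pr_le.
- by apply: measurable_all_lt => i; exact: gX.1.
- exact: measurable_below.
move=> w /= H t; rewrite mem_cat => /orP[] /(tnthP (in_tuple _))[i ->].
  exact: (H (inl i)).
exact: (H (inr i)).
Qed.

Variables (r q : R).
Hypotheses (q0 : 0 <= q) (qX : forall u, q <= pr P (below X [:: u] r)).

Lemma below_ge_expr s : q ^+ size s <= pr P (below X s r).
Proof.
elim: s => [|u s IH] /=.
  rewrite expr0 (_ : below X [::] r = setT); last by apply/seteqP; split.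
  by rewrite /pr probability_setT.
by rewrite exprS; apply: le_trans (below_assoc [:: u] s r); apply: ler_pM => //; exact: exprn_ge0.
Qed.

Lemma below_drop s s' :
  pr P (below X s r) * q ^+ size s' <= pr P (below X (s ++ s') r).
Proof.
apply: le_trans (below_assoc _ _ _); rewrite ler_wpM2l ?pr_ge0//.
exact: below_ge_expr.
Qed.

(* The product is expanded over the set J of the coordinates whose indicator is
   kept; restoring the others costs a factor 1 / q each, by association. *)
Lemma soft_below_le s (b : R) : 0 < q -> 0 <= b ->
  \int[P]_w (\prod_(i < size s)
     (\1_[set w | X (tnth (in_tuple s) i) w < r] w + b)) <=
  (1 + b / q) ^+ size s * pr P (below X s r).
Proof.
move=> qgt0 b0; set n := size s.
pose t (i : 'I_n) := tnth (in_tuple s) i.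
have mX i : measurable_fun setT (X (t i)) by exact: gX.1.
pose G (J : {set 'I_n}) w : R :=
  \prod_i (if i \in J then \1_[set w | X (t i) w < r] w else b).
have bG J : bmf (G J).
  apply: bmf_prod => i; case: (i \in J); last exact: bmf_cst.
  by apply: bmf_indic; exact: measurable_lt_set.
have -> : \int[P]_w (\prod_(i < n) (\1_[set w | X (t i) w < r] w + b)) =
    \sum_(J : {set 'I_n}) \int[P]_w G J w.
  rewrite -Ex_sum//; apply: eq_Rintegral => w _.
  by rewrite bigA_distr/=; apply: eq_bigl => J; rewrite inE.
have -> : (1 + b / q) ^+ n = \sum_(J : {set 'I_n}) \prod_i (if i \in J then 1 else b / q).
  transitivity (\prod_(i < n) (1 + b / q)).
    by rewrite prodr_const card_ord.
  rewrite bigA_distr/=.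
  by apply: eq_bigl => J; rewrite inE.
rewrite mulr_suml; apply: ler_sum => J _.
pose s1 := [seq t i | i <- enum J]; pose s2 := [seq t i | i <- enum (~: J)].
have GE w : G J w = b ^+ size s2 * \1_(below X s1 r) w.
  rewrite /G big_if/= mulrC; congr (_ * _).
    rewrite /s2 size_map -cardE -prodr_const; apply: eq_bigl => i.
    by rewrite inE.
  have [Hw|Hw] := pselect (below X s1 r w).
    rewrite indicE mem_set//= big1// => i iJ; rewrite indicE mem_set//=.
    by apply: Hw; apply: map_f; rewrite mem_enum.
  rewrite indicE memNset//=.
  move/existsNP : Hw => [u /not_implyP[/mapP[i]]].
  rewrite mem_enum => iJ -> Xi.
  by rewrite (bigD1 i)//= indicE memNset// mul0r.
have -> : \int[P]_w G J w = b ^+ size s2 * pr P (below X s1 r).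
  have m1 := measurable_below s1 r.
  rewrite -Ex_indic// -ExZ; last exact: bmf_indic.
  by apply: eq_Rintegral => w _; exact: GE.
have -> : \prod_i (if i \in J then 1 else b / q) = (b / q) ^+ size s2.
  rewrite big_if/= big1// mul1r /s2 size_map -cardE -prodr_const.
  by apply: eq_bigl => i; rewrite inE.
rewrite expr_div_n -mulrA ler_wpM2l ?exprn_ge0// mulrC ler_pdivlMr ?exprn_gt0//.
have -> : pr P (below X s r) = pr P (below X (s1 ++ s2) r).
  apply: pr_below_perm => u; rewrite mem_cat; apply/idP/idP.
    move=> /(tnthP (in_tuple s))[i ->].
    have [iJ|iJ] := boolP (i \in J); apply/orP; [left|right];
      by apply/mapP; exists i; rewrite ?mem_enum ?inE.
  by case/orP => /mapP[i _ ->]; exact: mem_tnth.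
exact: below_drop.
Qed.

End one_field.

End gaussian_field.

(** * Change of level along the row sums of the covariance *)

Section shift.
Variable R : realType.

Lemma derive_le_of_right_bound (H : R -> R) (a M : R) :
  is_derive (0 : R) 1 H a -> H 0 = 0 -> (forall t, 0 < t -> H t <= t * M) ->
  a <= M.
Proof.
move=> [dH aE] H0 HM; rewrite leNgt; apply/negP => Ma.
have cH : (fun h : R => h^-1 *: (H (h *: 1 + 0) - H 0)) @ 0^' --> a.
  by rewrite -aE; exact: dH.
have e0 : 0 < a - M by rewrite subr_gt0.
have /cvgrPdist_lt/(_ _ e0) := cH.
rewrite near_withinE => /nbhs_ballP[e /= ep He].
have e2 : 0 < e / 2 by rewrite divr_gt0.
have : ball (0 : R) e (e / 2).
  by rewrite /ball/= sub0r normrN gtr0_norm// ltr_pdivrMr// ltr_pMr// ltr1n.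
move=> /He/(_ (lt0r_neq0 e2)); rewrite H0 subr0 addr0 /GRing.scale/= mulr1.
have : (e / 2)^-1 * H (e / 2) <= M.
  by rewrite mulrC ler_pdivrMr// [leRHS]mulrC; exact: HM.
move=> h1; rewrite ltr_norml => /andP[_ h2].
by move: (lt_le_trans h2 (lexx _)); rewrite ltrBlDr => h3; lra.
Qed.

Lemma norm_sin_le (x : R) : `|sin x| <= `|x|.
Proof.
wlog x0 : x / 0 <= x.
  move=> H; have [/H//|/ltW x0] := leP 0 x.
  by rewrite -normrN -sinN -[leRHS]normrN; apply: H; rewrite oppr_ge0.
have cs : {within `[0, x], continuous (@sin R)}.
  by apply: continuous_subspaceT => y; exact: continuous_sin.
have [c _] := MVT_segment x0 (fun x _ => is_derive_sin x) cs.
rewrite sin0 !subr0 => ->; rewrite normrM ler_piMl//; exact: cos_max.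
Qed.

Context d (T : measurableType d) (P : probability T R) (I : finType).
Variables (Y : I -> T -> R) (D : I -> I -> R).
Hypothesis gY : gvec P Y D.
Hypothesis Dsym : forall i j, D i j = D j i.

Let g i := \sum_j D i j.
Let W w := \sum_i Y i w.

Variable V : R.
Hypothesis expW : P.-integrable setT (EFin \o (fun w => expR `|W w|)).
Hypothesis VW : \int[P]_w expR `|W w| <= V.

Let mY : forall i, measurable_fun setT (Y i) := gY.1.

Let shifted (u : R) i w : R := Y i w - u * g i.

Let mshifted u i : measurable_fun setT (shifted u i).
Proof. by apply: measurable_funB => //; exact: measurable_cst. Qed.

Let mW : measurable_fun setT W.
Proof. exact: measurable_sum. Qed.

Let pairing (c : I -> R) := \sum_i c i * g i.

(** Adding [t] to all frequencies multiplies a wave by one in t W. The term linear in [t] is the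
    pairing with the row sums [g], that is the derivative of the phase along the shift: this
    identity is the integration by parts on the side of characteristic functions. *)
Lemma cov_form_shift (c : I -> R) (t : R) :
  cov_form D (fun i => c i + t) =
  cov_form D c + 2 * t * pairing c + t ^+ 2 * \sum_i g i.
Proof.
have E1 : \sum_i \sum_j t * c i * D i j = t * pairing c.
  rewrite /pairing mulr_sumr; apply: eq_bigr => i _.
  by rewrite /g !mulr_sumr; apply: eq_bigr => j _; ring.
have E2 : \sum_i \sum_j t * c j * D i j = t * pairing c.
  rewrite exchange_big/= -E1; apply: eq_bigr => i _; apply: eq_bigr => j _.
  by rewrite (Dsym j i).
have E3 : \sum_i \sum_j t ^+ 2 * D i j = t ^+ 2 * \sum_i g i.
  by rewrite mulr_sumr; apply: eq_bigr => i _; rewrite /g mulr_sumr.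
rewrite -E3 (_ : 2 * t * pairing c = t * pairing c + t * pairing c); last by ring.
rewrite -{1}E1 -E2 /cov_form -!big_split/=; apply: eq_bigr => i _.
by rewrite -!big_split/=; apply: eq_bigr => j _; ring.
Qed.

(* By Gaussian integration by parts the derivative of E F (Y - u g) in u is
   - E [W F (Y - u g)], and - W <= b + exp (|W| - b). *)
Lemma shift_derivative_bound s (b : R) : 0 <= b ->
  (forall x : I -> R, 0 <= trig_sum s x <= 1) ->
  exists psi dpsi : R -> R, [/\
    forall u, psi u = \int[P]_w trig_sum s ((shifted u) ^~ w),
    forall u : R, is_derive u 1 psi (dpsi u) &
    forall u, dpsi u <= b * psi u + expR (- b) * V].
Proof.
move=> b0 F01.
pose E (q : R * (I -> R) * R) := expR (- cov_form D q.1.2 / 2).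
pose th (q : R * (I -> R) * R) u := q.2 - u * pairing q.1.2.
pose psi u := \sum_(q <- s) q.1.1 * (cos (th q u) * E q).
pose dpsi u := \sum_(q <- s) q.1.1 * (pairing q.1.2 * (sin (th q u) * E q)).
have phaseE q u w : trig_phase q ((shifted u) ^~ w) =
    \sum_i q.1.2 i * Y i w + th q u.
  rewrite /trig_phase /th /pairing mulr_sumr -sumrN [q.2 + _]addrC addrA -big_split/=.
  by congr (_ + _); apply: eq_bigr => i _; rewrite /shifted; ring.
have psiE u : psi u = \int[P]_w trig_sum s ((shifted u) ^~ w).
  have b1 (q : R * (I -> R) * R) : bmf (fun w => cos (trig_phase q (shifted u ^~ w))).
    by apply: bmf_cos; exact: measurable_lin.
  rewrite /trig_sum Ex_sum; last by move=> q; exact: bmfZ.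
  apply: eq_bigr => q _; rewrite ExZ//.
  by under eq_Rintegral do rewrite phaseE; rewrite gY.2.
have dE (u : R) : is_derive u 1 psi (dpsi u).
  apply: is_derive_bigsum => q.
  have -> : (fun u => q.1.1 * (cos (th q u) * E q)) =
     (q.1.1 * E q) \*: (cos \o (fun u => q.2 + (- pairing q.1.2) * u)).
    apply/funext => v; rewrite /th /= /GRing.scale/= mulNr (mulrC v).
    by ring.
  apply: (is_derive_eq (is_deriveZ (q.1.1 * E q) (is_derive1_comp
    (is_derive_cos _) (is_derive_affine q.2 (- pairing q.1.2) u)))).
  have -> : q.2 + - pairing q.1.2 * u = th q u by rewrite /th; ring.
  by rewrite /GRing.scale/=; ring.
exists psi, dpsi; split => // u.
set M := b * psi u + _.
pose F w := trig_sum s ((shifted u) ^~ w).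
have bF : bmf F.
  apply: bmf_sum => q; apply: bmfZ; apply: bmf_cos.
  exact: measurable_lin.
pose G (e : R) (q : R * (I -> R) * R) (t : R) := expR (- cov_form D (fun i => q.1.2 i + e * t) / 2).
(* A bounded stand-in for - E [W F]: [H t] is E [F (- sin (t W))], whose derivative at 0 is read off
   the characteristic function. No derivative has to pass under the expectation with the unbounded
   [W]. *)
pose H (t : R) := \sum_(q <- s) (q.1.1 * - sin (th q u) / 2) * (G 1 q t - G (-1) q t).
have HE t : H t = \int[P]_w (F w * - sin (t * W w)).
  have b1 e (q : R * (I -> R) * R) : bmf (fun w => cos
      (\sum_i (q.1.2 i + e * t) * Y i w + (th q u + pi / 2))).
    by apply: bmf_cos; exact: measurable_lin.
  transitivity (\int[P]_w (\sum_(q <- s) (q.1.1 / 2) *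
     (cos (\sum_i (q.1.2 i + 1 * t) * Y i w + (th q u + pi / 2)) +
      (-1) * cos (\sum_i (q.1.2 i + (-1) * t) * Y i w + (th q u + pi / 2))))).
    rewrite Ex_sum; last first.
      by move=> q; apply: bmfZ; apply: bmfD => //; exact: bmfZ.
    apply: eq_bigr => q _; rewrite ExZ; last by apply: bmfD => //; exact: bmfZ.
    rewrite ExD//; last exact: bmfZ.
    rewrite ExZ// !gY.2 cosDpihalf /G; ring.
  apply: eq_Rintegral => w _; rewrite /F /trig_sum mulr_suml; apply: eq_bigr => q _.
  have sumE e : \sum_i (q.1.2 i + e * t) * Y i w + (th q u + pi / 2) =
      (\sum_i q.1.2 i * Y i w + th q u) + e * (t * W w) + pi / 2.
    have -> : \sum_i (q.1.2 i + e * t) * Y i w =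
        \sum_i q.1.2 i * Y i w + e * (t * W w); last by ring.
    rewrite /W !mulr_sumr -big_split/=; apply: eq_bigr => i _; ring.
  rewrite !sumE phaseE; move: (\sum_i _ + _) (t * W w) => x y.
  by rewrite !cosDpihalf mul1r !mulN1r sinD sinB; field.
have H0 : H 0 = 0.
  by rewrite /H; apply: big1 => p _; rewrite /G !mulr0 subrr mulr0.
have dH : is_derive (0 : R) 1 H (dpsi u).
  apply: is_derive_bigsum => q.
  set v := \sum_i g i; set p := pairing q.1.2.
  have quad e : is_derive (0 : R) 1 (G e q) (E q * - (e * p)).
    have -> : G e q = expR \o (fun t => (- cov_form D q.1.2 / 2) +
       (- (e * p)) * t + (- (e ^+ 2 * v / 2)) * t ^+ 2).
      by apply/funext => t /=; rewrite /G cov_form_shift; congr expR; rewrite -/v -/p; field.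
    have h : is_derive (0 : R) 1 (fun t : R => (- cov_form D q.1.2 / 2) +
       (- (e * p)) * t + (- (e ^+ 2 * v / 2)) * t ^+ 2) (- (e * p)).
      by apply: is_derive_eq; rewrite /GRing.scale/=; ring.
    have := is_derive1_comp (is_derive_expR _) h.
    by rewrite mulr0 addr0 expr0n/= mulr0 addr0.
  have := is_deriveZ (q.1.1 * - sin (th q u) / 2)
    (is_deriveB (quad 1) (quad (-1))).
  rewrite /GRing.scale/=.
  have -> : q.1.1 * - sin (th q u) / 2 * (E q * - (1 * p) - E q * - (-1 * p)) =
    q.1.1 * (p * (sin (th q u) * E q)) by field.
  by [].
apply: (derive_le_of_right_bound dH H0) => t t0; rewrite HE.
have -> : t * M = \int[P]_w (t * (b * F w + expR (- b) * V)).
  have bc := bmf_cst T (expR (- b) * V).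
  rewrite ExZ; last by apply: bmfD => //; exact: bmfZ.
  by rewrite ExD// ?Ex_cst ?ExZ// ?/M ?psiE//; exact: bmfZ.
have bS : bmf (fun w => F w * - sin (t * W w)).
  apply: bmfM => //.
  have -> : (fun w => - sin (t * W w)) = (fun w => cos (t * W w + pi / 2)).
    by apply/funext => w; rewrite cosDpihalf.
  apply: bmf_cos; apply: measurable_funD => //; exact: measurable_funM.
pose L w := t * (b * F w) + t * expR (- b) * expR `|W w|.
have iF : P.-integrable setT (EFin \o (fun w => t * (b * F w))).
  by apply/bmf_integrable/bmfZ/bmfZ.
have iW : P.-integrable setT (EFin \o (fun w => t * expR (- b) * expR `|W w|)).
  by apply: (integrableZl measurableT (t * expR (- b)) expW).
have iL : P.-integrable setT (EFin \o L) by exact: (integrableD measurableT iF iW).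
apply: (@le_trans _ _ (\int[P]_w L w)).
  apply: le_Rintegral => //; first exact: bmf_integrable.
  move=> w _; rewrite /L -mulrA -mulrDr.
  have /andP[f0 f1] := F01 (shifted u ^~ w).
  have sW : - sin (t * W w) <= t * `|W w|.
    rewrite (le_trans (ler_norm _))// normrN.
    have -> : t * `|W w| = `|t * W w| by rewrite normrM (gtr0_norm t0).
    exact: norm_sin_le.
  (* The inequality exp x >= 1 + x at x = |W| - b. *)
  have Wb : `|W w| <= b + expR (- b) * expR `|W w|.
    rewrite -expRD; have := expR_ge1Dx (- b + `|W w|); lra.
  apply: (@le_trans _ _ (F w * (t * `|W w|))); first by rewrite ler_wpM2l.
  rewrite mulrCA ler_pM2l//.
  have : F w * `|W w| <= F w * (b + expR (- b) * expR `|W w|) by rewrite ler_wpM2l.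
  by move=> /le_trans; apply; rewrite mulrDr (mulrC _ b) lerD2l ler_piMl// mulr_ge0 ?expR_ge0.
rewrite /L RintegralD// !RintegralZl//; last 3 first.
- by apply: bmf_integrable; apply: bmfD; [exact: bmfZ|exact: bmf_cst].
- exact: bmf_integrable.
- by apply/bmf_integrable/bmfZ.
rewrite ExD; [|exact: bmfZ|exact: bmf_cst].
rewrite Ex_cst ExZ// mulrDr lerD2l -mulrA ler_pM2l// ler_wpM2l// expR_ge0//.
Qed.

(** Row sums at least 1 ensure that the shift by dl g lowers every coordinate by at least [dl]. The
    rate [b] is free: raising it shrinks the additive remainder and increases the factor exp (b
    dl). *)
Lemma gaussian_shift (r b dl : R) : 0 <= b -> 0 <= dl -> (forall i, 1 <= g i) ->
  pr P [set w | forall i, Y i w < r + dl] <=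
  expR (b * dl) * (pr P [set w | forall i, Y i w < r] + expR (- b) * V * dl).
Proof.
move=> b0 dl0 g1.
have V0 : 0 <= V.
  by apply: le_trans VW; apply: Rintegral_ge0 => w _; exact: expR_ge0.
have cV0 : 0 <= expR (- b) * V by rewrite mulr_ge0// expR_ge0.
apply: pr_all_lt_le => // r' r'r.
(* Chosen such that r - h = r' - dl: the test function between the levels [r - h] and [r] then fits
   the shifted vector at [r'] and the original one at [r]. *)
pose h := r + dl - r'; have h0 : 0 < h by rewrite subr_gt0.
have mr' := measurable_all_lt r' mY; have mr := measurable_all_lt r mY.
apply: le_of_perturbation.
- by rewrite pr_ge0 pr_le1.
- by rewrite pr_ge0 pr_le1.
- exact: expR_ge0.
move=> e /andP[e0 e1].
have [k [k01 ke Hk2 Hk]] := soft_parameter #|I| e0.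
have k0 : 0 < k by have /andP[] := k01.
have k20 : 0 <= 2 * k by rewrite mulr_ge0// ltW.
have [C C0 [B1 HC]] := test_function_exists (r - h) h0 k01.
have nY i : measurable_fun setT (fun w => `|Y i w|) by exact: measurableT_comp.
have nZ i : measurable_fun setT (fun w => `|shifted dl i w|).
  by apply: measurableT_comp => //; exact: mshifted.
have [BY HY] := pr_tail_sum P (index_enum I) nY e0.
have [BZ HZ] := pr_tail_sum P (index_enum I) nZ e0.
pose B := Num.max B1 (Num.max BY BZ).
have {}HY : \sum_i pr P [set w | B < `|Y i w|] <= e.
  by apply: HY; rewrite /B !le_max lexx !orbT.
have {}HZ : \sum_i pr P [set w | B < `|shifted dl i w|] <= e.
  by apply: HZ; rewrite /B !le_max lexx !orbT.
have [|f tf] := HC B; first by rewrite /B le_max lexx.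
have [fT f01 _ _ _] := tf.
have [s sE] := trig_poly_prod (fun i => fT I i).
have {}sE (x : I -> R) : \prod_i f (x i) = trig_sum s x by exact: sE.
have F01 x : 0 <= trig_sum s x <= 1.
  rewrite -sE prodr_ge0/=; last by move=> i _; have /andP[/ltW] := f01 (x i).
  by apply: prodr_ile1 => i _; have /andP[/ltW -> ->] := f01 (x i).
have [psi [dpsi [psiE dpsiE dpsi_le]]] := shift_derivative_bound b0 F01.
have := gronwall b0 cV0 dl0 dpsiE (fun x _ => dpsi_le x).
have psi_dl : (1 - e) * pr P [set w | forall i, Y i w < r'] - e <= psi dl.
  rewrite psiE; under eq_Rintegral do rewrite -sE.
  apply: le_trans (test_prod_lower P k01 tf (mshifted dl)).
  apply: lerB => //; apply: ler_pM => //.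
  - by rewrite subr_ge0 ltW.
  - exact: pr_ge0.
  apply: pr_le => //; first exact: measurable_all_lt (mshifted dl).
  move=> w /= Yw i; rewrite /shifted ltrBlDr (lt_le_trans (Yw i))//.
  have := ler_wpM2l dl0 (g1 i); rewrite /h; lra.
have psi_0 : psi 0 <= (1 + e) * (pr P [set w | forall i, Y i w < r] + e) + e.
  rewrite psiE; under eq_Rintegral do rewrite -sE.
  have := test_prod_upper P k0 tf mY.
  rewrite subrK => H.
  have -> : \int[P]_w (\prod_i f (shifted 0 i w)) = \int[P]_w (\prod_i f (Y i w)).
    by apply: eq_Rintegral => w _; apply: eq_bigr => i _; rewrite /shifted mul0r subr0.
  apply: (le_trans H); apply: lerD => //.
  apply: (le_trans (soft_prod_le P r k20 mY)).
  apply: ler_pM => //; first by rewrite exprn_ge0// addr_ge0.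
    by rewrite addr_ge0// pr_ge0.
  by rewrite lerD2l.
move=> H; apply: (le_trans psi_dl); apply: (le_trans H).
by rewrite ler_wpM2l ?expR_ge0// lerD2r.
Qed.

End shift.

(** * Gaussian laws and processes *)

Lemma norm_le_sqrD1 (R : realFieldType) (x : R) : `|x| <= x ^+ 2 + 1.
Proof.
rewrite -real_normK ?num_real//; have := normr_ge0 x.
by have := sqr_ge0 (`|x| - 1); nra.
Qed.

(** * The normal density: moments and characteristic function *)

Section normal_density.
Variable R : realType.
Local Notation mu := (@lebesgue_measure R).

(** The Radon-Nikodym derivative of the normal law and the density have the same integral on every
    measurable set, hence agree almost everywhere. *)
Lemma ge0_integral_normal_prob (m s : R) (f : R -> \bar R) : s != 0 ->
  measurable_fun setT f -> (forall x, 0 <= f x)%E ->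
  (\int[normal_prob m s]_x f x = \int[mu]_x (f x * (normal_pdf m s x)%:E))%E.
Proof.
move=> s0 mf f0.
have dom := normal_prob_dominates m s.
rewrite -(Radon_Nikodym_SigmaFinite.change_of_variables dom)//.
have mpdf : measurable_fun setT (EFin \o normal_pdf m s).
  by apply/measurable_EFinP; exact: measurable_normal_pdf.
have iRN := Radon_Nikodym_SigmaFinite.f_integrable dom.
apply: ae_eq_integral => //.
- by apply: emeasurable_funM => //; exact: (measurable_int mu iRN).
- exact: emeasurable_funM.
- apply: ae_eqe_mul2l => /=.
  apply: integral_ae_eq => // E E01 mE.
  by rewrite -(Radon_Nikodym_SigmaFinite.f_integral dom).
Qed.

Lemma integral_normal_prob (m s : R) (f : R -> \bar R) : s != 0 ->
  measurable_fun setT f ->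
  (\int[normal_prob m s]_x f x = \int[mu]_x (f x * (normal_pdf m s x)%:E))%E.
Proof.
move=> s0 mf; rewrite integralE [RHS]integralE.
rewrite !ge0_integral_normal_prob//; [|exact: measurable_funeneg|exact: measurable_funepos].
have p0 x : (0 <= (normal_pdf m s x)%:E)%E by rewrite lee_fin normal_pdf_ge0.
congr (_ - _)%E; apply: eq_integral => x _.
  by rewrite !funeposE maxeMl// mul0e.
by rewrite !funenegE -mulNe maxeMl// mul0e.
Qed.

(** Decay of [G] like 1 / |x - m| removes the boundary terms at infinity. Taking for [G] the
    density, its product with x - m and its product with a sine gives the mean, the variance and the
    equation for the characteristic function. *)
Lemma integral_derivative_eq0 (G g : R -> R) (m K : R) : continuous g ->
  (forall x : R, is_derive x 1 G (g x)) -> mu.-integrable setT (EFin \o g) ->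
  (forall x, `|x - m| * `|G x| <= K) -> \int[mu]_x g x = 0.
Proof.
move=> cg Gg ig GK.
pose A (n : nat) : set R := [set` `[m - n.+1%:R, m + n.+1%:R]].
have mA n : measurable (A n) by exact: measurable_itv.
have GK0 (n : nat) (x : R) : `|x - m| = n.+1%:R -> `|G x| <= K * n.+1%:R^-1.
  move=> xm; rewrite ler_pdivlMr// mulrC -xm; exact: GK.
have intA n : \int[mu]_(x in A n) g x = G (m + n.+1%:R) - G (m - n.+1%:R).
  have lt : m - n.+1%:R < m + n.+1%:R.
    by rewrite ltrD2l (@lt_trans _ _ 0)// oppr_lt0.
  have cG x : {for x, continuous G}.
    by apply/differentiable_continuous/derivable1_diffP; have [] := Gg x.
  rewrite /Rintegral (@continuous_FTC2 R g G)//.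
  - exact: continuous_subspaceT.
  - split.
    + by move=> x _; have [] := Gg x.
    + by apply: cvg_at_right_filter; exact: cG.
    + by apply: cvg_at_left_filter; exact: cG.
  - by move=> x _; rewrite derive1E; have [_ ->] := Gg x.
have lim0 : \int[mu]_(x in A n) g x @[n --> \oo] --> 0.
  apply: norm_cvg0.
  apply: (@squeeze_cvgr _ _ _ _ (fun=> 0) (fun n : nat => 2 * K * n.+1%:R^-1)).
  - apply: nearW => n; rewrite normr_ge0/= intA (le_trans (ler_normB _ _))//.
    rewrite mulrAC -mulrA mulr_natl mulr2n mulrC; apply: lerD; apply: GK0.
      by rewrite addrC addKr ger0_norm.
    by rewrite addrC addKr normrN ger0_norm.
  - exact: cvg_cst.
  - rewrite -(mulr0 (2 * K)); apply: cvgM; first exact: cvg_cst.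
    exact: cvg_harmonic.
have limI : \int[mu]_(x in A n) g x @[n --> \oo] --> \int[mu]_x g x.
  have mg : measurable_fun setT g by exact: continuous_measurable_fun.
  have := @dominated_convergence _ _ _ mu setT measurableT
    (fun n x => (EFin \o g) \_ (A n) x) (EFin \o g) (fun x => `|g x|%:E).
  move=> []//.
  - move=> n; apply: (measurable_restrictT (EFin \o g) (mA n)).1.
    by apply/measurable_EFinP; exact: measurable_funTS.
  - exact/measurable_EFinP.
  - apply: aeW => /= x _; apply: cvg_near_cst; near=> n.
    pose z : R := `|(x : R) - m|.
    have H : z < n.+1%:R.
      near: n; exists (`|Num.ceil z|%N) => // n /= Hn.
      rewrite (le_lt_trans (ceil_ge _))// -natr1.
      rewrite (le_lt_trans (y := n%:R)) ?ltrDl//.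
      rewrite (le_trans (y := (`|Num.ceil z|%N)%:R)) ?ler_nat//.
      by rewrite natr_absz ler_int ler_norm.
    rewrite patchE ifT// inE /A/= in_itv/=.
    move: H; rewrite /z ltr_norml => /andP[h1 h2].
    by rewrite lerBlDr -lerBlDl; apply/andP; split; lra.
  - by move/integrable_abse : ig.
  - apply: aeW => x n _; rewrite patchE; case: ifP => _ /=; rewrite lee_fin//.
    by rewrite normr0.
  move=> _ _; rewrite -(fineK (integrable_fin_num measurableT ig)).
  move=> /fine_cvg; apply: cvg_trans; apply: near_eq_cvg; near=> n.
  by rewrite /Rintegral [in RHS]integral_mkcond.
by have := cvg_unique _ lim0 limI => /(_ (@norm_hausdorff _ _)) ->.
Unshelve. all: end_near. Qed.

End normal_density.

Section normal_moments.
Variables (R : realType) (m s : R).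
Hypothesis s0 : 0 < s.
Local Notation mu := (@lebesgue_measure R).
Local Notation phi := (normal_pdf m s).

Let sn0 : s != 0. Proof. by rewrite gt_eqF. Qed.

Let q0 : Num.sqrt 2 * s != 0.
Proof. by rewrite mulf_neq0// gt_eqF// sqrtr_gt0. Qed.

Lemma normal_pdf_expR (x : R) :
  phi x = normal_peak s * expR (- (x - m) ^+ 2 / (2 * s ^+ 2)).
Proof. by rewrite normal_pdfE// /normal_fun -mulr_natl. Qed.

Lemma is_derive_normal_pdf (x : R) :
  is_derive x 1 phi (- ((x - m) / s ^+ 2) * phi x).
Proof.
have -> : phi = normal_peak s \*:
    (expR \o (fun x => - (2 * s ^+ 2)^-1 * (x - m) ^+ 2)).
  apply/funext => y; rewrite normal_pdf_expR /= /GRing.scale/=.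
  by congr (_ * expR _); rewrite mulNr mulrC mulNr.
have h : is_derive x 1 (fun x => - (2 * s ^+ 2)^-1 * (x - m) ^+ 2)
    (- ((x - m) / s ^+ 2)).
  by apply: is_derive_eq; rewrite /GRing.scale/=; field.
apply: (is_derive_eq (is_deriveZ (normal_peak s)
  (is_derive1_comp (is_derive_expR _) h))).
by rewrite /= /GRing.scale/=; ring.
Qed.

(** The Gaussian factor is split into two equal halves: one absorbs the square, the other is, up to
    a constant, the density with variance 2 s^2. *)
Lemma sqr_normal_pdf_le (x : R) : (x - m) ^+ 2 * phi x <=
  4 * s ^+ 2 * (normal_peak s / normal_peak (Num.sqrt 2 * s)) *
    normal_pdf m (Num.sqrt 2 * s) x.
Proof.
rewrite (normal_pdfE _ q0) normal_pdf_expR.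
have pk : normal_peak (Num.sqrt 2 * s) != 0 by rewrite gt_eqF// normal_peak_gt0.
rewrite -[X in _ <= X]mulrA [X in _ <= _ * X]mulrA divfK//.
rewrite /normal_fun; have -> : (Num.sqrt 2 * s) ^+ 2 *+ 2 = 2 * (2 * s ^+ 2).
  by rewrite exprMn sqr_sqrtr// [RHS]mulr_natl.
set a := (x - m) ^+ 2.
have a0 : 0 <= a by exact: sqr_ge0.
have d0 : 0 < 2 * (2 * s ^+ 2) by rewrite !mulr_gt0.
have -> : expR (- a / (2 * s ^+ 2)) =
    expR (- a / (2 * (2 * s ^+ 2))) * expR (- a / (2 * (2 * s ^+ 2))).
  by rewrite -expRD; congr expR; field.
set E := expR (- a / _).
have aE : a * E <= 4 * s ^+ 2.
  have := expR_ge1Dx (a / (2 * (2 * s ^+ 2))) => h.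
  have E1 : E * expR (a / (2 * (2 * s ^+ 2))) = 1.
    by rewrite /E -expRD mulNr addNr expR0.
  have E0 : 0 <= E by exact: expR_ge0.
  have : E * (a / (2 * (2 * s ^+ 2))) <= 1.
    by rewrite -[leRHS]E1 ler_wpM2l// (le_trans _ h)// lerDr.
  rewrite mulrA ler_pdivrMr// mul1r mulrC; lra.
have -> : a * (normal_peak s * (E * E)) = (a * E) * (normal_peak s * E) by ring.
by rewrite ler_wpM2r// mulr_ge0 ?normal_peak_ge0 ?expR_ge0.
Qed.

Lemma sqr_normal_pdf_bound : exists2 K : R, 0 <= K &
  forall x, (x - m) ^+ 2 * phi x <= K /\ `|x - m| * phi x <= K.
Proof.
set c := 4 * s ^+ 2 * (normal_peak s / normal_peak (Num.sqrt 2 * s)).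
have c0 : 0 <= c.
  by rewrite mulr_ge0 ?divr_ge0 ?normal_peak_ge0// mulr_ge0// sqr_ge0.
pose K0 := c * normal_peak (Num.sqrt 2 * s).
have K00 : 0 <= K0 by rewrite mulr_ge0// normal_peak_ge0.
exists (K0 + normal_peak s); first by rewrite addr_ge0// normal_peak_ge0.
move=> x.
have h1 : (x - m) ^+ 2 * phi x <= K0.
  apply: (le_trans (sqr_normal_pdf_le x)); rewrite ler_wpM2l//.
  exact: normal_pdf_ub.
have p0 := normal_peak_ge0 s.
split; first by rewrite (le_trans h1)// lerDl.
have f0 := normal_pdf_ge0 m s x.
have fub := normal_pdf_ub m x sn0.
have := norm_le_sqrD1 (x - m).
move=> /(ler_wpM2r f0) /le_trans; apply.
by rewrite mulrDl mul1r lerD.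
Qed.

Lemma integrable_sqr_normal_pdf :
  mu.-integrable setT (fun x => ((x - m) ^+ 2 * phi x)%:E).
Proof.
set c := 4 * s ^+ 2 * (normal_peak s / normal_peak (Num.sqrt 2 * s)).
have ib : mu.-integrable setT
    (fun x => (c%:E * (normal_pdf m (Num.sqrt 2 * s) x)%:E)%E).
  by apply: integrableZl => //; exact: integrable_normal_pdf.
apply: le_integrable ib => //.
  apply/measurable_EFinP/measurable_funM; last exact: measurable_normal_pdf.
  by apply: measurable_funX; exact: measurable_funB.
move=> x _; rewrite lee_fin ger0_norm.
  by rewrite (le_trans (sqr_normal_pdf_le x))// ler_norm.
by rewrite mulr_ge0 ?sqr_ge0 ?normal_pdf_ge0.
Qed.

Lemma integrable_growth_normal_pdf (h : R -> R) (K : R) :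
  measurable_fun setT h -> (forall x, `|h x| <= K * ((x - m) ^+ 2 + 1)) ->
  mu.-integrable setT (fun x => (h x * phi x)%:E).
Proof.
move=> mh hK.
have ib : mu.-integrable setT
    (fun x => (K%:E * (((x - m) ^+ 2 * phi x)%:E + (phi x)%:E))%E).
  apply: integrableZl => //; apply: integrableD => //.
    exact: integrable_sqr_normal_pdf.
  exact: integrable_normal_pdf.
apply: le_integrable ib => //.
  by apply/measurable_EFinP/measurable_funM => //; exact: measurable_normal_pdf.
move=> x _; have f0 := normal_pdf_ge0 m s x.
rewrite lee_fin (normrM (h x)) (ger0_norm f0).
rewrite -{3}[phi x]mul1r -mulrDl mulrA (le_trans _ (ler_norm _))//.
by rewrite ler_wpM2r.
Qed.

Lemma integrable_norm_normal_pdf :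
  mu.-integrable setT (fun x => (`|x - m| * phi x)%:E).
Proof.
apply: (integrable_growth_normal_pdf (K := 1)).
  by apply: measurableT_comp => //; exact: measurable_funB.
by move=> x; rewrite normr_id mul1r norm_le_sqrD1.
Qed.

Lemma normal_mean : \int[mu]_x ((x - m) * phi x) = 0.
Proof.
have cphi : continuous phi by exact: continuous_normal_pdf.
have [K K0 HK] := sqr_normal_pdf_bound.
have := @integral_derivative_eq0 R phi (fun x => - (s ^+ 2)^-1 * ((x - m) * phi x)) m K.
have i1 : mu.-integrable setT (fun x => ((x - m) * phi x)%:E).
  apply: (integrable_growth_normal_pdf (K := 1)); first exact: measurable_funB.
  by move=> x; rewrite mul1r norm_le_sqrD1.
rewrite RintegralZl//= => H.
have : - (s ^+ 2)^-1 * \int[mu]_x ((x - m) * phi x) = 0.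
  apply: H.
  - move=> x; apply: cvgM; first exact: cvg_cst.
    apply: cvgM; last exact: cphi.
    by apply: cvgB; [exact: cvg_id|exact: cvg_cst].
  - move=> x; have := is_derive_normal_pdf x.
    by have -> : - ((x - m) / s ^+ 2) * phi x = - (s ^+ 2)^-1 * ((x - m) * phi x) by field.
  - exact: (integrableZl measurableT (- (s ^+ 2)^-1) i1).
  - by move=> x; rewrite (ger0_norm (normal_pdf_ge0 _ _ _)); have [] := HK x.
by move=> /eqP; rewrite mulf_eq0 oppr_eq0 invr_eq0 expf_eq0 (negbTE sn0)/= => /eqP.
Qed.

Lemma normal_variance : \int[mu]_x ((x - m) ^+ 2 * phi x) = s ^+ 2.
Proof.
have cphi : continuous phi by exact: continuous_normal_pdf.
have [K K0 HK] := sqr_normal_pdf_bound.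
have i2 := integrable_sqr_normal_pdf.
have i0 := integrable_normal_pdf m s.
have i2' : mu.-integrable setT
    (EFin \o (fun x => (s ^+ 2)^-1 * ((x - m) ^+ 2 * phi x))).
  exact: (integrableZl measurableT (s ^+ 2)^-1 i2).
have := @integral_derivative_eq0 R (fun x => (x - m) * phi x)
  (fun x => phi x - (s ^+ 2)^-1 * ((x - m) ^+ 2 * phi x)) m K.
rewrite RintegralB// RintegralZl//= => H.
have : \int[mu]_x phi x - (s ^+ 2)^-1 * \int[mu]_x ((x - m) ^+ 2 * phi x) = 0.
  apply: H.
  - move=> x; apply: cvgB; first exact: cphi.
    apply: cvgM; first exact: cvg_cst.
    apply: cvgM; last exact: cphi.
    apply: (cvg_comp (fun y => y - m) (fun y => y ^+ 2)).
      by apply: cvgB; [exact: cvg_id|exact: cvg_cst].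
    exact: exprn_continuous.
  - move=> x; have d1 := is_derive_normal_pdf x.
    have d2 : is_derive x 1 (fun x => x - m) 1.
      by apply: is_derive_eq; rewrite oppr0 addr0.
    by apply: (is_derive_eq (is_deriveM d2 d1)); rewrite /GRing.scale/=; field.
  - exact: (integrableB measurableT i0 i2').
  - move=> x; rewrite normrM (ger0_norm (normal_pdf_ge0 _ _ _)) mulrA -normrM.
    by rewrite -expr2 ger0_norm ?sqr_ge0//; have [] := HK x.
rewrite {1}/Rintegral integral_normal_pdf/= => /eqP; rewrite subr_eq0 => /eqP E.
have : s ^+ 2 * 1 = s ^+ 2 * ((s ^+ 2)^-1 * \int[mu]_x ((x - m) ^+ 2 * phi x)).
  by rewrite -E.
by rewrite mulr1 mulrA divff ?expf_neq0// mul1r => ->.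
Qed.

End normal_moments.

Section normal_characteristic_function.
Variables (R : realType) (s : R).
Hypothesis s0 : 0 < s.
Local Notation mu := (@lebesgue_measure R).
Local Notation phi := (normal_pdf 0 s).

Let sn0 : s != 0. Proof. by rewrite gt_eqF. Qed.

Let q0 : Num.sqrt 2 * s != 0.
Proof. by rewrite mulf_neq0// gt_eqF// sqrtr_gt0. Qed.

Lemma continuous_affine (t th : R) : continuous (fun x : R => t * x + th).
Proof.
by move=> x; apply: cvgD; [apply: cvgM; [exact: cvg_cst|exact: cvg_id]|exact: cvg_cst].
Qed.

Lemma continuous_sin_affine (t th : R) : continuous (fun x => sin (t * x + th)).
Proof.
move=> x; apply: (cvg_comp (fun x => t * x + th) (@sin R)).
  exact: continuous_affine.
exact: continuous_sin.
Qed.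

Lemma continuous_cos_affine (t th : R) : continuous (fun x => cos (t * x + th)).
Proof.
move=> x; apply: (cvg_comp (fun x => t * x + th) (@cos R)).
  exact: continuous_affine.
exact: continuous_cos.
Qed.

Lemma integrable_cos_normal_pdf (t th : R) :
  mu.-integrable setT (fun x => (cos (t * x + th) * phi x)%:E).
Proof.
apply: (integrable_growth_normal_pdf s0 (K := 1)).
  by apply: continuous_measurable_fun; exact: continuous_cos_affine.
by move=> x; rewrite mul1r (le_trans (cos_max _))// lerDr sqr_ge0.
Qed.

Lemma integrable_sin_normal_pdf (t th : R) :
  mu.-integrable setT (fun x => (x * sin (t * x + th) * phi x)%:E).
Proof.
apply: (integrable_growth_normal_pdf s0 (K := 1)).
  apply: measurable_funM => //; apply: continuous_measurable_fun.
  exact: continuous_sin_affine.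
move=> x; rewrite mul1r subr0 normrM.
by rewrite (@le_trans _ _ `|x|) ?ler_piMr ?sin_max// norm_le_sqrD1.
Qed.

Lemma normal_cos_ibp (t th : R) :
  \int[mu]_x (x * sin (t * x + th) * phi x) =
  s ^+ 2 * t * \int[mu]_x (cos (t * x + th) * phi x).
Proof.
have cphi : continuous phi by exact: continuous_normal_pdf.
have ic := integrable_cos_normal_pdf t th.
have is_ := integrable_sin_normal_pdf t th.
have [K K0 HK] := sqr_normal_pdf_bound 0 s0.
have := @integral_derivative_eq0 R (fun x => sin (t * x + th) * phi x)
  (fun x => t * (cos (t * x + th) * phi x) -
            (s ^+ 2)^-1 * (x * sin (t * x + th) * phi x)) 0 K.
have i1 : mu.-integrable setT (EFin \o (fun x => t * (cos (t * x + th) * phi x))).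
  exact: (integrableZl measurableT t ic).
have i2 : mu.-integrable setT
    (EFin \o (fun x => (s ^+ 2)^-1 * (x * sin (t * x + th) * phi x))).
  exact: (integrableZl measurableT (s ^+ 2)^-1 is_).
rewrite RintegralB// !RintegralZl//= => H.
have E : t * \int[mu]_x (cos (t * x + th) * phi x) -
     (s ^+ 2)^-1 * \int[mu]_x (x * sin (t * x + th) * phi x) = 0.
  apply: H.
  - move=> x; apply: cvgB; apply: cvgM; try exact: cvg_cst.
      by apply: cvgM; [exact: continuous_cos_affine|exact: cphi].
    apply: cvgM; last exact: cphi.
    by apply: cvgM; [exact: cvg_id|exact: continuous_sin_affine].
  - move=> x; have d1 := is_derive_normal_pdf 0 s0 x.
    have lin : is_derive x 1 (fun x => t * x + th) t.
      by apply: is_derive_eq; rewrite /GRing.scale/=; ring.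
    have d2 := @is_derive1_comp R (@sin R) (fun x => t * x + th) x _ _ (is_derive_sin _) lin.
    apply: (is_derive_eq (is_deriveM d2 d1)).
    by rewrite /GRing.scale/= subr0; field.
  - exact: (integrableB measurableT i1 i2).
  - move=> x; rewrite subr0 normrM (ger0_norm (normal_pdf_ge0 _ _ _)).
    have [_] := HK x; rewrite subr0; apply: le_trans.
    by rewrite ler_wpM2l// ler_piMl ?sin_max// normal_pdf_ge0.
move/eqP: E; rewrite subr_eq0 => /eqP E.
by rewrite -mulrA E mulrA divff ?expf_neq0// mul1r.
Qed.

(** As a function of the frequency the integral solves f' = - s^2 u f, so that exp (s^2 u^2 / 2) f u
    is constant. *)
Lemma normal_characteristic (t th : R) :
  \int[mu]_x (cos (t * x + th) * phi x) = cos th * expR (- (t ^+ 2 * s ^+ 2) / 2).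
Proof.
pose f (u : R) := \int[mu]_x (cos (u * x + th) * phi x).
have df (u : R) : is_derive u 1 f (- (s ^+ 2 * u * f u)).
  pose F (u x : R) := cos (u * x + th) * phi x.
  have dF (v x : R) : is_derive v 1 (F ^~ x) (- (x * sin (v * x + th) * phi x)).
    have lin : is_derive v 1 (fun v => v * x + th) x.
      by apply: is_derive_eq; rewrite /GRing.scale/=; ring.
    rewrite /F.
    have -> : (fun v => cos (v * x + th) * phi x) =
        phi x \*: (@cos R \o (fun v => v * x + th)).
      by apply/funext => y /=; rewrite /GRing.scale/= mulrC.
    apply: (is_derive_eq (is_deriveZ (phi x) (@is_derive1_comp R (@cos R)
      (fun v => v * x + th) v _ _ (is_derive_cos _) lin))).
    by rewrite /GRing.scale/=; ring.
  have uI : u \in `]u - 1, u + 1[ by rewrite in_itv/=; apply/andP; split; lra.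
  have iF v : mu.-integrable setT (EFin \o F v) := integrable_cos_normal_pdf v th.
  have dF' v x : partial1of2 F v x = - (x * sin (v * x + th) * phi x).
    by rewrite partial1of2E; have [] := dF v x.
  have hG0 : forall x : R, 0 <= `|x - 0| * phi x.
    by move=> x; rewrite mulr_ge0// normal_pdf_ge0.
  have iG := integrable_norm_normal_pdf 0 s0.
  have hub v x : (`]u - 1, u + 1[%classic : set R) v -> setT x ->
      `|partial1of2 F v x| <= `|x - 0| * phi x.
    move=> _ _; rewrite dF' normrN !normrM subr0 (ger0_norm (normal_pdf_ge0 _ _ _)).
    by rewrite ler_wpM2r ?normal_pdf_ge0// ler_piMr// sin_max.
  have hder v x : (`]u - 1, u + 1[%classic : set R) v -> setT x -> derivable (F ^~ x) v 1.
    by move=> _ _; have [] := dF v x.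
  have D1 := derivable_under_integral measurableT uI (fun v _ => iF v) hder hG0 iG hub.
  have D2 := differentiation_under_integral measurableT uI (fun v _ => iF v) hder hG0 iG hub.
  apply: DeriveDef; first exact: D1.
  rewrite -derive1E D2 -[in RHS](normal_cos_ibp u th).
  transitivity (\int[mu]_x (-1 * (x * sin (u * x + th) * phi x))).
    by apply: eq_Rintegral => x _; rewrite dF' mulN1r.
  by rewrite RintegralZl ?mulN1r//; exact: integrable_sin_normal_pdf.
pose g u := expR (s ^+ 2 / 2 * u ^+ 2) * f u.
have dg (u : R) : is_derive u 1 g 0.
  have h1 : is_derive u 1 (fun u => s ^+ 2 / 2 * u ^+ 2) (s ^+ 2 * u).
    by apply: is_derive_eq; rewrite /GRing.scale/=; field.
  have h2 := @is_derive1_comp R expR (fun u => s ^+ 2 / 2 * u ^+ 2) u _ _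
    (is_derive_expR _) h1.
  by apply: (is_derive_eq (is_deriveM h2 (df u))); rewrite /GRing.scale/=; ring.
have gt : g t = g 0.
  have cst_le (a b : R) : a <= b -> g b - g a = 0.
    move=> ab; have cg : {within `[a, b], continuous g}.
      by apply: derivable_within_continuous => x _; have [] := dg x.
    by have [c _ ->] := MVT_segment ab (fun x _ => dg x) cg; rewrite mul0r.
  apply/eqP; rewrite -subr_eq0; apply/eqP.
  have [t0|/ltW t0] := leP 0 t; first exact: cst_le.
  by rewrite -[LHS]opprK opprB cst_le// oppr0.
have f0 : f 0 = cos th.
  rewrite /f; under eq_Rintegral do rewrite mul0r add0r.
  rewrite RintegralZl//; last exact: integrable_normal_pdf.
  by rewrite /Rintegral integral_normal_pdf/= mulr1.
move: gt; rewrite /g expr0n mulr0 expR0 mul1r f0 => <-.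
rewrite mulrAC -expRD; have -> : s ^+ 2 / 2 * t ^+ 2 + - (t ^+ 2 * s ^+ 2) / 2 = 0 by field.
by rewrite expR0 mul1r.
Qed.

(** The weight cancels half of the Gaussian exponent, which doubles the variance; hence the
    exponential moment sqrt 2, independent of [s]. *)
Lemma normal_sqr_exp (x : R) :
  expR (x ^+ 2 / (4 * s ^+ 2)) * phi x =
  Num.sqrt 2 * normal_pdf 0 (Num.sqrt 2 * s) x.
Proof.
have E : (Num.sqrt 2 * s) ^+ 2 = 2 * s ^+ 2 by rewrite exprMn sqr_sqrtr.
have peakE : Num.sqrt 2 * normal_peak (Num.sqrt 2 * s) = normal_peak s.
  rewrite /normal_peak E -mulrA -mulrnAr sqrtrM// invfM mulrA.
  by rewrite divff ?mul1r// gt_eqF// sqrtr_gt0.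
rewrite (normal_pdfE _ q0) (normal_pdfE _ sn0) /normal_fun subr0 E.
rewrite mulrCA -expRD [RHS]mulrA peakE; congr (_ * expR _).
by rewrite -[s ^+ 2 *+ 2]mulr_natl -[(2 * s ^+ 2) *+ 2]mulr_natl; field.
Qed.

End normal_characteristic_function.

(** * Parameters, exponential moments and tails of a Gaussian variable *)

Section gaussian_law_integral.
Context d (T : measurableType d) (R : realType) (P : probability T R).
Variable X : T -> R.
Hypothesis mX : measurable_fun setT X.
Local Notation mu := (@lebesgue_measure R).

(* The library's real numbers carry two convertible measurable structures, with
   different displays; [normal_prob] lives on [measurableTypeR R]. *)
Lemma integral_law (nu : {measure set (measurableTypeR R) -> \bar R})
    (f : R -> \bar R) :
  (forall V : set R, measurable V -> pushforward P X V = nu V) ->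
  measurable_fun setT f ->
  (\int[P]_w f (X w) = \int[nu]_x f x)%E.
Proof.
move=> XV mf.
have mX1 : @measurable_fun _ _ T (measurableTypeR R) setT X by exact: mX.
pose X' : {RV P >-> measurableTypeR R} :=
  @mfun_Sub _ _ T (measurableTypeR R) X (mem_set mX1).
have ge0 (g : measurableTypeR R -> \bar R) : measurable_fun setT g ->
    (forall x, 0 <= g x)%E -> (\int[P]_w g (X w) = \int[nu]_x g x)%E.
  move=> mg g0; rewrite -(ge0_integral_distribution X' mg)//.
  by apply: eq_measure_integral => A mA _; exact: XV.
rewrite integralE [RHS]integralE -!ge0//; [|exact: measurable_funeneg|exact: measurable_funepos].
by congr (_ - _)%E; apply: eq_integral => w _; rewrite ?funeposE ?funenegE.
Qed.

Lemma integral_gaussian_law (m s : R) (f : R -> \bar R) :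
  (forall V : set R, measurable V -> pushforward P X V = gaussian_law m s V) ->
  measurable_fun setT f ->
  (\int[P]_w f (X w) = if (s == 0)%R then f m
     else \int[mu]_x (f x * (normal_pdf m s x)%:E))%E.
Proof.
move=> XV mf; case: ifPn => s0.
  pose nu : {measure set (measurableTypeR R) -> \bar R} := dirac (m : measurableTypeR R).
  rewrite (@integral_law nu)//.
    by rewrite integral_dirac// diracT mul1e.
  by move=> V mV; rewrite XV// /gaussian_law s0.
pose nu : {measure set (measurableTypeR R) -> \bar R} := normal_prob m s.
rewrite (@integral_law nu)//; first exact: integral_normal_prob.
by move=> V mV; rewrite XV// /gaussian_law (negbTE s0).
Qed.

Hypothesis gX : is_gaussian P X.

Lemma gaussian_sqr_integrable : P.-integrable setT (fun w => (X w ^+ 2)%:E).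
Proof.
have [m [s [s0 XV]]] := gX.
apply/integrableP; split.
  by apply/measurable_EFinP; exact: measurable_funX.
have -> : (\int[P]_w `|(X w ^+ 2)%:E| = \int[P]_w (X w ^+ 2)%:E)%E.
  by apply: eq_integral => w _; rewrite gee0_abs// lee_fin sqr_ge0.
rewrite (integral_gaussian_law (f := fun x => (x ^+ 2)%:E) XV); last first.
  by apply/measurable_EFinP; exact: measurable_funX.
case: ifPn => sn0; first exact: ltry.
have s1 : 0 < s by rewrite lt_neqAle eq_sym sn0.
have : mu.-integrable setT (fun x => (x ^+ 2 * normal_pdf m s x)%:E).
  apply: (integrable_growth_normal_pdf s1 (K := 2 * (1 + m ^+ 2))).
    exact: measurable_funX.
  move=> x; rewrite ger0_norm ?sqr_ge0//.
  have := sqr_ge0 (x - m - m); have := sqr_ge0 (x - m); have := sqr_ge0 m.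
  have := mulr_ge0 (sqr_ge0 m) (sqr_ge0 (x - m)); nra.
move=> /integrableP[_]; apply: le_lt_trans.
apply: ge0_le_integral => //.
- by move=> x _; rewrite -EFinM lee_fin mulr_ge0 ?sqr_ge0 ?normal_pdf_ge0.
- apply: emeasurable_funM; apply/measurable_EFinP; first exact: measurable_funX.
  exact: measurable_normal_pdf.
- apply: measurableT_comp => //; apply/measurable_EFinP; apply: measurable_funM.
    exact: measurable_funX.
  exact: measurable_normal_pdf.
- by move=> x _; rewrite -EFinM lee_fin ler_norm.
Qed.

Lemma gaussian_integrable : P.-integrable setT (fun w => (X w)%:E).
Proof.
have i2 := gaussian_sqr_integrable.
have i1 : P.-integrable setT (fun w => ((X w ^+ 2)%:E + 1%:E)%E).
  by apply: integrableD => //; exact: finite_measure_integrable_cst.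
apply: le_integrable i1 => //; first exact/measurable_EFinP.
move=> w _; rewrite lee_fin [leRHS]ger0_norm ?addr_ge0 ?sqr_ge0//.
exact: norm_le_sqrD1.
Qed.

Variable v : R.
Hypothesis EX : \int[P]_w X w = 0.
Hypothesis VX : \int[P]_w (X w ^+ 2) = v.

(** The parameters in [is_gaussian] are existential; the first two moments identify them, the Dirac
    case included. *)
Lemma centered_gaussian_law : 0 <= v /\
  forall V : set R, measurable V -> pushforward P X V = gaussian_law 0 (Num.sqrt v) V.
Proof.
have v0 : 0 <= v by rewrite -VX; apply: Rintegral_ge0 => w _; exact: sqr_ge0.
split => // V mV.
have [m [s [s0 XV]]] := gX; rewrite (XV _ mV).
have m2 : measurable_fun setT (fun x : R => (x ^+ 2)%:E).
  by apply/measurable_EFinP; exact: measurable_funX.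
have m1 : measurable_fun setT (fun x : R => x%:E) by exact/measurable_EFinP.
move: EX VX; rewrite /Rintegral.
rewrite (integral_gaussian_law XV m1) (integral_gaussian_law XV m2).
case: ifPn => [/eqP ->|sn0] /=.
  by move=> -> <-; rewrite expr0n/= sqrtr0.
have s1 : 0 < s by rewrite lt_neqAle eq_sym sn0.
have i1 : mu.-integrable setT (fun x => ((x - m) * normal_pdf m s x)%:E).
  apply: (integrable_growth_normal_pdf s1 (K := 1)); first exact: measurable_funB.
  by move=> x; rewrite mul1r norm_le_sqrD1.
have i0 := integrable_normal_pdf m s.
have p1 : \int[mu]_x normal_pdf m s x = 1 by rewrite /Rintegral integral_normal_pdf.
move=> E V'.
have m0 : m = 0.
  have : \int[mu]_x ((x - m) * normal_pdf m s x + m * normal_pdf m s x) = 0.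
    rewrite -{}E; congr fine; apply: eq_integral => x _.
    by rewrite -EFinM; congr _%:E; ring.
  rewrite RintegralD//; last exact: (integrableZl measurableT m i0).
  by rewrite (normal_mean m s1) RintegralZl// p1 mulr1 add0r.
have : \int[mu]_x ((x - m) ^+ 2 * normal_pdf m s x) = v.
  rewrite -V'; congr fine; apply: eq_integral => x _.
  by rewrite -EFinM m0 subr0.
by rewrite (normal_variance m s1) m0 => <-; rewrite sqrtr_sqr ger0_norm.
Qed.

Lemma centered_gaussian_cos (th : R) :
  \int[P]_w cos (X w + th) = cos th * expR (- v / 2).
Proof.
have [v0 XV] := centered_gaussian_law.
have mc : measurable_fun setT (fun x : R => (cos (x + th))%:E).
  apply/measurable_EFinP; apply: continuous_measurable_fun => x.
  apply: (cvg_comp (fun x => x + th) (@cos R)); last exact: continuous_cos.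
  by apply: cvgD; [exact: cvg_id|exact: cvg_cst].
rewrite /Rintegral (integral_gaussian_law XV mc).
case: ifPn => [|sn0].
  rewrite sqrtr_eq0 => vle; have -> : v = 0 by apply/eqP; rewrite eq_le vle v0.
  by rewrite oppr0 mul0r expR0 mulr1 /= add0r.
have s1 : 0 < Num.sqrt v by rewrite lt_neqAle eq_sym sn0 sqrtr_ge0.
have := normal_characteristic s1 1 th; rewrite expr1n mul1r sqr_sqrtr// => <-.
by rewrite /Rintegral; congr fine; apply: eq_integral => x _; rewrite mul1r.
Qed.

Lemma centered_gaussian_sqr_exp : 0 < v ->
  P.-integrable setT (fun w => (expR (X w ^+ 2 / (4 * v)))%:E) /\
  \int[P]_w expR (X w ^+ 2 / (4 * v)) = Num.sqrt 2.
Proof.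
move=> v1.
have [v0 XV] := centered_gaussian_law.
have s1 : 0 < Num.sqrt v by rewrite sqrtr_gt0.
have me : measurable_fun setT (fun x : R => (expR (x ^+ 2 / (4 * v)))%:E).
  apply/measurable_EFinP; apply: measurableT_comp => //.
  by apply: measurable_funM => //; exact: measurable_funX.
have E : (\int[P]_w (expR (X w ^+ 2 / (4 * v)))%:E = (Num.sqrt 2)%:E)%E.
  rewrite (integral_gaussian_law XV me) gt_eqF//.
  transitivity (\int[mu]_x ((Num.sqrt 2)%:E *
      (normal_pdf 0 (Num.sqrt 2 * Num.sqrt v) x)%:E))%E.
    apply: eq_integral => x _.
    by rewrite -!EFinM -(normal_sqr_exp s1) sqr_sqrtr.
  rewrite integralZl//; last exact: integrable_normal_pdf.
  by rewrite integral_normal_pdf mule1.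
split; last by rewrite /Rintegral E.
apply/integrableP; split; first exact: (measurableT_comp me).
under eq_integral do rewrite gee0_abs ?lee_fin ?expR_ge0//.
by rewrite E ltry.
Qed.

Lemma centered_gaussian_exp_norm : 0 < v ->
  P.-integrable setT (fun w => (expR `|X w|)%:E) /\
  \int[P]_w expR `|X w| <= 2 * expR v.
Proof.
move=> v0; have [i2 E2] := centered_gaussian_sqr_exp v0.
(* Completing the square: |x| <= v + x^2 / (4 v). *)
have le w : expR `|X w| <= expR v * expR (X w ^+ 2 / (4 * v)).
  rewrite -expRD ler_expR -(real_normK (num_real (X w))).
  have -> : v + `|X w| ^+ 2 / (4 * v) =
      (`|X w| - 2 * v) ^+ 2 / (4 * v) + `|X w| by field; rewrite gt_eqF.
  by rewrite lerDr divr_ge0 ?sqr_ge0// mulr_ge0// ltW.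
have iZ := integrableZl measurableT (expR v) i2.
have mE : measurable_fun setT (fun w => expR `|X w|).
  by do 2 apply: measurableT_comp => //.
have iE : P.-integrable setT (fun w => (expR `|X w|)%:E).
  apply: le_integrable iZ => //; first exact/measurable_EFinP.
  move=> w _; rewrite -EFinM lee_fin [leRHS]ger0_norm ?mulr_ge0 ?expR_ge0//.
  by rewrite ger0_norm ?expR_ge0.
split => //.
apply: (@le_trans _ _ (\int[P]_w (expR v * expR (X w ^+ 2 / (4 * v))))).
  exact: le_Rintegral.
rewrite RintegralZl// E2 mulrC ler_wpM2r ?expR_ge0//.
rewrite -(@ler_sqr _ (Num.sqrt 2)) ?nnegrE ?sqrtr_ge0// sqr_sqrtr//; lra.
Qed.

(** Markov's inequality for exp (X^2 / (4 v)), with sqrt 2 rounded up to 2. *)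
Lemma centered_gaussian_tail (x : R) : 0 <= x -> 0 < v ->
  pr P [set w | x <= X w] <= 2 * expR (- (x ^+ 2 / (4 * v))).
Proof.
move=> x0 v0.
have [i2 E2] := centered_gaussian_sqr_exp v0.
have mA := measurable_ge_set x mX.
have bA := bmf_indic R mA.
rewrite -Ex_indic//.
apply: (@le_trans _ _ (\int[P]_w (expR (- (x ^+ 2 / (4 * v))) * expR (X w ^+ 2 / (4 * v))))).
  apply: le_Rintegral => //; first exact: bmf_integrable.
    exact: (integrableZl measurableT _ i2).
  move=> w _; rewrite indicE; case: (pselect (x <= X w)) => xX.
    rewrite mem_set//= -expRD -[leLHS]expR0 ler_expR addrC subr_ge0.
    by rewrite ler_pM2r ?invr_gt0 ?mulr_gt0// ler_sqr ?nnegrE// (le_trans x0).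
  by rewrite memNset//= mulr_ge0 ?expR_ge0.
rewrite RintegralZl// E2 mulrC ler_wpM2r ?expR_ge0//.
rewrite -(@ler_sqr _ (Num.sqrt 2)) ?nnegrE ?sqrtr_ge0// sqr_sqrtr//; lra.
Qed.

End gaussian_law_integral.

Section standard_normal_tail.
Variable R : realType.
Local Notation mu := (@lebesgue_measure R).

(** On the interval from [r - 1] to [r] the density is bounded below by the constant [c]. *)
Lemma normal_prob_lt_gt0 (r : R) : (0 < normal_prob 0 1 [set x : R | x < r]%R)%E.
Proof.
set a := r - 1.
pose c := normal_peak 1 * expR (- (a ^+ 2 + r ^+ 2)) : R.
have c0 : 0 < c by rewrite mulr_gt0 ?expR_gt0 ?normal_peak_gt0.
have mI : measurable [set` `[a, r[] by exact: measurable_itv.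
have mr := measurable_lt_set r (@measurable_id _ R setT).
apply: (@lt_le_trans _ _ (\int[mu]_(x in [set` `[a, r[]) c%:E)%E).
  have ar : a < r by rewrite /a ltrBlDr ltrDl.
  have L : lebesgue_measure ([set` `[a, r[] : set R) = (r - a)%:E.
    by rewrite lebesgue_measure_itv/= lte_fin ar.
  rewrite integral_cst// [X in (_ * X)%E](_ : _ = (r - a)%:E); last exact: L.
  by rewrite -EFinM lte_fin mulr_gt0// subr_gt0.
apply: (@le_trans _ _ (\int[mu]_(x in [set` `[a, r[]) (normal_pdf 0 1 x)%:E)%E).
  apply: ge0_le_integral => //.
  - by move=> x _; rewrite lee_fin ltW.
  - by apply/measurable_funTS/measurable_EFinP; exact: measurable_normal_pdf.
  - move=> x /=; rewrite in_itv/= => /andP[ax xr].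
    rewrite lee_fin normal_pdfE ?oner_neq0// /c /normal_fun subr0.
    rewrite ler_wpM2l ?normal_peak_ge0// ler_expR expr1n mulNr lerN2.
    have : x ^+ 2 <= a ^+ 2 + r ^+ 2.
      have [x0|x0] := leP 0 x.
        have : x ^+ 2 <= r ^+ 2 by rewrite ler_sqr ?nnegrE// ltW// (le_lt_trans x0).
        by have := sqr_ge0 a; lra.
      have : x ^+ 2 <= a ^+ 2.
        by rewrite -(sqrrN x) -(sqrrN a) ler_sqr ?nnegrE ?oppr_ge0 ?lerN2//; lra.
      by have := sqr_ge0 r; lra.
    by have := sqr_ge0 x; lra.
rewrite /normal_prob; apply: ge0_subset_integral => //.
- by apply/measurable_funTS/measurable_EFinP; exact: measurable_normal_pdf.
- by move=> x _; rewrite lee_fin normal_pdf_ge0.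
- by move=> x /=; rewrite in_itv/= => /andP[].
Qed.

End standard_normal_tail.

Section integral_sum.
Context d (T : measurableType d) (R : realType) (P : probability T R).

Lemma Rintegral_bigsum (I : Type) (s : seq I) (F : I -> T -> R) :
  (forall i, P.-integrable setT (EFin \o F i)) ->
  P.-integrable setT (EFin \o (fun w => \sum_(i <- s) F i w)) /\
  \int[P]_w (\sum_(i <- s) F i w) = \sum_(i <- s) \int[P]_w F i w.
Proof.
move=> iF; elim: s => [|i s [IH1 IH2]].
  under [in X in X /\ _]eq_fun do rewrite big_nil.
  under eq_Rintegral do rewrite big_nil.
  by rewrite big_nil Ex_cst; split => //; exact/bmf_integrable/bmf_cst.
have -> : (fun w => \sum_(j <- i :: s) F j w) =
    (fun w => F i w + \sum_(j <- s) F j w).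
  by apply/funext => w; rewrite big_cons.
split; first exact: (integrableD measurableT (iF i) IH1).
by rewrite RintegralD// big_cons IH2.
Qed.

End integral_sum.

(** * Finite-dimensional laws of a Gaussian process *)

Section process.
Context d (T : measurableType d) (R : realType) (P : probability T R).
Variables (Z : R -> {RV P >-> R}) (A : R -> R -> R).
Hypothesis gZ : gaussian_process Z.
Hypothesis cZ : centered_process Z.
Hypothesis covZ : has_covariance Z A.
Hypothesis A1 : forall s, 0 <= s -> A s s = 1.

Lemma measurable_process t : measurable_fun setT (Z t).
Proof. exact: measurable_funPT. Qed.

Section linear_combination.
Variables (I : finType) (t : I -> R) (c : I -> R).
Hypothesis t0 : forall i, 0 <= t i.

Let L w := \sum_i c i * Z (t i) w.

Lemma measurable_lincomb : measurable_fun setT L.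
Proof.
by apply: measurable_sum => i; apply: measurable_funM => //; exact: measurable_process.
Qed.

Lemma gaussian_lincomb : is_gaussian P L.
Proof.
have -> : L = fun w => \sum_(k < #|I|) c (enum_val k) * Z (t (enum_val k)) w.
  apply/funext => w; rewrite /L.
  rewrite (reindex (@enum_val I predT))//=.
  by apply: onW_bij; exact: enum_val_bij.
exact: (gZ (fun k => c (enum_val k)) (fun k => t0 (enum_val k))).
Qed.

End linear_combination.

Lemma gaussian_coord t : 0 <= t -> is_gaussian P (Z t).
Proof.
move=> t0; have := @gaussian_lincomb unit (fun=> t) (fun=> 1) (fun=> t0).
suff -> : (fun w => \sum_(i : unit) 1 * Z t w) = Z t by [].
by apply/funext => w; rewrite big_const card_unit /= addr0 mul1r.
Qed.

Lemma coord_integrable t : 0 <= t -> P.-integrable setT (EFin \o Z t).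
Proof.
by move=> t0; exact: (gaussian_integrable (measurable_process t) (gaussian_coord t0)).
Qed.

Lemma coordM_integrable s t : 0 <= s -> 0 <= t ->
  P.-integrable setT (EFin \o (fun w => Z s w * Z t w)).
Proof.
move=> s0 t0.
have i1 := gaussian_sqr_integrable (measurable_process s) (gaussian_coord s0).
have i2 := gaussian_sqr_integrable (measurable_process t) (gaussian_coord t0).
have i3 := integrableD measurableT i1 i2.
apply: le_integrable i3 => //.
  by apply/measurable_EFinP; apply: measurable_funM; exact: measurable_process.
move=> w _; rewrite /= lee_fin [leRHS]ger0_norm ?addr_ge0 ?sqr_ge0// normrM.
rewrite -(real_normK (num_real (Z s w))) -(real_normK (num_real (Z t w))).
have := sqr_ge0 (`|Z s w| - `|Z t w|).
by have := mulr_ge0 (normr_ge0 (Z s w)) (normr_ge0 (Z t w)); nra.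
Qed.

Lemma mean0 t : 0 <= t -> \int[P]_w Z t w = 0.
Proof. by move=> t0; rewrite /Rintegral; have := cZ t0; rewrite unlock => ->. Qed.

Lemma covE s t : 0 <= s -> 0 <= t -> \int[P]_w (Z s w * Z t w) = A s t.
Proof.
by move=> s0 t0; rewrite /Rintegral; have := covZ s0 t0; rewrite unlock => ->.
Qed.

Lemma covC s t : 0 <= s -> 0 <= t -> A s t = A t s.
Proof.
move=> s0 t0; rewrite -covE// -covE//; apply: eq_Rintegral => w _.
exact: mulrC.
Qed.

Section linear_combination_moments.
Variables (I : finType) (t : I -> R) (c : I -> R).
Hypothesis t0 : forall i, 0 <= t i.

Let L w := \sum_i c i * Z (t i) w.
Let v := cov_form (fun i j => A (t i) (t j)) c.

Lemma lincomb_mean : \int[P]_w L w = 0.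
Proof.
have iF i : P.-integrable setT (EFin \o (fun w => c i * Z (t i) w)).
  exact: (integrableZl measurableT (c i) (coord_integrable (t0 i))).
rewrite (Rintegral_bigsum _ iF).2 big1// => i _.
by rewrite RintegralZl ?mean0 ?mulr0//; exact: coord_integrable.
Qed.

Lemma lincomb_variance : \int[P]_w (L w ^+ 2) = v.
Proof.
have iF i j : P.-integrable setT
    (EFin \o (fun w => c i * c j * (Z (t i) w * Z (t j) w))).
  exact: (integrableZl measurableT (c i * c j) (coordM_integrable (t0 i) (t0 j))).
transitivity (\int[P]_w (\sum_i \sum_j c i * c j * (Z (t i) w * Z (t j) w))).
  apply: eq_Rintegral => w _; rewrite expr2 /L mulr_suml; apply: eq_bigr => i _.
  by rewrite mulr_sumr; apply: eq_bigr => j _; ring.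
rewrite (Rintegral_bigsum _ _).2; last first.
  by move=> i; exact: (Rintegral_bigsum _ (iF i)).1.
apply: eq_bigr => i _; rewrite (Rintegral_bigsum _ (iF i)).2; apply: eq_bigr => j _.
by rewrite RintegralZl ?covE//; exact: coordM_integrable.
Qed.

Lemma lincomb_cos (th : R) : \int[P]_w cos (L w + th) = cos th * expR (- v / 2).
Proof.
exact: (centered_gaussian_cos (measurable_lincomb t c) (gaussian_lincomb c t0)
  lincomb_mean lincomb_variance).
Qed.

Lemma lincomb_exp_norm : 0 < v ->
  P.-integrable setT (fun w => (expR `|L w|)%:E) /\
  \int[P]_w expR `|L w| <= 2 * expR v.
Proof.
exact: (centered_gaussian_exp_norm (measurable_lincomb t c) (gaussian_lincomb c t0)
  lincomb_mean lincomb_variance).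
Qed.

End linear_combination_moments.

(* Time is reflected at 0 so that no sign condition on times is needed. *)
Definition even_process (t : R) (w : T) : R := Z `|t| w.
Definition even_cov (s t : R) : R := A `|s| `|t|.

Lemma process_gfield : gfield P even_process even_cov.
Proof.
split; first by move=> u; exact: measurable_process.
move=> I phi; split; first by move=> i; exact: measurable_process.
move=> c th; exact: (lincomb_cos c (fun i => normr_ge0 (phi i)) th).
Qed.

Definition Phi (r : R) : R := fine (normal_prob 0 1 [set x : R | x < r]).

Lemma pr_coord_lt t r : 0 <= t -> pr P [set w | Z t w < r] = Phi r.
Proof.
move=> t0; have sqE : \int[P]_w (Z t w ^+ 2) = 1.
  by rewrite -(A1 t0) -covE//; apply: eq_Rintegral => w _; rewrite expr2.
have [_ XV] := centered_gaussian_law (measurable_process t) (gaussian_coord t0)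
  (mean0 t0) sqE.
have mr := measurable_lt_set r (@measurable_id _ R setT).
have := XV _ mr; rewrite /gaussian_law sqrtr1 oner_eq0 /pushforward => H.
by rewrite /pr /Phi -H.
Qed.

Lemma pr_increment_tail s t (x v : R) : 0 <= s -> 0 <= t -> 0 < x -> 0 < v ->
  2 * (1 - A s t) <= v ->
  pr P [set w | x <= Z t w - Z s w] <= 2 * expR (- (x ^+ 2 / (4 * v))).
Proof.
move=> s0 t0 x0 v0 Av.
pose tt (b : bool) := if b then t else s.
pose c (b : bool) : R := if b then 1 else -1.
have tt0 b : 0 <= tt b by case: b.
have LE w : Z t w - Z s w = \sum_b c b * Z (tt b) w.
  by rewrite big_bool /= mul1r mulN1r.
pose u := cov_form (fun b b' => A (tt b) (tt b')) c.
have uE : u = 2 * (1 - A s t).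
  by rewrite /u /cov_form big_bool/= !big_bool/= /c/= !A1// (covC t0 s0); ring.
have mL := measurable_lincomb tt c; have gL := gaussian_lincomb c tt0.
have EL := lincomb_mean c tt0; have VL := lincomb_variance c tt0.
rewrite -/u in VL.
have -> : [set w | x <= Z t w - Z s w] = [set w | x <= \sum_b c b * Z (tt b) w].
  by apply/seteqP; split => w /=; rewrite LE.
have [u0 XV] := centered_gaussian_law mL gL EL VL.
(* Here [v] only bounds the variance [u] of the increment. If [u] is 0 the increment has the Dirac
   law at 0 and cannot reach x > 0. *)
have [u1|u1] := ltP 0 u.
  apply: (le_trans (centered_gaussian_tail mL gL EL VL (ltW x0) u1)).
  rewrite ler_pM2l// ler_expR lerN2.
  by rewrite ler_wpM2l ?sqr_ge0// lef_pV2 ?posrE ?mulr_gt0// ler_pM2l// uE.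
have u00 : u = 0 by apply/eqP; rewrite eq_le u1 u0.
have mx := measurable_ge_set x (@measurable_id _ R setT).
have := XV _ mx; rewrite /gaussian_law u00 sqrtr0 eqxx /pushforward => H.
rewrite [X in X <= _](_ : _ = 0); first by rewrite mulr_ge0 ?expR_ge0.
rewrite /pr (_ : P _ = 0%E)//; rewrite [LHS]H diracE memNset//=.
by apply/negP; rewrite -ltNge.
Qed.

End process.

(** * Suprema, chaining and blocks *)

Lemma pr_seq_union d (T : measurableType d) (R : realType) (P : probability T R)
    (I : eqType) (s : seq I) (F : I -> set T) : (forall i, measurable (F i)) ->
  measurable [set w | exists2 i, i \in s & F i w] /\
  pr P [set w | exists2 i, i \in s & F i w] <= \sum_(i <- s) pr P (F i).
Proof.
move=> mF; elim: s => [|i s [IH1 IH2]].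
  rewrite big_nil (_ : [set w | _] = set0).
    by rewrite /pr measure0; split => //; exact: measurable0.
  by apply/seteqP; split => // w [].
have -> : [set w | exists2 j, j \in i :: s & F j w] =
    F i `|` [set w | exists2 j, j \in s & F j w].
  apply/seteqP; split => w /=.
    move=> [j]; rewrite inE => /orP[/eqP ->|js] Fj; first by left.
    by right; exists j.
  move=> [Fi|[j js Fj]]; first by exists i => //; rewrite mem_head.
  by exists j => //; rewrite inE js orbT.
split; first exact: measurableU.
by rewrite big_cons (le_trans (prU_le P (mF i) IH1))// lerD2l.
Qed.

Section grid.
Variable R : realType.

Definition nfloor (x : R) : nat := `|Num.floor x|%N.

Lemma nfloor_le (x : R) : 0 <= x -> (nfloor x)%:R <= x.
Proof.
move=> x0; rewrite /nfloor natr_absz ger0_norm ?floor_ge0//.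
exact: floor_le_tmp.
Qed.

Lemma nfloor_gt (x : R) : 0 <= x -> x < (nfloor x).+1%:R.
Proof.
move=> x0; rewrite /nfloor -natr1 natr_absz ger0_norm ?floor_ge0//.
by have := lt_succ_floor x; rewrite intrD.
Qed.

Lemma le_nfloorS (x : R) : x <= (nfloor `|x|).+1%:R.
Proof. by rewrite (le_trans (ler_norm _))// ltW// nfloor_gt. Qed.

Lemma le_nfloor (x : R) (i : nat) : 0 <= x -> (i <= nfloor x)%N = (i%:R <= x).
Proof.
move=> x0; apply/idP/idP => [ix|ix].
  by rewrite (le_trans _ (nfloor_le x0))// ler_nat.
by rewrite -ltnS -(ltr_nat R) (le_lt_trans ix)// nfloor_gt.
Qed.

Definition grid (l : nat) (M s : R) : seq R :=
  [seq s + i%:R / l%:R | i <- iota 0 (nfloor (M * l%:R)).+1].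

Lemma mem_grid l M s x : (0 < l)%N -> 0 <= M ->
  x \in grid l M s -> exists2 i : nat, x = s + i%:R / l%:R & i%:R / l%:R <= M.
Proof.
move=> l0 M0 /mapP[i]; rewrite mem_iota add0n ltnS => /andP[_ iM] ->.
exists i => //; rewrite ler_pdivrMr ?ltr0n// -le_nfloor// mulr_ge0//.
Qed.

Lemma grid_mem l M s (i : nat) : (0 < l)%N -> 0 <= M -> i%:R / l%:R <= M ->
  s + i%:R / l%:R \in grid l M s.
Proof.
move=> l0 M0 iM; apply/mapP; exists i => //; rewrite mem_iota add0n ltnS leq0n/=.
by rewrite le_nfloor ?mulr_ge0// -ler_pdivrMr// ltr0n.
Qed.

(* The logarithm of the mesh doubles at each step: (b) then makes the variance of
   the increments summably small against the logarithm of their number. *)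
Definition mesh (m : nat) : nat := 2 ^ 2 ^ m.

Lemma mesh_gt0 m : (0 < mesh m)%N. Proof. by rewrite expn_gt0. Qed.

Lemma meshS m : mesh m.+1 = (mesh m * mesh m)%N.
Proof. by rewrite /mesh expnS mul2n -addnn expnD. Qed.

Lemma mesh_ge m : (2 ^ m <= mesh m)%N.
Proof. by rewrite /mesh leq_exp2l// ltnW// ltn_expl. Qed.

Lemma grid_nested m n M s x : 0 <= M -> (m <= n)%N ->
  x \in grid (mesh m) M s -> x \in grid (mesh n) M s.
Proof.
move=> M0; elim: n => [|n IH]; first by rewrite leqn0 => /eqP ->.
rewrite leq_eqVlt => /predU1P[-> //|]; rewrite ltnS => /IH {}IH /IH.
move=> /(mem_grid (mesh_gt0 n) M0)[i -> iM].
have E : i%:R / (mesh n)%:R = (i * mesh n)%:R / (mesh n.+1)%:R :> R.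
  have n0 : (mesh n)%:R != 0 :> R by rewrite pnatr_eq0 -lt0n mesh_gt0.
  by rewrite meshS !natrM; field.
by rewrite E; apply: grid_mem; rewrite ?mesh_gt0// -E.
Qed.

End grid.

(** * Events for the supremum, and chaining *)

Section sup_events.
Context d (T : measurableType d) (R : realType) (P : probability T R).
Variable Z : R -> {RV P >-> R}.
Hypothesis contZ : continuous_paths Z.

Definition sup_lt (a b r : R) : set T :=
  [set w | (ereal_sup [set (Z t w)%:E | t in `[a, b]] < r%:E)%E].

Definition all_le (a b c : R) : set T :=
  [set w | forall t, a <= t <= b -> Z t w <= c].

Let X (t : R) (w : T) : R := Z t w.

Let mX t : measurable_fun setT (X t). Proof. exact: measurable_process. Qed.

(** A supremum strictly below [r] leaves a margin; the event becomes a countable union of non-strict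
    conditions, which countable dense sets of times can test. *)
Lemma sup_ltP a b r : a <= b ->
  sup_lt a b r = \bigcup_n all_le a b (r - n.+1%:R^-1).
Proof.
move=> ab; apply/seteqP; split => w; rewrite /sup_lt /=.
  set S := ereal_sup _ => Sr.
  have Sub t : a <= t <= b -> ((Z t w)%:E <= S)%E.
    by move=> tab; apply: ereal_sup_ubound; exists t => //=; rewrite in_itv.
  have Sf : S \is a fin_num.
    rewrite fin_numE; apply/andP; split.
      rewrite gt_eqF// (@lt_le_trans _ _ (Z a w)%:E) ?ltNyr//.
      by apply: Sub; rewrite lexx ab.
    by rewrite lt_eqF// (lt_trans Sr)// ltry.
  have [n Hn] : exists n : nat, fine S < r - n.+1%:R^-1.
    by apply: ltr_exists_invn; rewrite -lte_fin fineK.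
  exists n => // t tab; rewrite -lee_fin (le_trans (Sub t tab))//.
  by rewrite -(fineK Sf) lee_fin ltW.
move=> [n _ H].
apply: (@le_lt_trans _ _ (r - n.+1%:R^-1)%:E); last first.
  by rewrite lte_fin gtrBl invr_gt0.
apply: ge_ereal_sup => _ /= [t tab <-]; rewrite lee_fin; apply: H.
by move: tab; rewrite in_itv.
Qed.

Lemma continuous_path_near w t e : 0 <= t -> 0 < e ->
  exists2 dl, 0 < dl & forall u, 0 <= u -> `|t - u| < dl -> `|Z t w - Z u w| < e.
Proof.
move=> t0 e0.
have /subspace_continuousP : {within `[0, +oo[, continuous (fun t : R => Z t w)}.
  exact: contZ.
have tI : [set` `[(0:R), +oo[] t by rewrite /= in_itv/= t0.
move=> /(_ t tI)/cvgrPdist_lt/(_ e e0).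
rewrite near_withinE => /nbhs_ballP[dl /= dl0 H].
by exists dl => // u u0 tu; apply: H => //; rewrite in_itv/= u0.
Qed.

(** The grids become dense and path continuity carries a non-strict bound over to the whole
    interval. A strict bound would not survive the passage, whence the margins above. *)
Lemma all_le_gridP s M c : 0 <= s -> 0 <= M ->
  all_le s (s + M) c =
  \bigcap_m [set w | forall x, x \in grid (mesh m) M s -> Z x w <= c].
Proof.
move=> s0 M0; apply/seteqP; split => w /= H.
  move=> m _ x /(mem_grid (mesh_gt0 m) M0)[i -> iM]; apply: H.
  by rewrite lerDl divr_ge0// lerD2l.
move=> t /andP[st tM]; apply/ler_addgt0Pr => e e0.
have t0 : 0 <= t by exact: le_trans st.
have [dl dl0 Hdl] := continuous_path_near w t0 e0.
have [m Hm] : exists m : nat, (mesh m)%:R^-1 < dl.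
  exists (nfloor dl^-1); rewrite -[ltRHS]invrK ltf_pV2 ?posrE ?invr_gt0 ?ltr0n ?mesh_gt0//.
  apply: (lt_le_trans (nfloor_gt _)); first by rewrite invr_ge0 ltW.
  by rewrite ler_nat (leq_trans _ (mesh_ge _))// ltn_expl.
pose l := mesh m; have l0 : (0 < l)%N := mesh_gt0 m.
have lR : 0 < l%:R :> R by rewrite ltr0n.
have u0 : 0 <= t - s by rewrite subr_ge0.
have ul0 : 0 <= (t - s) * l%:R by rewrite mulr_ge0.
pose i := nfloor ((t - s) * l%:R).
have i1 : i%:R / l%:R <= t - s by rewrite ler_pdivrMr// nfloor_le.
have i2 : t - s < i%:R / l%:R + l%:R^-1.
  have -> : i%:R / l%:R + l%:R^-1 = i.+1%:R / l%:R :> R.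
    by rewrite -(natr1 i) mulrDl mul1r.
  by rewrite ltr_pdivlMr// nfloor_gt.
have xg : s + i%:R / l%:R \in grid l M s.
  by apply: grid_mem => //; rewrite (le_trans i1)// lerBlDl.
have x0 : 0 <= s + i%:R / l%:R by rewrite addr_ge0// divr_ge0.
have := Hdl _ x0; have := H m I _ xg => Hx.
have -> : `|t - (s + i%:R / l%:R)| < dl.
  have -> : t - (s + i%:R / l%:R) = (t - s) - i%:R / l%:R by ring.
  rewrite ger0_norm ?subr_ge0//.
  by move: Hm; rewrite -/l; lra.
by move=> /(_ isT); rewrite ltr_norml => /andP[_]; lra.
Qed.

Lemma measurable_seq_le (s : seq R) (c : R) :
  measurable [set w | forall x, x \in s -> Z x w <= c].
Proof.
rewrite (_ : [set w | _] = ~` [set w | exists2 x, x \in s & c < Z x w]).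
  apply: measurableC.
  by apply: (pr_seq_union P s (F := fun x => [set w | c < Z x w]) _).1 => x;
    exact: measurable_gt_set.
apply/seteqP; split => w /=.
  by move=> H [x xs]; rewrite ltNge H.
by move=> H x xs; rewrite leNgt; apply/negP => Zx; apply: H; exists x.
Qed.

Lemma measurable_all_le s M c : 0 <= s -> 0 <= M ->
  measurable (all_le s (s + M) c).
Proof.
by move=> s0 M0; rewrite all_le_gridP//; apply: bigcap_measurable => // m _;
  exact: measurable_seq_le.
Qed.

Lemma measurable_sup_lt s M r : 0 <= s -> 0 <= M ->
  measurable (sup_lt s (s + M) r).
Proof.
move=> s0 M0; rewrite sup_ltP ?lerDl//; apply: bigcup_measurable => n _.
exact: measurable_all_le.
Qed.

Lemma sup_lt_below s M r (g : seq R) : 0 <= s -> 0 <= M ->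
  (forall x, x \in g -> s <= x <= s + M) ->
  sup_lt s (s + M) r `<=` below X g r.
Proof.
move=> s0 M0 gs; rewrite sup_ltP ?lerDl// => w [n _ H] x /gs /H.
by move=> /le_lt_trans; apply; rewrite gtrBl invr_gt0.
Qed.

Lemma measurable_below_seq (g : seq R) r : measurable (below X g r).
Proof. by rewrite below_tnth; apply: measurable_all_lt => i; exact: mX. Qed.

(** The grid events decrease, so a bound valid for all fine grids holds for their intersection. On
    it the path is only known to be at most r' everywhere, and r' < r restores strictness. *)
Lemma pr_sup_lt_ge s M r r' c : 0 <= s -> 0 <= M -> r' < r -> forall m0,
  (forall m, (m0 <= m)%N -> c <= pr P (below X (grid (mesh m) M s) r')) ->
  c <= pr P (sup_lt s (s + M) r).
Proof.
move=> s0 M0 r'r m0 H.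
pose E n := below X (grid (mesh (m0 + n)) M s) r'.
have mE n : measurable (E n) by exact: measurable_below_seq.
have : c <= pr P (\bigcap_n E n).
  apply: pr_bigcap_ge => //.
    move=> n m nm w /= Hw x xg; apply: Hw.
    by apply: grid_nested xg; rewrite ?leq_add2l.
  by move=> n; apply: H; exact: leq_addr.
move=> /le_trans; apply; apply: pr_le.
- exact: bigcap_measurable.
- exact: measurable_sup_lt.
move=> w Hw; rewrite sup_ltP ?lerDl//.
have [n Hn] := ltr_exists_invn r'r.
exists n => //; rewrite all_le_gridP// => m _ x xg.
rewrite (le_trans _ (ltW Hn))// ltW//.
by apply: (Hw m I); apply: grid_nested xg => //; exact: leq_addl.
Qed.

(** As [mesh m.+1] is the square of [mesh m], the quotient [i %/ mesh m] indexes the last coarse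
    point to the left of the fine point [i]. If no fine point exceeds its coarse parent by [h], the
    bound [c] on the coarse grid becomes [c + h]. *)
Lemma chaining_step s M c h p m : 0 <= s -> 0 <= M ->
  (forall i : nat, pr P [set w | h <= Z (s + i%:R / (mesh m.+1)%:R) w -
     Z (s + (i %/ mesh m)%N%:R / (mesh m)%:R) w] <= p) ->
  pr P (below X (grid (mesh m) M s) c) <=
  pr P (below X (grid (mesh m.+1) M s) (c + h)) +
  (nfloor (M * (mesh m.+1)%:R)).+1%:R * p.
Proof.
move=> s0 M0 Hp.
pose F (i : nat) := [set w | h <= Z (s + i%:R / (mesh m.+1)%:R) w -
     Z (s + (i %/ mesh m)%N%:R / (mesh m)%:R) w].
have mF i : measurable (F i).
  apply: measurable_ge_set; apply: measurable_funB; exact: measurable_process.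
set N := (nfloor _).+1.
have [mU Ule] := pr_seq_union P (iota 0 N) mF.
apply: (@le_trans _ _ (pr P (below X (grid (mesh m.+1) M s) (c + h) `|`
    [set w | exists2 i, i \in iota 0 N & F i w]))).
  apply: pr_le; try apply: measurableU => //; try exact: measurable_below_seq.
  move=> w Hw; have [Fw|Fw] := pselect (exists2 i, i \in iota 0 N & F i w).
    by right.
  left=> x /mapP[i iN ->].
  have iM : i%:R / (mesh m.+1)%:R <= M.
    move: iN; rewrite mem_iota add0n /= ltnS le_nfloor ?mulr_ge0// => iM.
    by rewrite ler_pdivrMr// ltr0n mesh_gt0.
  have xg : s + (i %/ mesh m)%N%:R / (mesh m)%:R \in grid (mesh m) M s.
    apply: grid_mem => //; first exact: mesh_gt0.
    apply: le_trans iM; rewrite ler_pdivrMr ?ltr0n ?mesh_gt0//.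
    have m0 : (mesh m)%:R != 0 :> R by rewrite pnatr_eq0 -lt0n mesh_gt0.
    have -> : i%:R / (mesh m.+1)%:R * (mesh m)%:R = i%:R / (mesh m)%:R :> R.
      by rewrite meshS natrM; field.
    by rewrite ler_pdivlMr ?ltr0n ?mesh_gt0// -natrM ler_nat leq_divM.
  have := Hw _ xg; rewrite /X => h1.
  have : ~ F i w by move=> Fi; apply: Fw; exists i.
  by rewrite /F /= => /negP; rewrite -ltNge; lra.
apply: (le_trans (prU_le P _ _)) => //; first exact: measurable_below_seq.
rewrite lerD2l (le_trans Ule)//.
apply: (@le_trans _ _ (\sum_(i <- iota 0 N) p)); first by apply: ler_sum => i _; exact: Hp.
by rewrite big_const_seq count_predT size_iota iter_addr_0 mulr_natl.
Qed.

Lemma chaining s M r r' H e (h p : nat -> R) m0 : 0 <= s -> 0 <= M ->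
  (forall m, 0 <= h m) ->
  (forall m, (m0 <= m)%N -> forall i : nat,
     pr P [set w | h m <= Z (s + i%:R / (mesh m.+1)%:R) w -
       Z (s + (i %/ mesh m)%N%:R / (mesh m)%:R) w] <= p m) ->
  (forall n, \sum_(m0 <= m < n) h m <= H) ->
  (forall n, \sum_(m0 <= m < n) (nfloor (M * (mesh m.+1)%:R)).+1%:R * p m <= e) ->
  r' + H < r ->
  pr P (below X (grid (mesh m0) M s) r') <= pr P (sup_lt s (s + M) r) + e.
Proof.
move=> s0 M0 h0 hp hH pe r'r; rewrite -lerBlDr.
apply: (pr_sup_lt_ge s0 M0 r'r (m0 := m0)) => n m0n.
have : pr P (below X (grid (mesh m0) M s) r') <=
    pr P (below X (grid (mesh n) M s) (r' + \sum_(m0 <= m < n) h m)) +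
    \sum_(m0 <= m < n) (nfloor (M * (mesh m.+1)%:R)).+1%:R * p m.
  elim: n m0n => [|n IH].
    by rewrite leqn0 => /eqP ->; rewrite !big_geq// !addr0.
  rewrite leq_eqVlt => /predU1P[<-|]; first by rewrite !big_geq// !addr0.
  rewrite ltnS => m0n; apply: (le_trans (IH m0n)).
  rewrite !big_nat_recr//= !addrA -[leRHS]addrAC lerD2r.
  exact: (chaining_step _ s0 M0 (hp n m0n)).
have : pr P (below X (grid (mesh n) M s) (r' + \sum_(m0 <= m < n) h m)) <=
    pr P (below X (grid (mesh n) M s) (r' + H)).
  apply: pr_le; try exact: measurable_below_seq.
  by move=> w Hw x xg; rewrite (lt_le_trans (Hw x xg))// lerD2l.
by have := pe n; lra.
Qed.

End sup_events.

Section geometric.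
Variable R : realType.

Lemma geometric_tail (K rho H : R) : 0 <= K -> 0 <= rho < 1 -> 0 < H ->
  exists m1 : nat, forall m0, (m1 <= m0)%N -> forall n,
    \sum_(m0 <= m < n) K * rho ^+ m <= H.
Proof.
move=> K0 /andP[r0 r1] H0.
have r1' : 0 < 1 - rho by rewrite subr_gt0.
have sum_le m0 n : \sum_(m0 <= m < n) K * rho ^+ m <= K * rho ^+ m0 / (1 - rho).
  have [nm|mn] := leqP n m0.
    by rewrite big_geq// divr_ge0 ?mulr_ge0 ?exprn_ge0// ltW.
  rewrite -mulr_sumr -mulrA ler_wpM2l// ler_pdivlMr// mulr_suml.
  suff -> : \sum_(m0 <= m < n) rho ^+ m * (1 - rho) = rho ^+ m0 - rho ^+ n.
    by rewrite gerBl exprn_ge0.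
  have E m : rho ^+ m * (1 - rho) = - (rho ^+ m.+1) - - rho ^+ m.
    by rewrite exprS; ring.
  under eq_bigr do rewrite E.
  by rewrite telescope_sumr ?(ltnW mn)//; ring.
have d0 : 0 < H * (1 - rho) / (K + 1).
  by rewrite !mulr_gt0 ?invr_gt0// ltr_wpDl.
have : rho ^+ n @[n --> \oo] --> (0 : R) by apply: cvg_expr; rewrite ger0_norm.
move=> /cvgrPdist_le/(_ _ d0)[m1 _ Hm1].
exists m1 => m0 m10 n; apply: (le_trans (sum_le m0 n)).
have := Hm1 m0 m10; rewrite sub0r normrN ger0_norm ?exprn_ge0//.
rewrite ler_pdivlMr ?ltr_wpDl// ler_pdivrMr// => h.
by apply: le_trans h; rewrite mulrC ler_wpM2l ?exprn_ge0// lerDl.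
Qed.

End geometric.

Section uniform_chaining.
Variable R : realType.

Definition decorrelation_bound (A : R -> R -> R) (C eta e0 : R) : Prop :=
  forall s eps tau : R, 0 <= s -> 0 < eps < e0 -> 0 <= tau <= eps ->
    (1 - A s (s + tau)) * `|ln eps| `^ eta <= C.

(** The mesh is chosen before the process, the position [s] and the level [r]; this supplies
    uniformity in k and in the position of the block. *)
Lemma uniform_chaining (C eta e0 M h e : R) : 0 < C -> 1 < eta -> 0 < e0 ->
  0 <= M -> 0 < h -> 0 < e -> exists m0 : nat,
  forall d (T : measurableType d) (P : probability T R) (Z : R -> {RV P >-> R})
    (A : R -> R -> R),
  gaussian_process Z -> centered_process Z -> continuous_paths Z ->
  has_covariance Z A -> (forall s, 0 <= s -> A s s = 1) ->
  decorrelation_bound A C eta e0 ->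
  forall s r, 0 <= s ->
    pr P (below (fun t w => Z t w) (grid (mesh m0) M s) (r - h)) <=
    pr P (sup_lt Z s (s + M) r) + e.
Proof.
move=> C0 eta1 e00 M0 h0 ee0.
pose L (m : nat) : R := 2 ^+ m * ln 2.
have ln2 : 0 < ln 2 :> R by rewrite ln_gt0// ltr1n.
have L0 m : 0 < L m by rewrite mulr_gt0// exprn_gt0.
have lnmesh m : ln (mesh m)%:R = L m.
  by rewrite /mesh natrX lnXn// -[LHS]mulr_natl natrX.
pose a := (1 - eta) / 2.
have a0 : a < 0 by rewrite /a; lra.
(* By (b) an increment between the levels m and m + 1 has variance at most v = 2 C / L^eta. The
   threshold h_m^2 = 32 C L^(1 - eta) gives h_m^2 / (4 v) = 4 L, that is a failure probability 2 /
   mesh^4 against about M mesh^2 points. As eta > 1, the thresholds decay geometrically. *)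
pose K := Num.sqrt (32 * C) * (ln 2) `^ a.
pose rho := 2 `^ a : R.
have K0 : 0 <= K by rewrite mulr_ge0 ?sqrtr_ge0 ?powR_ge0.
have rho1 : 0 <= rho < 1.
  rewrite powR_ge0/= /rho /powR pnatr_eq0/= -[ltRHS]expR0 ltr_expR.
  by rewrite pmulr_llt0.
pose hh (m : nat) := K * rho ^+ m.
have hhL m : (ln 2) `^ a * rho ^+ m = (L m) `^ a.
  rewrite /L powRM ?exprn_ge0 ?(ltW ln2)// mulrC; congr (_ * _).
  by rewrite -powR_mulrn ?powR_ge0// /rho -powRrM mulrC powRrM powR_mulrn.
have hhE m : hh m ^+ 2 = 32 * C * (L m) `^ (1 - eta).
  rewrite /hh /K -mulrA hhL exprMn sqr_sqrtr; last by rewrite mulr_ge0// ltW.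
  congr (_ * _); rewrite -powR_mulrn ?powR_ge0// -powRrM.
  by congr (_ `^ _); rewrite /a divfK.
have [m1 Hm1] := geometric_tail K0 rho1 (divr_gt0 h0 (ltr0n R 2)).
have M1 : 0 <= 4 * (M + 1) by rewrite mulr_ge0// addr_ge0.
have half : 0 <= (2^-1 : R) < 1 by lra.
have [m2 Hm2] := geometric_tail M1 half ee0.
have [m3 Hm3] : exists m3 : nat, forall m, (m3 <= m)%N -> (mesh m)%:R^-1 < e0.
  exists (nfloor e0^-1) => m mm.
  rewrite -[ltRHS]invrK ltf_pV2 ?posrE ?invr_gt0 ?ltr0n ?mesh_gt0//.
  apply: (lt_le_trans (nfloor_gt _)); first by rewrite invr_ge0 ltW.
  rewrite ler_nat (leq_trans _ (mesh_ge _))//.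
  by rewrite (leq_trans _ (ltn_expl m (isT : (1 < 2)%N))).
pose m0 := maxn m1 (maxn m2 m3).
exists m0 => d T P Z A gZ cZ contZ covZ A1 dec s r s0.
pose p (m : nat) : R := 2 * expR (- (4 * L m)).
have pE m : p m = 2 * (mesh m)%:R ^- 4.
  rewrite /p -lnmesh expRN; congr (_ * _^-1).
  by rewrite expRM_natl lnK// posrE ltr0n mesh_gt0.
apply: (chaining contZ (H := h / 2) (h := hh) (p := p)) => //.
- by move=> m; rewrite /hh mulr_ge0 ?exprn_ge0//; case/andP: rho1.
- move=> m mm i.
  set t2 := s + (i %/ mesh m)%N%:R / (mesh m)%:R.
  set t1 := s + i%:R / (mesh m.+1)%:R.
  have l0 : 0 < (mesh m)%:R :> R by rewrite ltr0n mesh_gt0.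
  have tau0 : 0 <= t1 - t2 <= (mesh m)%:R^-1.
    have -> : t1 - t2 = (i%:R - (i %/ mesh m * mesh m)%N%:R) / (mesh m.+1)%:R.
      by rewrite /t1 /t2 meshS !natrM; field; rewrite gt_eqF.
    rewrite -natrB ?leq_divM// divr_ge0//=.
    rewrite ler_pdivrMr ?ltr0n ?mesh_gt0// meshS natrM mulrA mulVf ?gt_eqF// mul1r.
    by rewrite ler_nat {1}(divn_eq i (mesh m)) addKn ltnW// ltn_mod mesh_gt0.
  have t20 : 0 <= t2 by rewrite addr_ge0// divr_ge0.
  have t10 : 0 <= t1 by rewrite addr_ge0// divr_ge0.
  have lnE : `|ln (mesh m)%:R^-1| = L m.
    by rewrite lnV ?posrE// normrN lnmesh gtr0_norm.
  have epsr : 0 < ((mesh m)%:R^-1 : R) < e0.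
    apply/andP; split; first by rewrite invr_gt0.
    rewrite Hm3// (leq_trans _ mm)//.
    by rewrite /m0 !leq_max leqnn !orbT.
  have := dec t2 _ _ t20 epsr tau0; rewrite lnE subrKC => decA.
  pose v := 2 * C / (L m) `^ eta.
  have Le0 : 0 < (L m) `^ eta by rewrite powR_gt0.
  have v0 : 0 < v by rewrite !mulr_gt0 ?invr_gt0.
  have hm0 : 0 < hh m.
    rewrite /hh !mulr_gt0 ?exprn_gt0 ?powR_gt0// sqrtr_gt0 mulr_gt0//.
  have Av : 2 * (1 - A t2 t1) <= v.
    by rewrite /v ler_pdivlMr// -mulrA ler_pM2l.
  apply: (le_trans (pr_increment_tail gZ cZ covZ A1 t20 t10 hm0 v0 Av)).
  rewrite /p ler_pM2l// ler_expR lerN2 hhE /v.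
  have -> : (L m) `^ (1 - eta) = L m / (L m) `^ eta.
    by rewrite powRD ?(gt_eqF (L0 m)) ?implybT// powRN powRr1 ?(ltW (L0 m)).
  rewrite le_eqVlt; apply/orP; left; apply/eqP.
  by field; rewrite !gt_eqF.
- move=> n; apply: Hm1; by rewrite /m0 leq_max leqnn.
- move=> n; apply: (@le_trans _ _ (\sum_(m0 <= m < n) 4 * (M + 1) * 2^-1 ^+ m)); last first.
    by apply: Hm2; rewrite /m0 !leq_max leqnn !orbT.
  apply: ler_sum => m _; rewrite pE.
  have l1 : 1 <= (mesh m)%:R :> R by rewrite ler1n mesh_gt0.
  have l0 : 0 < (mesh m)%:R :> R by rewrite ltr0n mesh_gt0.
  set l : R := (mesh m)%:R.
  have NM : (nfloor (M * (mesh m.+1)%:R)).+1%:R <= (M + 1) * l ^+ 2.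
    rewrite -natr1 mulrDl mul1r lerD ?exprn_ege1//.
    have Ml : 0 <= M * (mesh m.+1)%:R by rewrite mulr_ge0.
    by rewrite (le_trans (nfloor_le Ml))// meshS natrM expr2.
  have l2 : l ^- 2 <= 2^-1 ^+ m.
    rewrite exprVn lef_pV2 ?posrE ?exprn_gt0//.
    have : 2 ^+ m <= l by rewrite /l -natrX ler_nat mesh_ge.
    by move=> /le_trans; apply; rewrite expr2 ler_peMr// ltW.
  apply: (@le_trans _ _ ((M + 1) * l ^+ 2 * (2 * l ^- 4))).
    by rewrite ler_wpM2r// mulr_ge0// invr_ge0 exprn_ge0// ltW.
  have -> : (M + 1) * l ^+ 2 * (2 * l ^- 4) = 2 * (M + 1) * l ^- 2.
    by field; rewrite gt_eqF.
  apply: (@le_trans _ _ (2 * (M + 1) * 2^-1 ^+ m)).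
    by rewrite ler_wpM2l// mulr_ge0// addr_ge0.
  by rewrite ler_wpM2r ?exprn_ge0// ler_wpM2r ?addr_ge0// ler_nat.
- lra.
Qed.

End uniform_chaining.

(** * Products over blocks of time *)

Section block_products.
Context d (T : measurableType d) (R : realType) (P : probability T R).
Variables (Z : R -> {RV P >-> R}) (A : R -> R -> R).
Hypothesis gZ : gaussian_process Z.
Hypothesis cZ : centered_process Z.
Hypothesis contZ : continuous_paths Z.
Hypothesis covZ : has_covariance Z A.
Hypothesis A0 : forall s t, 0 <= s -> 0 <= t -> 0 <= A s t.

Let X := even_process Z.

Lemma below_even (g : seq R) r : (forall x, x \in g -> 0 <= x) ->
  below X g r = below (fun t w => Z t w) g r.
Proof.
move=> g0; apply/seteqP; split => w H t tg; have := H t tg;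
  by rewrite /X /even_process ger0_norm// g0.
Qed.

Lemma below_flatten (q r : R) (ss : seq (seq R)) : 0 <= q ->
  (forall g, g \in ss -> q <= pr P (below X g r)) ->
  q ^+ size ss <= pr P (below X (flatten ss) r).
Proof.
move=> q0; elim: ss => [|g ss IH] H.
  rewrite expr0 (_ : below X (flatten [::]) r = setT).
    by rewrite /pr probability_setT.
  by apply/seteqP; split.
rewrite exprS /=.
apply: le_trans (below_assoc (process_gfield gZ cZ covZ) _ g (flatten ss) r).
  apply: ler_pM => //; first exact: exprn_ge0.
    by apply: H; rewrite mem_head.
  by apply: IH => g' g's; apply: H; rewrite inE g's orbT.
by move=> u v; exact: A0.
Qed.

(** Association concerns finitely many points. It is applied at level r' on each fine grid, cut into
    blocks, and the bound then passes to the supremum at the higher level [r]. *)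
Lemma pr_sup_lt_blocks (M Tm r r' q : R) : 0 < M -> 0 <= Tm -> r' < r -> 0 <= q ->
  (forall s, 0 <= s -> q <= pr P (sup_lt Z s (s + M) r')) ->
  q ^+ (nfloor (Tm / M)).+1 <= pr P (sup_lt Z 0 (0 + Tm) r).
Proof.
move=> M0 T0 r'r q0 H.
apply: (pr_sup_lt_ge contZ (lexx 0) T0 r'r (m0 := 0%N)) => m _.
set g := grid (mesh m) Tm 0.
(* Closed blocks share end points, which is harmless in a list; the extra block covers the end of
   the interval. *)
pose block (j : nat) := [seq x <- g | j%:R * M <= x <= j%:R * M + M].
pose ss := [seq block j | j <- iota 0 (nfloor (Tm / M)).+1].
have g0 x : x \in g -> 0 <= x <= Tm.
  move=> /(mem_grid (mesh_gt0 m) T0)[i -> iT].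
  by rewrite add0r divr_ge0.
have -> : (nfloor (Tm / M)).+1 = size ss by rewrite /ss size_map size_iota.
have b0 j x : x \in block j -> 0 <= x.
  by rewrite mem_filter => /andP[_ /g0/andP[]].
have := below_flatten (r := r') (ss := ss) q0 => /(_ _)/le_trans; apply.
  move=> _ /mapP[j _ ->]; rewrite below_even; last exact: b0.
  have jM : 0 <= j%:R * M by rewrite mulr_ge0// ltW.
  apply: (le_trans (H _ jM)); apply: pr_le.
  - by apply: (measurable_sup_lt contZ) => //; exact: ltW.
  - exact: measurable_below_seq.
  - apply: sup_lt_below => //; first exact: ltW.
    by move=> x; rewrite mem_filter => /andP[].
rewrite below_even; last by move=> x /flattenP[_ /mapP[j _ ->]]; exact: b0.
apply: pr_le; [exact: measurable_below_seq|exact: measurable_below_seq|].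
move=> w Hw x xg; apply: Hw; have /andP[x0 xT] := g0 _ xg.
apply/flattenP; exists (block (nfloor (x / M))).
  apply: map_f; rewrite mem_iota add0n ltnS leq0n/=.
  rewrite le_nfloor ?divr_ge0 ?(ltW M0)//.
  apply: (le_trans (nfloor_le _)); first by rewrite divr_ge0// ltW.
  by rewrite ler_pM2r// invr_gt0.
rewrite mem_filter xg andbT.
have xM : 0 <= x / M by rewrite divr_ge0// ltW.
rewrite -ler_pdivlMr// nfloor_le//=.
have -> : (nfloor (x / M))%:R * M + M = (nfloor (x / M)).+1%:R * M.
  by rewrite -(natr1 (nfloor _)) mulrDl mul1r.
by rewrite -ler_pdivrMr// ltW// nfloor_gt.
Qed.

End block_products.

(** * Comparison with the limit process *)

Section symmetric_sums.
Variable R : realType.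

Lemma sum_symmetric N (F : 'I_N -> 'I_N -> R) :
  (forall i j : 'I_N, F i j = F j i) ->
  \sum_(i < N) \sum_(j < N) F i j =
  2 * (\sum_(i < N) \sum_(j < N | (i < j)%N) F i j) + \sum_(i < N) F i i.
Proof.
move=> Fsym.
have E (i : 'I_N) : \sum_(j < N) F i j = \sum_(j < N | (i < j)%N) F i j +
    \sum_(j < N | (j < i)%N) F i j + F i i.
  rewrite (bigID (fun j : 'I_N => (i < j)%N))/= -addrA; congr (_ + _).
  rewrite (bigID (fun j : 'I_N => (j < i)%N))/=; congr (_ + _).
    by apply: eq_bigl => j; rewrite -leqNgt andb_idl// => /ltnW.
  by rewrite (big_pred1 i)// => j; rewrite -!leqNgt -eqn_leq.
under eq_bigr do rewrite E.
rewrite !big_split/=; congr (_ + _).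
have -> : \sum_(i < N) \sum_(j < N | (j < i)%N) F i j =
    \sum_(i < N) \sum_(j < N | (i < j)%N) F i j.
  rewrite (exchange_big_dep predT)//=; apply: eq_bigr => i _.
  by apply: eq_bigr => j _; exact: Fsym.
by rewrite mulr_natl mulr2n.
Qed.

(** For fixed [i] the lags j - i are distinct, so each row is bounded by a sum over lags in which
    [i] no longer occurs. *)
Lemma sum_above_le N (i : 'I_N) (f : nat -> R) : (forall m, 0 <= f m) ->
  \sum_(j < N | (i < j)%N) f (j - i)%N <= \sum_(1 <= m < N) f m.
Proof.
move=> f0.
rewrite -(big_mkord (fun j => (i < j)%N) (fun j => f (j - i)%N)).
have -> : \sum_(0 <= j < N | (i < j)%N) f (j - i)%N =
    \sum_(i.+1 <= j < N) f (j - i)%N by rewrite (big_nat_widenl i.+1 0).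
rewrite -[i.+1]add1n big_addn.
under eq_bigr do rewrite addnK.
rewrite [leRHS](@big_cat_nat _ _ _ (N - i))//=; last exact: leq_subr.
  by rewrite lerDl sumr_ge0.
by rewrite subn_gt0.
Qed.

Lemma excess_le N (S S' : 'I_N -> 'I_N -> R) (e : R) :
  (forall i j, S i j = S j i) -> (forall i j, S' i j = S' j i) ->
  (forall i, S i i = S' i i) ->
  (forall i : 'I_N, \sum_(j < N | (i < j)%N) Num.max 0 (S i j - S' i j) <= e) ->
  excess S S' <= 2 * N%:R * e.
Proof.
move=> Ssym S'sym diag H; rewrite /excess sum_symmetric; last first.
  by move=> i j; rewrite Ssym S'sym.
rewrite [X in _ + X]big1 ?addr0; last by move=> i _; rewrite diag subrr maxxx.
rewrite -mulrA ler_pM2l//.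
apply: (@le_trans _ _ (\sum_(i < N) e)); first exact: ler_sum.
by rewrite sumr_const card_ord mulr_natl.
Qed.

End symmetric_sums.

(** * Estimates along arithmetic progressions of times *)

Section progression.
Variable R : realType.

(** The length is free here, while that of [grid] is dictated by an interval; [grid l M s] is the
    progression of length [(nfloor (M * l%:R)).+1]. *)
Definition ap (l N : nat) (s : R) : seq R :=
  [seq s + i%:R / l%:R | i <- iota 0 N].

Lemma below_ap (T : Type) (X : R -> T -> R) l N s r :
  below X (ap l N s) r = [set w | forall i : 'I_N, X (s + i%:R / l%:R) w < r].
Proof.
apply/seteqP; split => w /= H.
  by move=> i; apply: H; apply/mapP; exists (val i) => //; rewrite mem_iota/=.
by move=> t /mapP[i]; rewrite mem_iota add0n => /= iN ->; exact: (H (Ordinal iN)).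
Qed.

Lemma ap_shift l (s : R) (i j : nat) : (i <= j)%N ->
  s + j%:R / l%:R = s + i%:R / l%:R + (j - i)%:R / l%:R.
Proof. by move=> ij; rewrite natrB// mulrBl; ring. Qed.

Lemma ap_dist l (s : R) (i j : nat) : (i <= j)%N ->
  `|s + i%:R / l%:R - (s + j%:R / l%:R)| = (j - i)%:R / l%:R.
Proof.
move=> ij; rewrite distrC (ap_shift l s ij).
rewrite [X in `|X|](_ : _ = (j - i)%:R / l%:R); last by ring.
by rewrite ger0_norm// divr_ge0.
Qed.

Lemma ap_ge0 l N (s x : R) : 0 <= s -> x \in ap l N s -> 0 <= x.
Proof. by move=> s0 /mapP[i _ ->]; rewrite addr_ge0// divr_ge0. Qed.

Variables (d : measure_display) (T : measurableType d) (P : probability T R).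
Variables (Z : R -> {RV P >-> R}) (A : R -> R -> R).
Hypothesis gZ : gaussian_process Z.
Hypothesis cZ : centered_process Z.
Hypothesis covZ : has_covariance Z A.
Hypothesis A1 : forall s, 0 <= s -> A s s = 1.
Hypothesis A0 : forall s t, 0 <= s -> 0 <= t -> 0 <= A s t.

Lemma gvec_ap l N (s : R) : 0 <= s ->
  gvec P (fun (i : 'I_N) w => Z (s + i%:R / l%:R) w)
    (fun i j => A (s + i%:R / l%:R) (s + j%:R / l%:R)).
Proof.
move=> s0; split; first by move=> i; exact: measurable_process.
move=> c th; apply: (lincomb_cos gZ cZ covZ) => i.
by rewrite addr_ge0// divr_ge0.
Qed.

Lemma Phi_gt0 (r : R) : 0 < Phi r.
Proof.
rewrite /Phi fine_gt0// normal_prob_lt_gt0/=.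
apply: (@le_lt_trans _ _ 1%E); last exact: ltry.
pose nu : probability (measurableTypeR R) R := normal_prob 0 1.
apply: (@probability_le1 _ _ _ nu).
exact: measurable_lt_set (@measurable_id _ R setT).
Qed.

Let X := even_process Z.

Lemma Phi_below (r : R) (u : R) : Phi r <= pr P (below X [:: u] r).
Proof.
have -> : below X [:: u] r = [set w | Z `|u| w < r].
  apply/seteqP; split => w H; first by apply: H; rewrite mem_head.
  by move=> t; rewrite inE => /eqP ->.
by rewrite (pr_coord_lt gZ cZ covZ A1).
Qed.

Lemma pr_below_ge (g : seq R) r : (forall x, x \in g -> 0 <= x) ->
  Phi r ^+ size g <= pr P (below (fun t w => Z t w) g r).
Proof.
move=> g0; rewrite -below_even//.
apply: (below_ge_expr (process_gfield gZ cZ covZ)).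
- by move=> u v; exact: A0.
- exact/ltW/Phi_gt0.
- exact: Phi_below.
Qed.

Lemma pr_below_cat (g g' : seq R) r : (forall x, x \in g -> 0 <= x) ->
  (forall x, x \in g' -> 0 <= x) ->
  pr P (below (fun t w => Z t w) g r) * Phi r ^+ size g' <=
  pr P (below (fun t w => Z t w) (g ++ g') r).
Proof.
move=> g0 g0'.
have gg' x : x \in g ++ g' -> 0 <= x by rewrite mem_cat => /orP[/g0|/g0'].
rewrite -(below_even _ _ g0) -(below_even _ _ gg').
apply: (below_drop (process_gfield gZ cZ covZ)).
- by move=> u v; exact: A0.
- exact/ltW/Phi_gt0.
- exact: Phi_below.
Qed.

Lemma soft_ap_le l N (s r b : R) : 0 <= s -> 0 <= b ->
  \int[P]_w (\prod_(i < N) (\1_[set w | Z (s + i%:R / l%:R) w < r] w + b)) <=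
  (1 + b / Phi r) ^+ N * pr P (below (fun t w => Z t w) (ap l N s) r).
Proof.
move=> s0 b0.
have K0 u v : 0 <= even_cov A u v by exact: A0.
have := soft_below_le (process_gfield gZ cZ covZ) K0
  (ltW (Phi_gt0 r)) (Phi_below r) (ap l N s) (Phi_gt0 r) b0.
have sz : size (ap l N s) = N by rewrite size_map size_iota.
have g0 x : x \in ap l N s -> 0 <= x by exact: ap_ge0.
rewrite (below_even _ _ g0) [X in (1 + b / Phi r) ^+ X]sz.
apply: le_trans; rewrite le_eqVlt; apply/orP; left; apply/eqP.
apply: eq_Rintegral => w _.
rewrite -(big_tnth _ _ (ap l N s) predT (fun t => \1_[set w | X t w < r] w + b)).
rewrite /ap big_map -[N in iota 0 N]subn0 -/(index_iota 0 N) big_mkord.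
apply: eq_bigr => i _; congr (\1_(_) _ + _).
apply/seteqP; split => w' /=; rewrite /X /even_process ger0_norm//;
  by rewrite addr_ge0// divr_ge0.
Qed.

(** Unit variances and non-negative correlations make the row sums at least 1; [V] bounds the
    variance of the sum of the coordinates, whose exponential moment is then at most 2 exp V. *)
Lemma shift_ap l N (s r b dl V : R) : (0 < N)%N -> 0 <= s -> 0 <= b -> 0 <= dl ->
  \sum_(i < N) \sum_(j < N) A (s + i%:R / l%:R) (s + j%:R / l%:R) <= V ->
  pr P (below (fun t w => Z t w) (ap l N s) (r + dl)) <=
  expR (b * dl) * (pr P (below (fun t w => Z t w) (ap l N s) r) +
                   2 * expR (V - b) * dl).
Proof.
move=> N0 s0 b0 dl0 HV.
have t0 (i : 'I_N) : 0 <= s + i%:R / l%:R by rewrite addr_ge0// divr_ge0.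
have gY := gvec_ap l N s0.
pose v := cov_form (fun i j : 'I_N => A (s + i%:R / l%:R) (s + j%:R / l%:R)) (fun=> 1).
have vE : v = \sum_(i < N) \sum_(j < N) A (s + i%:R / l%:R) (s + j%:R / l%:R).
  by apply: eq_bigr => i _; apply: eq_bigr => j _; rewrite !mul1r.
have g1 (i : 'I_N) : 1 <= \sum_(j < N) A (s + i%:R / l%:R) (s + j%:R / l%:R).
  by rewrite (bigD1 i)//= A1// lerDl; apply: sumr_ge0 => j _; exact: A0.
have v0 : 0 < v.
  rewrite vE; apply: (@lt_le_trans _ _ (\sum_(i < N) 1)).
    by rewrite sumr_const card_ord ltr0n.
  exact: ler_sum.
have [iE leE] := lincomb_exp_norm gZ cZ covZ (c := fun=> 1) t0 v0.
have WE : (fun w => \sum_(i < N) 1 * Z (s + i%:R / l%:R) w) =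
    (fun w => \sum_(i < N) Z (s + i%:R / l%:R) w).
  by apply/funext => w; apply: eq_bigr => i _; rewrite mul1r.
have iE' : P.-integrable setT
    (EFin \o (fun w => expR `|\sum_(i < N) Z (s + i%:R / l%:R) w|)).
  move: iE; congr (P.-integrable setT _); apply/funext => w /=.
  by have := congr1 (fun f => (expR `|f w|)%:E) WE.
have leE' : \int[P]_w expR `|\sum_(i < N) Z (s + i%:R / l%:R) w| <= 2 * expR v.
  apply: le_trans leE; rewrite le_eqVlt; apply/orP; left; apply/eqP.
  apply: eq_Rintegral => w _.
  by have := congr1 (fun f => expR `|f w|) WE.
have sym (i j : 'I_N) : A (s + i%:R / l%:R) (s + j%:R / l%:R) =
  A (s + j%:R / l%:R) (s + i%:R / l%:R) by exact: (covC covZ).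
have := gaussian_shift gY sym iE' leE' r b0 dl0 g1.
move=> H; rewrite !below_ap; apply: (le_trans H).
rewrite ler_wpM2l ?expR_ge0// lerD2l ler_wpM2r//.
rewrite mulrCA ler_pM2l// -expRD ler_expR.
by rewrite addrC lerD2r vE.
Qed.

End progression.

(** Ending the second range at L + N instead of N covers the case L > N as well. *)
Lemma sum_range_le (R : realType) (f : nat -> R) (L N : nat) :
  (forall m, 0 <= f m) ->
  \sum_(1 <= m < N) f m <= \sum_(0 <= m < L) f m + \sum_(L <= m < L + N) f m.
Proof.
move=> f0; rewrite -(@big_cat_nat _ _ _ L)//=; last exact: leq_addr.
have [N0|N0] := leqP 1 N; last by rewrite big_geq ?sumr_ge0// ltnW.
rewrite [leRHS](@big_cat_nat _ _ _ N)//=; last exact: leq_addl.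
rewrite [in leRHS](@big_cat_nat _ _ _ 1)//= -addrA addrCA lerDl.
by rewrite addr_ge0// sumr_ge0.
Qed.

(** * Convergence and summability of the correlations *)

Section correlations.
Variables (R : realType) (A : nat -> R -> R -> R) (Ainf : R -> R).

Definition corr_cvg : Prop := forall tau e : R, 0 <= tau -> 0 < e ->
  exists K, forall k s, (K <= k)%N -> 0 <= s -> `|A k s (s + tau) - Ainf tau| < e.

Definition corr_tails (l : nat) : Prop := forall e : R, 0 < e ->
  exists L K, forall k s n, (K <= k)%N -> 0 <= s ->
    \sum_(L <= m < n) A k s (s + m%:R / l%:R) <= e.

Hypothesis A0 : forall k s t, (1 <= k)%N -> 0 <= s -> 0 <= t -> 0 <= A k s t.
Hypothesis Ainf0 : forall tau, 0 <= tau -> 0 <= Ainf tau.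
Hypothesis Acvg : corr_cvg.

Lemma corr_cvg_finite (l L : nat) (e : R) : 0 < e -> exists K, (1 <= K)%N /\
  forall k s, (K <= k)%N -> 0 <= s -> forall m, (m < L)%N ->
    `|A k s (s + m%:R / l%:R) - Ainf (m%:R / l%:R)| < e.
Proof.
move=> e0; elim: L => [|L [K [K1 HK]]]; first by exists 1%N.
have tau0 : 0 <= L%:R / l%:R :> R by rewrite divr_ge0.
have [K' HK'] := Acvg tau0 e0.
exists (maxn K K'); split; first by rewrite leq_max K1.
move=> k s; rewrite geq_max => /andP[kK kK'] s0 m.
rewrite ltnS leq_eqVlt => /predU1P[->|mL]; first exact: HK'.
exact: HK.
Qed.

(** Below the cut-off finitely many lags are handled by convergence. Beyond it the positive part is
    at most [A k] itself, as [Ainf] is non-negative, and (a) controls the tail. *)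
Lemma corr_diff_sum (l : nat) (e : R) : corr_tails l -> 0 < e ->
  exists K, (1 <= K)%N /\ forall k s N, (K <= k)%N -> 0 <= s ->
    \sum_(1 <= m < N)
      Num.max 0 (A k s (s + m%:R / l%:R) - Ainf (m%:R / l%:R)) <= e.
Proof.
move=> Htail e0; have e2 : 0 < e / 2 by rewrite divr_gt0.
have [L [K1 HL]] := Htail _ e2.
(* The successor avoids a division by 0 when the cut-off is 0. *)
have e3 : 0 < e / 2 / L.+1%:R by rewrite divr_gt0.
have [K2 [K21 HK2]] := corr_cvg_finite l L e3.
exists (maxn K1 K2); split; first by rewrite leq_max K21 orbT.
move=> k s N; rewrite geq_max => /andP[kK1 kK2] s0.
have k1 : (1 <= k)%N by exact: leq_trans kK2.
set f := fun m : nat => Num.max 0 (A k s (s + m%:R / l%:R) - Ainf (m%:R / l%:R)).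
have f0 m : 0 <= f m by rewrite le_max lexx.
have t0 (m : nat) : 0 <= m%:R / l%:R :> R by rewrite divr_ge0.
apply: (le_trans (sum_range_le L N f0)).
rewrite [leRHS]splitr lerD//.
  apply: (@le_trans _ _ (\sum_(0 <= m < L) e / 2 / L.+1%:R)).
    rewrite !big_mkord; apply: ler_sum => m _.
    rewrite /f ge_max (ltW e3)/=.
    by rewrite (le_trans (ler_norm _))// ltW// HK2.
  rewrite sumr_const_nat subn0 -[leLHS]mulr_natr -mulrA ger_pMr// mulrC.
  by rewrite ler_pdivrMr// mul1r ler_nat.
apply: le_trans (HL k s (L + N)%N kK1 s0).
apply: ler_sum => m _; rewrite /f ge_max A0 ?addr_ge0//=.
by rewrite gerBl Ainf0.
Qed.

(** Each partial sum is compared with that of a single large [k] depending on [N]. In the constant,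
    2 is 1 for the tail of [A k] plus at most 1 for N errors 1 / (N + 1). *)
Lemma corr_limit_summable (l : nat) : corr_tails l ->
  exists2 B : R, 0 <= B & forall N, \sum_(1 <= m < N) Ainf (m%:R / l%:R) <= B.
Proof.
move=> Htail; have [L [K HL]] := Htail 1 ltr01.
pose B0 : R := \sum_(0 <= m < L) Ainf (m%:R / l%:R).
have t0 (m : nat) : 0 <= m%:R / l%:R :> R by rewrite divr_ge0.
have B00 : 0 <= B0 by apply: sumr_ge0 => m _; exact: Ainf0.
exists (B0 + 2); first by rewrite addr_ge0.
move=> N.
apply: (le_trans (sum_range_le L N (fun m => Ainf0 (t0 m)))).
rewrite lerD2l.
have e0 : 0 < N.+1%:R^-1 :> R by rewrite invr_gt0.
have [K2 [K21 HK2]] := corr_cvg_finite l (L + N) e0.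
set k := maxn K K2.
have kK : (K <= k)%N by exact: leq_maxl.
have kK2 : (K2 <= k)%N by exact: leq_maxr.
have := HL k 0 (L + N)%N kK (lexx 0) => H.
have : \sum_(L <= m < L + N) Ainf (m%:R / l%:R) <=
    \sum_(L <= m < L + N) (A k 0 (0 + m%:R / l%:R) + N.+1%:R^-1).
  rewrite !big_nat; apply: ler_sum => m /andP[_ mN].
  have := HK2 k 0 kK2 (lexx 0) m mN; rewrite ltr_distlC => /andP[_ /ltW].
  by [].
move=> /le_trans; apply; rewrite big_split/= -[2]/(1 + 1) lerD//.
rewrite sumr_const_nat addKn -[leLHS]mulr_natl ler_pdivrMr// mul1r ler_nat.
exact: leqnSn.
Qed.

End correlations.

Lemma le_of_soft_bound (R : realType) (x y t : R) : 0 < t -> x <= 1 -> 0 <= y ->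
  (1 - t) * x <= (1 + t) * ((1 + t) * (y + t)) -> x - 4 * t <= y.
Proof.
move=> t0 x1 y0 H; rewrite leNgt; apply/negP => yx.
have : (1 + t) * ((1 + t) * (y + t)) < (1 + t) * ((1 + t) * (x - 3 * t)).
  by rewrite !ltr_pM2l ?addr_gt0//; lra.
move=> /(le_lt_trans H) {H}.
have : t * x <= t by rewrite ger_pMr.
have : t * (t * x) <= t * t by rewrite ler_pM2l// ger_pMr.
have tt : 0 < t * t by rewrite mulr_gt0.
have : 0 < t * (t * t) by rewrite mulr_gt0.
lra.
Qed.

(** * Upper and lower bounds against the limit process *)

Section limit_comparison.
Variables (R : realType)
  (d : nat -> measure_display) (Omega : forall k : nat, measurableType (d k))
  (P : forall k : nat, probability (Omega k) R)
  (Z : forall k : nat, R -> {RV (P k) >-> R}) (A : nat -> R -> R -> R)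
  (dinf : measure_display) (Omegainf : measurableType dinf)
  (Pinf : probability Omegainf R) (Zinf : R -> {RV Pinf >-> R}) (Ainf : R -> R).
Hypotheses (Zg : forall k, (1 <= k)%N -> gaussian_process (Z k))
  (Zc : forall k, (1 <= k)%N -> centered_process (Z k))
  (Zcont : forall k, (1 <= k)%N -> continuous_paths (Z k))
  (Zcov : forall k, (1 <= k)%N -> has_covariance (Z k) (A k))
  (A1 : forall k s, (1 <= k)%N -> 0 <= s -> A k s s = 1)
  (A0 : forall k s t, (1 <= k)%N -> 0 <= s -> 0 <= t -> 0 <= A k s t)
  (Zig : gaussian_process Zinf) (Zic : centered_process Zinf)
  (Zicont : continuous_paths Zinf)
  (Zicov : has_covariance Zinf (fun s t => Ainf `|s - t|))
  (Ainf1 : Ainf 0 = 1) (Ainf0 : forall tau, 0 <= tau -> 0 <= Ainf tau)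
  (Acvg : corr_cvg A Ainf).

Let Ai1 s : 0 <= s -> Ainf `|s - s| = 1.
Proof. by rewrite subrr normr0. Qed.

Let Ai0 s t : 0 <= s -> 0 <= t -> 0 <= Ainf `|s - t|.
Proof. by move=> _ _; exact: Ainf0. Qed.

Lemma ap_variance_le (l N : nat) (s B : R) :
  (forall N, \sum_(1 <= m < N) Ainf (m%:R / l%:R) <= B) ->
  \sum_(i < N) \sum_(j < N) Ainf `|s + i%:R / l%:R - (s + j%:R / l%:R)| <=
  (2 * B + 1) * N%:R.
Proof.
move=> HB; rewrite sum_symmetric; last by move=> i j; rewrite distrC.
have -> : (2 * B + 1) * N%:R = 2 * (\sum_(i < N) B) + \sum_(i < N) 1.
  by rewrite !sumr_const card_ord -[in RHS](mulr_natr B); ring.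
rewrite lerD ?ler_pM2l//; apply: ler_sum => i _.
  apply: le_trans (HB N).
  apply: le_trans (sum_above_le i (fun m => Ainf0 (divr_ge0 (ler0n R m) (ler0n R l)))).
  by apply: ler_sum => j /ltnW ij; rewrite ap_dist.
by rewrite subrr normr0 Ainf1.
Qed.

Lemma ap_excess_le (l N k : nat) (s e : R) : (1 <= k)%N -> 0 <= s ->
  (forall s N, 0 <= s -> \sum_(1 <= m < N)
     Num.max 0 (A k s (s + m%:R / l%:R) - Ainf (m%:R / l%:R)) <= e) ->
  excess (fun i j : 'I_N => A k (s + i%:R / l%:R) (s + j%:R / l%:R))
    (fun i j : 'I_N => Ainf `|s + i%:R / l%:R - (s + j%:R / l%:R)|) <=
  2 * N%:R * e.
Proof.
move=> k1 s0 He.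
have t0 (i : 'I_N) : 0 <= s + i%:R / l%:R by rewrite addr_ge0// divr_ge0.
apply: excess_le.
- by move=> i j; exact: (covC (Zcov k1)).
- by move=> i j; rewrite distrC.
- by move=> i; rewrite A1// subrr normr0 Ainf1.
move=> i; apply: le_trans (He _ N (t0 i)).
pose f m := Num.max 0
  (A k (s + i%:R / l%:R) (s + i%:R / l%:R + m%:R / l%:R) - Ainf (m%:R / l%:R)).
have f0 m : 0 <= f m by rewrite le_max lexx.
apply: le_trans (sum_above_le i f0).
by apply: ler_sum => j /ltnW ij; rewrite ap_dist// (ap_shift l s ij).
Qed.

(** Four losses, each kept below exp (e N / 4): the factor (1 - k)^N of the comparison, its
    exponential factor, the soft product and the level shift. *)
Lemma ap_upper_bound (l : nat) (r e : R) : corr_tails A l -> 0 < e ->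
  exists K, (1 <= K)%N /\ forall k N s, (K <= k)%N -> (0 < N)%N -> 0 <= s ->
    pr (P k) (below (fun t w => Z k t w) (ap l N s) r) <=
    3 * expR (e * N%:R) * pr Pinf (below (fun t w => Zinf t w) (ap l N s) r).
Proof.
move=> Htail e0.
have [B B0 HB] := corr_limit_summable Ainf0 Acvg Htail.
pose q : R := Phi r.
have q0 : 0 < q by exact: Phi_gt0.
have q1 : q <= 1.
  rewrite /q -(pr_coord_lt Zig Zic Zicov Ai1 r (lexx 0)); apply: pr_le1.
  by apply: measurable_lt_set; exact: measurable_process.
pose Kc := 2 * B + 1.
have Kc1 : 1 <= Kc by rewrite lerDr mulr_ge0.
have Kc0 : 0 < Kc by exact: lt_le_trans Kc1.
(* The shift runs at rate b = (Kc + Lq) N, where Kc N bounds the variance of the sum: its remainder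
   is then at most 2 exp (- Lq N) = 2 q^N, hence at most 2 p. This is the origin of the factor 3 = 1
   + 2. *)
pose Lq := - ln q.
have Lq0 : 0 <= Lq by rewrite oppr_ge0 ln_le0.
have eLq : expR (- Lq) = q by rewrite opprK lnK// posrE.
pose D := Kc + Lq + e.
have D0 : 0 < D by rewrite /D; lra.
pose dl := e / 4 / D.
have e40 : 0 < e / 4 by rewrite divr_gt0.
have dl0 : 0 < dl by rewrite divr_gt0.
have dl1 : dl <= 1 by rewrite /dl ler_pdivrMr// mul1r /D; lra.
have dlD : (Kc + Lq) * dl <= e / 4.
  by rewrite /dl mulrCA ger_pMr// ler_pdivrMr// mul1r /D; lra.
pose q' : R := Phi (r + dl).
have q'0 : 0 < q' by exact: Phi_gt0.
(* The first entry gives (1 - kp)^N >= exp (- e N / 4), the second (1 + 2 kp / q')^N <= exp (e N /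
   4). *)
pose kp := Num.min (1 - expR (- (e / 4))) (e / 4 * q' / 2).
have ee1 : expR (- (e / 4)) < 1 by rewrite expR_lt1 oppr_lt0.
have kp0 : 0 < kp by rewrite lt_min subr_gt0 ee1 !mulr_gt0 ?invr_gt0.
have kp1 : expR (- (e / 4)) <= 1 - kp by rewrite lerBrDl addrC -lerBrDl ge_min lexx.
have kp2 : 2 * kp / q' <= e / 4.
  by rewrite ler_pdivrMr// mulrC -ler_pdivlMr// ge_min lexx orbT.
have kp3 : kp < 1 by have := expR_gt0 (- (e / 4)); lra.
have kp01 : 0 < kp < 1 by rewrite kp0.
have [C C0 HC] := gaussian_comparison r dl0 kp01.
have C1 : 0 < C + 1 by rewrite ltr_wpDl.
(* The excess will be at most 2 N times this number, and [C] times that at most e N / 4; [C + 1]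
   allows for [C] equal to 0. *)
have e1 : 0 < e / 4 / 2 / (C + 1) by rewrite !divr_gt0.
have [K [K1 HK]] := corr_diff_sum A0 Ainf0 Acvg Htail e1.
exists K; split => // k N s kK N0 s0.
have k1 : (1 <= k)%N by exact: leq_trans kK.
have exc := ap_excess_le N k1 s0 (fun s' N' => HK k s' N' kK).
have t0 (i : 'I_N) : 0 <= s + i%:R / l%:R by rewrite addr_ge0// divr_ge0.
have diag (i : 'I_N) : A k (s + i%:R / l%:R) (s + i%:R / l%:R) =
  Ainf `|s + i%:R / l%:R - (s + i%:R / l%:R)| by rewrite A1// subrr normr0 Ainf1.
have := HC _ _ _ _ _ _ _ _ _ _ _ (gvec_ap (Zg k1) (Zc k1) (Zcov k1) l N s0)
  (gvec_ap Zig Zic Zicov l N s0) diag.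
rewrite card_ord [X in _ -> pr (P k) X <= _]below_ap.
set Pk := pr (P k) _ => cmp.
set p := pr Pinf _.
have soft := soft_ap_le Zig Zic Zicov Ai1 Ai0 l N (r + dl) s0 (ltW (mulr_gt0 (ltr0n R 2) kp0)).
have V := ap_variance_le N s HB.
have b0 : 0 <= (Kc + Lq) * N%:R by rewrite mulr_ge0// addr_ge0// ltW.
have shift := shift_ap Zig Zic Zicov Ai1 Ai0 r N0 s0 b0 (ltW dl0) V.
pose E := expR (e / 4 * N%:R).
have E0 : 0 < E := expR_gt0 _.
have p0 : q ^+ N <= p.
  have := pr_below_ge Zig Zic Zicov Ai1 Ai0 r (fun x => @ap_ge0 R l N s x s0).
  by rewrite size_map size_iota.
have h3 : pr Pinf (below (fun t w => Zinf t w) (ap l N s) (r + dl)) <= E * (3 * p).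
  apply: (le_trans shift); apply: ler_pM.
  - exact: expR_ge0.
  - apply: addr_ge0; first exact: pr_ge0.
    apply: mulr_ge0; last exact: ltW.
    by apply: mulr_ge0 => //; exact: expR_ge0.
  - by rewrite ler_expR mulrAC ler_wpM2r.
  have -> : (2 * B + 1) * N%:R - (Kc + Lq) * N%:R = N%:R * (- Lq) by rewrite /Kc; ring.
  rewrite expRM_natl eLq.
  have -> : 3 * p = p + 2 * p by ring.
  rewrite lerD2l -mulrA ler_pM2l//.
  by rewrite (le_trans _ p0)// ler_piMr// exprn_ge0// ltW.
have h2 : \int[Pinf]_w (\prod_(i < N)
    (\1_[set w | Zinf (s + i%:R / l%:R) w < r + dl] w + 2 * kp)) <= E * (E * (3 * p)).
  apply: (le_trans soft); apply: ler_pM => //.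
  - by rewrite exprn_ge0// addr_ge0// divr_ge0 ?mulr_ge0// ltW.
  - exact: pr_ge0.
  rewrite /E [_ * N%:R]mulrC expRM_natl lerXn2r// ?nnegrE ?expR_ge0//.
    by rewrite addr_ge0// divr_ge0 ?mulr_ge0// ltW.
  apply: le_trans (expR_ge1Dx _); rewrite lerD2l; exact: kp2.
have h1 : E^-1 * Pk <= E * (E * (E * (3 * p))).
  apply: (@le_trans _ _ ((1 - kp) ^+ N * Pk)).
    rewrite ler_wpM2r ?pr_ge0// /E -expRN -mulNr [_ * N%:R]mulrC expRM_natl.
    by rewrite lerXn2r// ?nnegrE ?expR_ge0// subr_ge0 ltW.
  apply: (le_trans cmp); apply: ler_pM => //.
  - apply: Rintegral_ge0 => w _; apply: prodr_ge0 => i _.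
    by rewrite addr_ge0// mulr_ge0// ltW.
  rewrite ler_expR; apply: le_trans (ler_wpM2l C0 exc) _.
  set u := e / 4 / (C + 1).
  have u0 : 0 <= u by rewrite /u !divr_ge0// ltW.
  have -> : e / 4 / 2 / (C + 1) = u / 2 by rewrite /u mulrAC.
  have -> : e / 4 = u * (C + 1) by rewrite /u divfK ?lt0r_neq0.
  have -> : C * (2 * N%:R * (u / 2)) = u * C * N%:R by field.
  by rewrite ler_wpM2r// ler_wpM2l// lerDl.
move: h1; rewrite ler_pdivrMl// => /le_trans; apply.
have -> : e * N%:R = e / 4 * N%:R + (e / 4 * N%:R + (e / 4 * N%:R + e / 4 * N%:R)).
  by field.
by rewrite !expRD -/E le_eqVlt; apply/orP; left; apply/eqP; ring.
Qed.

(** With [N] fixed only finitely many lags occur, so the entire excess becomes small, and not merely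
    small per grid point. The limit process is now the one bounded from above. *)
Lemma ap_excess_small (l N : nat) (u : R) : 0 < u -> exists K, (1 <= K)%N /\
  forall k s, (K <= k)%N -> 0 <= s ->
  excess (fun i j : 'I_N => Ainf `|0 + i%:R / l%:R - (0 + j%:R / l%:R)|)
    (fun i j : 'I_N => A k (s + i%:R / l%:R) (s + j%:R / l%:R)) <= u.
Proof.
move=> u0; have d0 : 0 < u / 2 / N.+1%:R / N.+1%:R by rewrite !divr_gt0.
have [K [K1 HK]] := corr_cvg_finite Acvg l N d0.
exists K; split => // k s kK s0.
have k1 : (1 <= k)%N by exact: leq_trans kK.
have t0 (i : 'I_N) : 0 <= s + i%:R / l%:R by rewrite addr_ge0// divr_ge0.
have N0 : N.+1%:R != 0 :> R by rewrite pnatr_eq0.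
apply: (@le_trans _ _ (2 * N%:R * (N%:R * (u / 2 / N.+1%:R / N.+1%:R)))); last first.
  have -> : 2 * N%:R * (N%:R * (u / 2 / N.+1%:R / N.+1%:R)) =
     u * ((N%:R / N.+1%:R) * (N%:R / N.+1%:R)) :> R by field.
  rewrite ger_pMr// mulr_ile1// ?divr_ge0//;
    by rewrite ler_pdivrMr// mul1r ler_nat.
apply: excess_le.
- by move=> i j; rewrite distrC.
- by move=> i j; exact: (covC (Zcov k1)).
- by move=> i; rewrite A1// subrr normr0 Ainf1.
move=> i; apply: (@le_trans _ _ (\sum_(j < N) u / 2 / N.+1%:R / N.+1%:R)); last first.
  by rewrite sumr_const card_ord mulr_natl.
rewrite big_mkcond; apply: ler_sum => j _; case: ifP => [/ltnW ij|_]; last exact: ltW.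
rewrite (ap_dist l 0 ij) (ap_shift l s ij) ge_max ltW//=.
have := HK k _ kK (t0 i) _ (leq_ltn_trans (leq_subr i j) (ltn_ord j)).
by rewrite distrC => /ltW; apply: le_trans; exact: ler_norm.
Qed.

(** The covariance of the limit depends on differences of times only, so the block at 0 can be
    compared with the block of [Z k] at any [s]. The conclusion at some r' < r leaves the gap that
    the product over blocks consumes. *)
Lemma block_lower_bound (C eta e0 M r p e : R) : 0 < C -> 1 < eta -> 0 < e0 ->
  (forall k, (1 <= k)%N -> decorrelation_bound (A k) C eta e0) ->
  0 <= M -> 0 < p -> p <= pr Pinf (sup_lt Zinf 0 (0 + M) r) -> 0 < e < 1 ->
  exists r' K, [/\ r' < r, (1 <= K)%N & forall k s, (K <= k)%N -> 0 <= s ->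
    (1 - e) * p <= pr (P k) (sup_lt (Z k) s (s + M) r')].
Proof.
move=> C0 eta1 e00 Hdec M0 p0 Hp /andP[ee0 e1].
have ep0 : 0 < e * p by rewrite mulr_gt0.
have p1 : p <= 1.
  by apply: (le_trans Hp); apply: pr_le1; exact: measurable_sup_lt.
have ep1 : e * p < 1 by rewrite (le_lt_trans _ e1)// ler_piMr// ltW.
have [n Hn] : exists n : nat,
    (1 - e / 4) * p <= pr Pinf (all_le Zinf 0 (0 + M) (r - n.+1%:R^-1)).
  apply: contrapT => /forallNP H.
  suff : pr Pinf (sup_lt Zinf 0 (0 + M) r) <= (1 - e / 4) * p by nra.
  rewrite sup_ltP ?lerDl//; apply: pr_bigcup_le.
  - by move=> n; exact: measurable_all_le.
  - move=> n m nm w Hw t tM; apply: le_trans (Hw t tM) _.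
    by rewrite lerD2l lerN2 lef_pV2 ?posrE// ler_nat.
  by move=> n; move/negP : (H n); rewrite -ltNge => /ltW.
pose ga : R := n.+1%:R^-1; have ga0 : 0 < ga by rewrite invr_gt0.
(* From [a] one [h] goes to the comparison and one to chaining, which ends at r - ga / 4 < r. *)
pose a := r - ga / 2; pose h := ga / 8.
have h0 : 0 < h by rewrite divr_gt0.
(* The losses are e p / 4 from the margin, 4 t = e p / 8 from the soft comparison and e p / 8 from
   chaining, in total less than e p. *)
pose t := e * p / 32; have t0 : 0 < t by rewrite divr_gt0.
have e80 : 0 < e * p / 8 by rewrite divr_gt0.
have [m0 Hm0] := uniform_chaining C0 eta1 e00 M0 h0 e80.
pose l := mesh m0; pose N := (nfloor (M * l%:R)).+1.
have below_a : (1 - e / 4) * p <= pr Pinf (below (fun t w => Zinf t w) (ap l N 0) a).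
  apply: (le_trans Hn); apply: pr_le.
  - exact: measurable_all_le.
  - exact: measurable_below_seq.
  move=> w Hw x xg.
  have [i xE iM] := mem_grid (mesh_gt0 m0) M0 xg.
  have /Hw : 0 <= x <= 0 + M by rewrite xE !add0r divr_ge0.
  move=> /le_lt_trans; apply; rewrite /a -/ga.
  by rewrite ltrD2l ltrN2 ltr_pdivrMr// ltr_pMr// ltr1n.
have [kp [kp01 kpt Hb2 Hb1]] := soft_parameter N t0.
have kp0 : 0 < kp by have /andP[] := kp01.
have [Cc Cc0 HC] := gaussian_comparison a h0 kp01.
have Cc1 : 0 < Cc + 1 by rewrite ltr_wpDl.
have lnt : 0 < ln (1 + t) by rewrite ln_gt0// ltrDl.
have u0 : 0 < ln (1 + t) / (Cc + 1) by rewrite divr_gt0.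
have [K [K1 HK]] := ap_excess_small l N u0.
exists (a + h + h), K; split => //.
  by rewrite /a /h; lra.
move=> k s kK s0.
have k1 : (1 <= k)%N by exact: leq_trans kK.
have chain := Hm0 _ _ _ _ _ (Zg k1) (Zc k1) (Zcont k1) (Zcov k1)
  (fun s => A1 k1) (Hdec k k1) s (a + h + h) s0.
rewrite addrK in chain.
have diag (i : 'I_N) : Ainf `|0 + i%:R / l%:R - (0 + i%:R / l%:R)| =
    A k (s + i%:R / l%:R) (s + i%:R / l%:R).
  by rewrite A1 ?subrr ?normr0 ?Ainf1// addr_ge0// divr_ge0.
have := HC _ _ _ _ _ _ _ _ _ _ _ (gvec_ap Zig Zic Zicov l N (lexx 0))
  (gvec_ap (Zg k1) (Zc k1) (Zcov k1) l N s0) diag.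
rewrite card_ord => cmp.
rewrite below_ap in below_a.
move: below_a cmp; set x := pr Pinf _ => below_a cmp.
have mY (i : 'I_N) : measurable_fun setT (fun w => Z k (s + i%:R / l%:R) w).
  exact: measurable_process.
have soft := soft_prod_le (P k) (a + h) (ltW (mulr_gt0 (ltr0n R 2) kp0)) mY.
rewrite card_ord in soft.
move: chain; rewrite (_ : grid _ _ _ = ap l N s)// below_ap.
set y := pr (P k) [set w | _] in soft *; set z := pr (P k) (sup_lt _ _ _ _) => chain.
have y0 : 0 <= y by exact: pr_ge0.
have x0 : 0 <= x by exact: pr_ge0.
have x1 : x <= 1 by apply: pr_le1; exact: measurable_all_lt.
have tp1 : (1 - t) * x <= (1 + t) * ((1 + t) * (y + t)).
  apply: (@le_trans _ _ ((1 - kp) ^+ N * x)); first by rewrite ler_wpM2r.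
  apply: (le_trans cmp); apply: ler_pM; first exact: expR_ge0.
  - apply: Rintegral_ge0 => w _; apply: prodr_ge0 => i _.
    by rewrite addr_ge0// mulr_ge0// ltW.
  - rewrite -[leRHS]lnK ?posrE ?addr_gt0// ler_expR.
    apply: le_trans (ler_wpM2l Cc0 (HK k s kK s0)) _.
    by rewrite mulrCA ger_pMr// ler_pdivrMr// mul1r lerDl.
  apply: (le_trans soft); apply: ler_pM => //.
  - by rewrite exprn_ge0// addr_ge0// mulr_ge0// ltW.
  - by rewrite addr_ge0// mulr_ge0// ltW.
  by rewrite lerD2l.
have := le_of_soft_bound t0 x1 y0 tp1; move: chain below_a ep0; rewrite /t; clear.
lra.
Qed.

(** One exp (e T) each for the comparison on the grid, for the passage from the grid to the
    supremum, and for the constant 3 / q. *)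
Lemma persistence_upper (l : nat) (r e T0 : R) : corr_tails A l -> (0 < l)%N ->
  0 < e ->
  (forall T, T0 <= T -> pr Pinf (below (fun t w => Zinf t w)
      (ap l `|Num.ceil (T * l%:R)|%N l%:R^-1) r) <=
    expR (e * T) * pr Pinf (sup_lt Zinf 0 T r)) ->
  exists K, forall k (T : R), (K <= k)%N -> K%:R <= T ->
    pr (P k) (sup_lt (Z k) 0 T r) <= expR (3 * e * T) * pr Pinf (sup_lt Zinf 0 T r).
Proof.
move=> Htail l0 e0 HT0.
have lR : 0 < l%:R :> R by rewrite ltr0n.
have il0 : 0 <= l%:R^-1 :> R by rewrite invr_ge0 ltW.
have el0 : 0 < e / l%:R by rewrite divr_gt0.
have [K1 [K11 HK1]] := ap_upper_bound r Htail el0.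
pose q : R := Phi r.
have q0 : 0 < q by exact: Phi_gt0.
(* The entries ensure in turn the comparison, T >= T0, 3 / q <= exp (e T), and T >= 2, which keeps
   [n.-1] positive. *)
pose K := maxn K1 (maxn (nfloor `|T0|).+1 (maxn (nfloor `|ln (3 / q) / e|).+1 2)).
exists K => k T; rewrite !geq_max => /and4P[kK1 _ _ _] KT.
have k1 : (1 <= k)%N by exact: leq_trans kK1.
have T0T : T0 <= T.
  by rewrite (le_trans (le_nfloorS _))// (le_trans _ KT)// ler_nat !leq_max leqnn !orbT.
have T2 : 2 <= T by rewrite (le_trans _ KT)// ler_nat !leq_max leqnn !orbT.
have Tq : ln (3 / q) <= e * T.
  rewrite -ler_pdivrMl// mulrC (le_trans (le_nfloorS _))//.
  by rewrite (le_trans _ KT)// ler_nat !leq_max leqnn !orbT.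
have Tge0 : 0 <= T by exact: le_trans T2.
have Tl0 : 0 <= T * l%:R by rewrite mulr_ge0.
have l1 : 1 <= l%:R :> R by rewrite ler1n.
have Tl2 : 2 <= T * l%:R by rewrite (le_trans T2)// ler_peMr.
set n := `|Num.ceil (T * l%:R)|%N in HT0 *.
have nE : n%:R = (Num.ceil (T * l%:R))%:~R :> R.
  by rewrite /n natr_absz ger0_norm// ceil_ge0 (lt_le_trans _ Tl0)// ltrN10.
have n2 : (2 <= n)%N by rewrite -(ler_nat R) nE (le_trans Tl2)// ceil_ge.
have n1 : n.-1%:R <= T * l%:R.
  apply: ltW; rewrite -(ltrD2r 1) natr1 prednK ?(ltnW n2)// nE.
  by have := ceilB1_lt (T * l%:R); rewrite intrB ltrBlDr.
have n10 : (0 < n.-1)%N by rewrite -ltnS prednK// ltnW.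
(* The last grid time n / l may exceed [T]. The comparison uses the first n - 1 points, which lie in
   [0, T]; restoring the last one costs a factor 1 / q, by association. *)
have E : ap l n (l%:R^-1 : R) = ap l n.-1 l%:R^-1 ++ [:: l%:R^-1 + n.-1%:R / l%:R].
  by rewrite /ap -{1}(prednK (ltnW n2)) -addn1 iotaD map_cat.
have ap0 (x : R) : x \in ap l n.-1 l%:R^-1 -> 0 <= x by exact: ap_ge0.
have last0 (x : R) : x \in [:: l%:R^-1 + n.-1%:R / l%:R] -> 0 <= x.
  by rewrite inE => /eqP ->; rewrite addr_ge0// divr_ge0.
have cat := pr_below_cat Zig Zic Zicov Ai1 Ai0 r ap0 last0.
rewrite -E /= expr1 in cat.
have up := HK1 k n.-1 l%:R^-1 kK1 n10 il0.
have sup_le : pr (P k) (sup_lt (Z k) 0 T r) <=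
    pr (P k) (below (fun t w => Z k t w) (ap l n.-1 l%:R^-1) r).
  apply: pr_le.
  - by rewrite -[T]add0r; exact: (measurable_sup_lt (Zcont k1)).
  - exact: measurable_below_seq.
  rewrite -[T]add0r; apply: sup_lt_below => // x xg.
  rewrite ap0//= !add0r; case/mapP : xg => i; rewrite mem_iota add0n => /andP[_ ni] ->.
  rewrite -{1}[l%:R^-1]mul1r -mulrDl addrC natr1 ler_pdivrMr//.
  by rewrite (le_trans _ n1)// ler_nat.
apply: (le_trans sup_le); apply: (le_trans up).
have h1 : pr Pinf (below (fun t w => Zinf t w) (ap l n.-1 l%:R^-1) r) <=
    q^-1 * (expR (e * T) * pr Pinf (sup_lt Zinf 0 T r)).
  by rewrite ler_pdivlMl// mulrC (le_trans cat)// HT0.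
have h2 : 3 * expR (e / l%:R * n.-1%:R) <= 3 * expR (e * T).
  rewrite ler_pM2l// ler_expR mulrAC ler_pdivrMr// -mulrA ler_pM2l//.
apply: (le_trans (ler_pM _ _ h2 h1)); first by rewrite mulr_ge0// expR_ge0.
  exact: pr_ge0.
have -> : 3 * e * T = e * T + (e * T + e * T) by ring.
rewrite !expRD.
have h3 : 3 / q <= expR (e * T).
  by rewrite -[leLHS]lnK ?posrE ?divr_gt0// ler_expR.
have -> : 3 * expR (e * T) * (q^-1 * (expR (e * T) * pr Pinf (sup_lt Zinf 0 T r))) =
  3 / q * (expR (e * T) * expR (e * T) * pr Pinf (sup_lt Zinf 0 T r)) by ring.
rewrite -[leRHS]mulrA ler_wpM2r// mulr_ge0 ?pr_ge0// mulr_ge0// expR_ge0.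
Qed.

(** A supremum serves on both sides: it bounds the logarithm at every large [T], and some finite [M]
    comes within [e] of it. No limit has to be shown to exist. *)
Lemma persistence_lower (C eta e0 T0 r e : R) : 0 < C -> 1 < eta -> 0 < e0 ->
  (forall k, (1 <= k)%N -> decorrelation_bound (A k) C eta e0) -> 0 < e ->
  (forall T, T0 <= T -> 0 < pr Pinf (sup_lt Zinf 0 T r)) ->
  exists K, forall k (T : R), (K <= k)%N -> K%:R <= T ->
    expR (- (3 * e * T)) * pr Pinf (sup_lt Zinf 0 T r) <=
    pr (P k) (sup_lt (Z k) 0 T r).
Proof.
move=> C0 eta1 e00 Hdec ee0 HT0.
pose a T := ln (pr Pinf (sup_lt Zinf 0 T r)).
pose T1 := Num.max T0 1.
have T1p T : T1 <= T -> [/\ T0 <= T, 1 <= T & 0 < T].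
  by rewrite ge_max => /andP[T0T T1T]; split => //; exact: lt_le_trans T1T.
have aT T : T1 <= T -> pr Pinf (sup_lt Zinf 0 T r) = expR (a T).
  by move=> /T1p[T0T _ _]; rewrite lnK// posrE HT0.
have a0 T : T1 <= T -> a T <= 0.
  move=> /T1p[T0T _ Tp]; apply: ln_le0; apply: pr_le1.
  by rewrite -[T]add0r; apply: measurable_sup_lt => //; exact: ltW.
pose S := [set a T / T | T in [set T | T1 <= T]].
have S_ub : ubound S 0.
  by move=> _ /= [T T1T <-]; have [_ _ Tp] := T1p _ T1T; rewrite pmulr_lle0 ?invr_gt0 ?a0.
have S_sup : has_sup S.
  split; first by exists (a T1 / T1); exists T1 => /=.
  by exists 0.
(* Plays the role of minus the persistence exponent. *)
pose b := sup S.
have b0 : b <= 0 by apply: ge_sup => //; exact: S_sup.1.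
have bS T : T1 <= T -> a T <= b * T.
  move=> T1T; have [_ _ Tp] := T1p _ T1T.
  by rewrite -ler_pdivrMr//; apply: ub_le_sup; [exact: S_sup.2|exists T].
have [_ [M T1M <-] Mb] := sup_adherent ee0 S_sup.
rewrite -/b in Mb.
have [_ M1 Mp] := T1p _ T1M.
have {}Mb : (b - e) * M <= a M by rewrite -ler_pdivlMr// ltW.
have eM : 0 < e * M by rewrite mulr_gt0.
(* The relative loss is chosen such that a block keeps exactly the factor exp (- e M). *)
have e'01 : 0 < 1 - expR (- (e * M)) < 1.
  by rewrite subr_gt0 expR_lt1 oppr_lt0 eM/= gtrBl expR_gt0.
have pM : expR (a M) <= pr Pinf (sup_lt Zinf 0 (0 + M) r) by rewrite add0r aT.
have [r' [K1 [r'r K11 HK1]]] :=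
  block_lower_bound C0 eta1 e00 Hdec (ltW Mp) (expR_gt0 (a M)) pM e'01.
rewrite subKr -expRD in HK1.
(* The last entry lets e T pay for the one block in excess of T / M, whose cost is at most M (2 e -
   b). *)
exists (maxn K1 (maxn (nfloor `|T1|).+1 (nfloor `|M * (2 * e - b) / e|).+1)) => k T.
rewrite !geq_max => /and3P[kK1 _ _] KT.
have k1 : (1 <= k)%N by exact: leq_trans kK1.
have T1T : T1 <= T.
  by rewrite (le_trans (le_nfloorS _))// (le_trans _ KT)// ler_nat !leq_max leqnn !orbT.
have TM : M * (2 * e - b) <= e * T.
  rewrite -ler_pdivrMl// mulrC (le_trans (le_nfloorS _))//.
  by rewrite (le_trans _ KT)// ler_nat !leq_max leqnn !orbT.
have [_ _ Tp] := T1p _ T1T.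
set ql := expR (- (e * M) + a M) in HK1.
have blocks := pr_sup_lt_blocks (Zg k1) (Zc k1) (Zcont k1) (Zcov k1)
  (fun s t => A0 k1) Mp (ltW Tp) r'r (expR_ge0 _) (fun s => HK1 k s kK1).
rewrite add0r in blocks; apply: le_trans blocks.
rewrite aT// -expRD -expRM_natl ler_expR.
have nT : (nfloor (T / M)).+1%:R <= T / M + 1.
  by rewrite -natr1 lerD2r nfloor_le// divr_ge0// ltW.
set n := (nfloor (T / M)).+1 in nT *.
have aM0 : - (e * M) + a M <= 0 by have := a0 _ T1M; lra.
apply: (@le_trans _ _ ((T / M + 1) * (- (e * M) + a M))); last first.
  by rewrite ler_wnM2r.
have : (T / M + 1) * ((b - 2 * e) * M) <= (T / M + 1) * (- (e * M) + a M).
  apply: ler_wpM2l; first by rewrite addr_ge0// divr_ge0// ltW.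
  have -> : (b - 2 * e) * M = - (e * M) + (b - e) * M by ring.
  by rewrite lerD2l.
apply: le_trans.
have -> : (T / M + 1) * ((b - 2 * e) * M) = T * (b - 2 * e) - M * (2 * e - b).
  by have M0 := lt0r_neq0 Mp; field.
have := bS _ T1T; lra.
Qed.

End limit_comparison.

(** * From upper limits in the extended reals to real inequalities *)

Section extended_reals.
Variable R : realType.

Lemma limf_esup_lt (T : choiceType) (X : filteredType T) (f : X -> \bar R)
    (F : set_system X) (c : \bar R) : (limf_esup f F < c)%E ->
  exists2 V, F V & forall x, V x -> (f x < c)%E.
Proof.
move=> /ereal_inf_lt[_ [V FV <-] Vc]; exists V => // x Vx.
by apply: le_lt_trans Vc; apply: ereal_sup_ubound; exists x.
Qed.

Lemma corr_cvg_uniform (A : nat -> R -> R -> R) (Ainf : R -> R) :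
  (forall tau, 0 <= tau ->
    {uniform `[0, +oo[, (fun k s => A k s (s + tau)) @ \oo -->
                        (fun _ : R => Ainf tau)}) ->
  corr_cvg A Ainf.
Proof.
move=> Acvg tau e tau0 e0.
pose E := [set xy : R * R | `|xy.1 - xy.2| < e].
have entE : entourage E.
  have := @entourage_ball R R (PosNum e0); apply: filterS => -[x y] /=.
  by rewrite /ball/=.
have : nbhs ((fun _ : R => Ainf tau) : {uniform` `[0, +oo[ -> R})
    [set h | forall y, `[0, +oo[%classic y -> E (Ainf tau, h y)].
  by apply/uniform_nbhs; exists E; split.
move=> /(Acvg tau tau0)[K _ HK]; exists K => k s kK s0.
rewrite distrC; apply: (HK k kK s).
by rewrite /= in_itv/= s0.
Qed.

Lemma corr_tails_limsup (A : nat -> R -> R -> R) (l : nat) :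
  (forall k s t, (1 <= k)%N -> 0 <= s -> 0 <= t -> 0 <= A k s t) ->
  (fun L : nat => limn_esup (fun k : nat =>
     (\sum_(L <= i <oo) sup_corr (A k) (i%:R / l%:R))%E)) @ \oo --> (0%E : \bar R) ->
  corr_tails A l.
Proof.
move=> A0 Ha e e0.
have sc k s tau : 0 <= s -> ((A k s (s + tau))%:E <= sup_corr (A k) tau)%E.
  by move=> s0; apply: ereal_sup_ubound; exists s => //=; rewrite in_itv/= s0.
have sc0 k tau : (1 <= k)%N -> 0 <= tau -> (0 <= sup_corr (A k) tau)%E.
  move=> k1 tau0; apply: le_trans (sc k 0 tau (lexx 0)).
  by rewrite lee_fin A0// add0r.
have [L HL] : exists L : nat, (limn_esup (fun k : nat =>
     (\sum_(L <= i <oo) sup_corr (A k) (i%:R / l%:R))%E) < e%:E)%E.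
  move/fine_cvgP : Ha => [[L1 _ HL1] /cvgrPdist_lt/(_ _ e0)[L2 _ HL2]].
  exists (maxn L1 L2).
  have := HL1 _ (leq_maxl L1 L2); have := HL2 _ (leq_maxr L1 L2) => /=.
  rewrite sub0r normrN => H fn; rewrite -(fineK fn) lte_fin.
  by apply: le_lt_trans H; exact: ler_norm.
have [V [K _ HK] HV] := limf_esup_lt HL.
(* Non-negativity is only given from index 1 on. *)
exists L, (maxn K 1) => k s n; rewrite geq_max => /andP[kK k1] s0.
rewrite -lee_fin; apply: le_trans (ltW (HV k (HK k kK))).
have t0 (m : nat) : 0 <= m%:R / l%:R :> R by rewrite divr_ge0.
apply: le_trans (nneseries_lim_ge n _); last by move=> m _ _; exact: sc0.
rewrite -sumEFin; apply: lee_sum => m _; exact: sc.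
Qed.

Lemma decorrelation_limsup (A : nat -> R -> R -> R) (Ainf : R -> R) (eta : R) :
  (limf_esup (fun eps : R =>
     (`|ln eps| `^ eta)%:E * sup_decorr A Ainf eps) (0%R)^'+ < +oo)%E ->
  exists C e0, [/\ 0 < C, 0 < e0 &
    forall k, (1 <= k)%N -> decorrelation_bound (A k) C eta e0].
Proof.
move=> /ereal_inf_lt[_ [V V0 <-] VC].
have [e0 /= e00 HV] : exists2 e0 : R, 0 < e0 & forall eps, 0 < eps < e0 -> V eps.
  move: V0 => /nbhs_ballP[e0 /= e00 He]; exists e0 => // eps /andP[eps0 epse].
  by apply: He => //=; rewrite /ball/= sub0r normrN gtr0_norm.
set S := ereal_sup _ in VC.
have [C C0 SC] : exists2 C : R, 0 < C & (S <= C%:E)%E.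
  case: S VC => [x _|//|_]; last by exists 1 => //; exact: leNye.
  exists (`|x| + 1); first by rewrite ltr_wpDl.
  by rewrite lee_fin (le_trans (ler_norm _))// lerDl.
exists C, e0; split => // k k1 s eps tau s0 /andP[eps0 epse] tau_eps.
rewrite -lee_fin; apply: le_trans SC.
apply: (@le_trans _ _ ((`|ln eps| `^ eta)%:E * sup_decorr A Ainf eps)%E); last first.
  by apply: ereal_sup_ubound; exists eps => //; apply: HV; rewrite eps0.
rewrite mulrC EFinM lee_wpmul2l ?lee_fin ?powR_ge0//.
by apply: ereal_sup_ubound; left; exists k, s, tau.
Qed.

(* If x or y is 0, the difference of the logarithms is infinite in \bar R. *)
Lemma lne_dist_lt (x y T e : R) : 0 <= x -> 0 <= y -> 0 < T ->
  ((T^-1)%:E * `|lne x%:E - lne y%:E| < e%:E)%E ->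
  [/\ 0 < x, 0 < y & `|ln x - ln y| < e * T].
Proof.
move=> x0 y0 T0; rewrite /lne.
have infty (z : \bar R) : `|z|%E = +oo%E -> ((T^-1)%:E * `|z| < e%:E)%E -> False.
  by move=> ->; rewrite gt0_muley ?lte_fin ?invr_gt0// ltNge leey.
case: ifPn => [xle|]; first by case: ifPn => _ /infty => /(_ erefl).
rewrite -ltNge => xgt; case: ifPn => [yle|]; first by move=> /infty => /(_ erefl).
rewrite -ltNge => ygt; rewrite -EFinB abse_EFin -EFinM lte_fin.
by rewrite ltr_pdivrMl// mulrC => H; split.
Qed.

Lemma bigmaxe_lt (I : eqType) (s : seq I) (F : I -> \bar R) (r : R) :
  ((\big[maxe/-oo]_(i <- s) F i < r%:E)%E) <-> (forall i, i \in s -> (F i < r%:E)%E).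
Proof.
elim: s => [|i s IH]; first by rewrite big_nil ltNyr.
rewrite big_cons gt_max; split.
  move=> /andP[Fi /IH H] j; rewrite inE => /predU1P[->//|]; exact: H.
move=> H; rewrite H ?mem_head//=; apply/IH => j js; apply: H.
by rewrite inE js orbT.
Qed.

(** The suprema decrease in M, so the limit is their infimum. *)
Lemma joint_limsup_eq0 (a : nat -> R -> \bar R) :
  (forall k T, 0 <= T -> (0 <= a k T)%E) ->
  (forall e, 0 < e -> exists K : nat, forall k T, (K <= k)%N -> K%:R <= T ->
     (a k T <= e%:E)%E) -> joint_limsup a = 0%E.
Proof.
move=> a0 ae; rewrite /joint_limsup.
set u := fun M : nat => ereal_sup _.
have un : {homo u : m n / (m <= n)%N >-> (n <= m)%E}.
  move=> m n mn; apply: ge_ereal_sup => _ [p [p1 p2] <-].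
  apply: ereal_sup_ubound; exists p => //; split; first exact: leq_trans p1.
  by rewrite (le_trans _ p2)// ler_nat.
rewrite (cvg_lim _ (ereal_nonincreasing_cvgn un))//.
apply/eqP; rewrite eq_le; apply/andP; split.
  apply/lee_addgt0Pr => e e0; rewrite add0e.
  have [K HK] := ae e e0.
  apply: (@le_trans _ _ (u K)); first by apply: ereal_inf_lbound; exists K.
  by apply: ge_ereal_sup => _ [p [p1 p2] <-]; exact: HK.
apply: le_ereal_inf_tmp => _ [M _ <-].
apply: (@le_trans _ _ (a M M%:R)); first exact: a0.
by apply: ereal_sup_ubound; exists (M, M%:R).
Qed.

End extended_reals.

Section probabilities.
Context d (Omega : measurableType d) (R : realType) (P : probability Omega R).
Variable Z : R -> {RV P >-> R}.

Lemma prob_sup_ltE T r : continuous_paths Z -> 0 <= T ->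
  prob_sup_lt Z T r = (pr P (sup_lt Z 0 T r))%:E.
Proof.
move=> contZ T0; rewrite prE//.
by have := measurable_sup_lt contZ r (lexx 0) T0; rewrite add0r.
Qed.

(** The indices 1, ..., n of the maximum become a progression of length n with first term 1 / l; for
    n = 0 both events are the whole space. *)
Lemma prob_max_ltE (l : nat) T r :
  prob_max_lt Z l T r =
  (pr P (below (fun t w => Z t w) (ap l `|Num.ceil (T * l%:R)|%N l%:R^-1) r))%:E.
Proof.
rewrite prE; last exact: measurable_below_seq.
rewrite /prob_max_lt; congr (P _); set n := `|_|%N.
have E (i : nat) : l%:R^-1 + i%:R / l%:R = i.+1%:R / l%:R :> R.
  by rewrite -{1}[l%:R^-1]mul1r -mulrDl addrC natr1.
apply/seteqP; split => w /=.
  move/bigmaxe_lt => H t /mapP[i]; rewrite mem_iota add0n => /andP[_ i_n] ->.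
  rewrite E -lte_fin; apply: (H i.+1); rewrite mem_index_iota ltnS//.
move=> H; apply/bigmaxe_lt => -[|i]; rewrite mem_index_iota// ltnS => i_n.
rewrite lte_fin -E; apply: H; apply/mapP; exists i => //.
by rewrite mem_iota.
Qed.

End probabilities.

Theorem theorem3p6 (R : realType)
    (d : nat -> measure_display) (Omega : forall k : nat, measurableType (d k))
    (P : forall k : nat, probability (Omega k) R)
    (Z : forall k : nat, R -> {RV (P k) >-> R})
    (A : nat -> R -> R -> R)
    (dinf : measure_display) (Omegainf : measurableType dinf)
    (Pinf : probability Omegainf R) (Zinf : R -> {RV Pinf >-> R})
    (Ainf : R -> R)
    (Z_gauss : forall k, (1 <= k)%N -> gaussian_process (Z k))
    (Z_centered : forall k, (1 <= k)%N -> centered_process (Z k))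
    (Z_cont : forall k, (1 <= k)%N -> continuous_paths (Z k))
    (Z_cov : forall k, (1 <= k)%N -> has_covariance (Z k) (A k))
    (A_unit : forall k s, (1 <= k)%N -> 0 <= s -> A k s s = 1)
    (A_ge0 : forall k s t, (1 <= k)%N -> 0 <= s -> 0 <= t -> 0 <= A k s t)
    (Zinf_gauss : gaussian_process Zinf)
    (Zinf_centered : centered_process Zinf)
    (Zinf_stationary : stationary_process Zinf)
    (Zinf_cont : continuous_paths Zinf)
    (Zinf_cov : has_covariance Zinf (fun s t => Ainf `|s - t|))
    (Ainf_unit : Ainf 0 = 1)
    (Ainf_ge0 : forall tau, 0 <= tau -> 0 <= Ainf tau)
    (A_cvg : forall tau, 0 <= tau ->
      {uniform `[0, +oo[, (fun k s => A k s (s + tau)) @ \oo -->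
                          (fun _ : R => Ainf tau)})
    (hyp_a : forall l : nat, (1 <= l)%N ->
      (fun L : nat => limn_esup (fun k : nat =>
         (\sum_(L <= i <oo) sup_corr (A k) (i%:R / l%:R))%E)) @ \oo -->
      (0%E : \bar R))
    (hyp_b : exists2 eta : R, 1 < eta &
      (limf_esup (fun eps : R =>
         (`|ln eps| `^ eta)%:E * sup_decorr A Ainf eps) (0%R)^'+ < +oo)%E)
    (hyp_c : forall r : R,
      limn_esup (fun l : nat => limf_esup (fun T : R =>
        (T^-1)%:E * `|lne (prob_sup_lt Zinf T r)
                      - lne (prob_max_lt Zinf l T r)|)%E (pinfty_nbhs R))
      = 0%E) :
  forall r : R,
    joint_limsup (fun (k : nat) (T : R) =>
      (T^-1)%:E * `|lne (prob_sup_lt (Z k) T r)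
                    - lne (prob_sup_lt Zinf T r)|)%E
    = 0%E.
Proof.
move=> r.
have Acvg := corr_cvg_uniform A_cvg.
have Htail (l : nat) (l1 : (1 <= l)%N) := corr_tails_limsup A_ge0 (hyp_a l l1).
have [eta eta1 Hb] := hyp_b.
have [C [e0 [C0 e00 Hdec]]] := decorrelation_limsup Hb.
apply: joint_limsup_eq0 => [k T T0|e ee0].
  by rewrite mule_ge0// lee_fin invr_ge0.
(* Both persistence bounds lose 3 e' T in the logarithm. *)
pose e' := e / 3; have e'0 : 0 < e' by rewrite divr_gt0.
(* Condition (c) is used at a single [l]. Besides closeness it yields positivity, since a finite
   difference of logarithms excludes probability 0. *)
have [l [l1 [T0 HT0]]] : exists l : nat, (1 <= l)%N /\ exists T0 : R, forall T, T0 <= T ->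
    [/\ 0 < T, 0 < pr Pinf (sup_lt Zinf 0 T r) &
     pr Pinf (below (fun t w => Zinf t w) (ap l `|Num.ceil (T * l%:R)|%N l%:R^-1) r) <=
     expR (e' * T) * pr Pinf (sup_lt Zinf 0 T r)].
  have : (limn_esup (fun l : nat => limf_esup (fun T : R =>
        (T^-1)%:E * `|lne (prob_sup_lt Zinf T r)
                      - lne (prob_max_lt Zinf l T r)|)%E (pinfty_nbhs R))
      < e'%:E)%E by rewrite hyp_c lte_fin.
  move=> /limf_esup_lt[V [N _ HN]] /(_ _ (HN _ (leq_maxl N 1))).
  set l := maxn N 1; have l1 : (1 <= l)%N by exact: leq_maxr.
  move=> /limf_esup_lt[W [B [_ HB]] HW]; exists l; split => //.
  exists (Num.max (B + 1) 1) => T; rewrite ge_max => /andP[BT T1].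
  have Tp : 0 < T by exact: lt_le_trans T1.
  have /HB/HW : B < T by rewrite (lt_le_trans _ BT)// ltrDl.
  rewrite (prob_sup_ltE r Zinf_cont (ltW Tp)) prob_max_ltE.
  move=> /(lne_dist_lt (pr_ge0 _ _) (pr_ge0 _ _) Tp)[p0 q0].
  set p := pr Pinf (sup_lt _ _ _ _) in p0 *; set q := pr Pinf _ in q0 *.
  rewrite ltr_distlC => /andP[_ pq]; split => //.
  rewrite -[q in q <= _]lnK ?posrE// -[p in _ * p]lnK ?posrE// -expRD ler_expR.
  by rewrite addrC ltW.
have [K1 HK1] := persistence_upper Z_gauss Z_centered Z_cont Z_cov A_unit A_ge0
  Zinf_gauss Zinf_centered Zinf_cov Ainf_unit Ainf_ge0 Acvg
  (Htail l l1) l1 e'0 (fun T TT => let: And3 _ _ H := HT0 T TT in H).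
have [K2 HK2] := persistence_lower Z_gauss Z_centered Z_cont Z_cov A_unit A_ge0
  Zinf_gauss Zinf_centered Zinf_cont Zinf_cov Ainf_unit Acvg
  C0 eta1 e00 Hdec e'0 (fun T TT => let: And3 _ H _ := HT0 T TT in H).
(* The successor entry gives both T >= T0 and k >= 1. *)
exists (maxn (maxn K1 K2) (nfloor `|T0|).+1) => k T.
rewrite !geq_max => /andP[/andP[kK1 kK2] k0] KT.
have k1 : (1 <= k)%N by exact: leq_trans k0.
have [T1 T2] : K1%:R <= T /\ K2%:R <= T.
  by split; rewrite (le_trans _ KT)// ler_nat !leq_max leqnn ?orbT.
have T0T : T0 <= T.
  by rewrite (le_trans (le_nfloorS _))// (le_trans _ KT)// ler_nat leq_max leqnn orbT.
have [Tp p0 _] := HT0 T T0T.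
rewrite (prob_sup_ltE r Zinf_cont (ltW Tp)) (prob_sup_ltE r (Z_cont k k1) (ltW Tp)).
have up := HK1 k T kK1 T1; have lo := HK2 k T kK2 T2.
set p := pr Pinf _ in p0 up lo *; set q := pr (P k) _ in up lo *.
have q0 : 0 < q by apply: lt_le_trans lo; rewrite mulr_gt0// expR_gt0.
have e3 : 3 * e' = e by rewrite /e' mulrC divfK.
rewrite !lne_EFin// -EFinB abse_EFin -EFinM lee_fin ler_pdivrMl// mulrC.
rewrite ler_distl; apply/andP; split.
  rewrite lerBlDl -ler_expR expRD !lnK ?posrE//.
  by rewrite -ler_pdivrMl ?expR_gt0// -expRN -e3.
by rewrite -ler_expR addrC expRD !lnK ?posrE// -e3.
Qed.
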